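(* Let $s\in(3/2,2)$. The tangent-point energy $E:\mathcal M\to\mathbb R$ is smooth (infinitely often Fréchet differentiable). Its first derivative is given by $$DE(\gamma)\,u=2\,B^1_\gamma(\gamma,u)-p\,B^2_\gamma(\gamma,u)+B^3_\gamma(\gamma,u)\quad\text{with}\quad p=2s+1$$ for $\gamma\in\mathcal M$, $u\in H^s(\mathbb T;\mathbb R^m)$.
   Context: Let $m\in\mathbb N$, $s\in(3/2,2)$, $\mathbb T=\mathbb R/\mathbb Z$ with Lebesgue measure $\lambda$ and distance $\varrho_{\mathbb T}(x,y)=\min_{k\in\mathbb Z}|x-y+k|$. $H^s(\mathbb T;\mathbb R^m)$ is the Sobolev–Slobodeckij Hilbert space with norm $\|u\|_{H^s}^2=\int_{\mathbb T}|u|^2d\lambda+\int_{\mathbb T}|u'|^2d\lambda+\int_{\mathbb T}\int_{\mathbb T}\frac{|u'(y)-u'(x)|^2}{\varrho_{\mathbb T}(y,x)^{2s-1}}\,d\lambda(y)\,d\lambda(x)$; it embeds continuously into $C^1$. An embedding is an immersion ($\gamma'\neq0$ everywhere) that is a homeomorphism onto its image. $\mathcal M=\{\gamma\in H^s(\mathbb T;\mathbb R^m):\gamma\text{ is an embedding}\}$ is an open subset of $H^s(\mathbb T;\mathbb R^m)$. For $\gamma\in\mathcal M$ and $u:\mathbb T\to\mathbb R^m$ of class $C^1$ put $D_\gamma u=u'/|\gamma'|$, $\mathcal D_\gamma u(x)=\frac{u'(x)\gamma'(x)^\top}{|\gamma'(x)|^2}$, $d\omega_\gamma(x)=|\gamma'(x)|\,d\lambda(x)$,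 $d\mu_\gamma(x,y)=\frac{d\omega_\gamma(y)\,d\omega_\gamma(x)}{|\gamma(y)-\gamma(x)|}$, and $$\mathcal R^s_\gamma u(x,y)=\frac{u(y)-u(x)-\mathcal D_\gamma u(x)(\gamma(y)-\gamma(x))}{|\gamma(y)-\gamma(x)|^s}.$$ The tangent-point energy is $E(\gamma)=\iint|\mathcal R^s_\gamma\gamma(x,y)|^2\,d\mu_\gamma(x,y)$. Moreover, $B^1_\gamma(u,v)=\iint\langle\mathcal R^s_\gamma u,\mathcal R^s_\gamma v\rangle\,d\mu_\gamma$, $B^2_\gamma(u,v)=\iint|\mathcal R^s_\gamma\gamma(x,y)|^2\Big\langle\frac{u(y)-u(x)}{|\gamma(y)-\gamma(x)|},\frac{v(y)-v(x)}{|\gamma(y)-\gamma(x)|}\Big\rangle d\mu_\gamma(x,y)$, $B^3_\gamma(u,v)=\iint|\mathcal R^s_\gamma\gamma(x,y)|^2\big(\langle D_\gamma u(x),D_\gamma v(x)\rangle+\langle D_\gamma u(y),D_\gamma v(y)\rangle\big)d\mu_\gamma(x,y)$. All double integrals are over $\mathbb T\times\mathbb T$. *)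

(* Defs.v *)
From HB Require Import structures.
From mathcomp Require Import all_boot all_order all_algebra.
From mathcomp Require Import all_classical all_reals all_analysis.
From mathcomp Require Import measurable_realfun ring lra.

Set Implicit Arguments.
Unset Strict Implicit.
Unset Printing Implicit Defensive.

Import Order.TTheory GRing.Theory Num.Theory.
Import numFieldNormedType.Exports.

Local Open Scope ring_scope.
Local Open Scope classical_set_scope.

Local Notation "f ^` ()" := (derive1 f) : ring_scope.

Section BoundedLinear.
Context {R : realType} (V W : normedModType R).

Definition blin_pred : {pred V -> W} :=
  [pred f : V -> W | `[< linear f /\ continuous f >]].

Lemma blin_submod_closed : submod_closed blin_pred.
Proof.
split.
- apply/asboolP; split; last by move=> x; exact: cvg_cst.
  by move=> a x y; rewrite -![(0 : V -> W) _]/(0 : W) scaler0 addr0.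
- move=> a f g /asboolP[lf cf] /asboolP[lg cg].
  apply/asboolP; split; last first.
    by move=> x; apply: cvgD; [apply: cvgZr; exact: cf|exact: cg].
  move=> b x y; rewrite -![(a *: f + g) _]/(a *: f _ + g _) lf lg.
  by rewrite !scalerDr !scalerA (mulrC b a) -!addrA; congr +%R; rewrite addrCA.
Qed.

HB.instance Definition _ :=
  GRing.isSubmodClosed.Build R (V -> W) blin_pred blin_submod_closed.

Record blin := Blin { blin_fun :> V -> W; _ : blin_fun \in blin_pred }.

HB.instance Definition _ := [isSub for blin_fun].
HB.instance Definition _ := [Choice of blin by <:].
HB.instance Definition _ := [SubChoice_isSubLmodule of blin by <:].

Implicit Types f g : blin.

Lemma blin_linear f : linear f.
Proof. by case: f => f /= /asboolP[]. Qed.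

Lemma blin_continuous f : continuous f.
Proof. by case: f => f /= /asboolP[]. Qed.

Lemma blinD f g x : (f + g : blin) x = f x + g x.
Proof. by []. Qed.

Lemma blinZ a f x : (a *: f : blin) x = a *: f x.
Proof. by []. Qed.

Lemma blin_at0 f : f 0 = 0.
Proof. by have := blin_linear f (-1) 0 0; rewrite !scaleN1r oppr0 add0r addNr. Qed.

Lemma blin_scale f a x : f (a *: x) = a *: f x.
Proof. by have := blin_linear f a x 0; rewrite !addr0 blin_at0 addr0. Qed.

Definition opnorm (f : blin) : R := sup [set `|f x| | x in [set x | `|x| <= 1]].

Let pack (f : blin) : {linear V -> W} :=
  HB.pack (f : V -> W) (GRing.isLinear.Build _ _ _ _ _ (blin_linear f)).

Lemma opnorm_has_sup f : has_sup [set `|f x| | x in [set x : V | `|x| <= 1]].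
Proof.
split; first by exists `|f 0|; exists 0; rewrite //= normr0.
have /(bounded_funP (pack f)) : bounded_near (pack f) (nbhs (0 : V)).
  by apply/linear_bounded_continuous; exact: blin_continuous.
by move=> /(_ 1)[M fM]; exists M => _ [x x1 <-]; exact: fM.
Qed.

Lemma opnorm_ub f x : `|x| <= 1 -> `|f x| <= opnorm f.
Proof. by move=> x1; apply: ub_le_sup; [case: (opnorm_has_sup f)|exists x]. Qed.

Lemma opnorm_le f M : (forall x, `|x| <= 1 -> `|f x| <= M) -> opnorm f <= M.
Proof.
move=> fM; apply: ge_sup; first by case: (opnorm_has_sup f).
by move=> _ [x x1 <-]; exact: fM.
Qed.

Lemma opnorm_ge0 f : 0 <= opnorm f.
Proof. by apply: le_trans (opnorm_ub f (x := 0) _); rewrite ?normr0. Qed.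

Lemma opnormD f g : opnorm (f + g) <= opnorm f + opnorm g.
Proof.
apply: opnorm_le => x x1; rewrite blinD (le_trans (ler_normD _ _))//.
by rewrite lerD// opnorm_ub.
Qed.

Lemma opnormZ a f : opnorm (a *: f) = `|a| * opnorm f.
Proof.
have le b g : opnorm (b *: g) <= `|b| * opnorm g.
  apply: opnorm_le => x x1; rewrite blinZ normrZ.
  by rewrite ler_wpM2l// opnorm_ub.
apply/eqP; rewrite eq_le le/=; have [->|a0] := eqVneq a 0.
  by rewrite normr0 mul0r opnorm_ge0.
have := le a^-1 (a *: f); rewrite scalerA mulVf// scale1r normfV.
by rewrite ler_pdivlMl ?normr_gt0.
Qed.

Lemma opnorm_eq0 f : opnorm f = 0 -> f = 0.
Proof.
move=> f0; apply/val_inj/funext => x /=.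
have [->|x0] := eqVneq x 0; first exact: blin_at0.
have := @opnorm_ub f (`|x|^-1 *: x); rewrite normrZ normfV normr_id.
rewrite mulVf ?normr_eq0// => /(_ (lexx _)); rewrite f0 blin_scale normr_le0.
by rewrite scaler_eq0 invr_eq0 normr_eq0 (negbTE x0)/= => /eqP.
Qed.

HB.instance Definition _ :=
  Lmodule_isNormed.Build R blin opnormD opnormZ opnorm_eq0.

End BoundedLinear.

(* For open U: n-fold Frechet differentiability on U, the k-th derivative being
   a map from U to the k-fold iterated space of bounded linear maps. *)
Fixpoint diff_times {R : realType} {V : normedModType R} (U : set V) (n : nat) :
    forall W : normedModType R, (V -> W) -> Prop :=
  match n with
  | 0%N => fun W f => True
  | n'.+1 => fun W f => exists F : V -> blin V W,
      (forall x, U x -> is_diff x f (F x)) /\ diff_times U n' F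
  end.

Definition smooth_on {R : realType} {V W : normedModType R} (U : set V)
  (f : V -> W) : Prop := forall n, diff_times U n f.

Section Euclidean.
Context {R : realType} {m : nat}.
Implicit Types u v : 'cV[R]_m.

(* The library norm on matrices is the sup norm, hence these. *)
Definition dotv u v : R := \sum_i u i 0 * v i 0.
Definition enorm u : R := Num.sqrt (dotv u u).

Lemma dotvv_ge0 u : 0 <= dotv u u.
Proof. by apply: sumr_ge0 => i _; rewrite -expr2 sqr_ge0. Qed.

Lemma enorm_sqr u : enorm u ^+ 2 = dotv u u.
Proof. by rewrite sqr_sqrtr// dotvv_ge0. Qed.

Lemma dotvv_eq0 u : dotv u u = 0 -> u = 0.
Proof.
move=> /psumr_eq0P u0; apply/matrixP => i j; rewrite (ord1 j) mxE.
by apply/eqP; rewrite -sqrf_eq0 expr2 u0// => k _; rewrite -expr2 sqr_ge0.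
Qed.

Lemma dotv_conv (p q : R) u v : 0 < p -> 0 < q -> p + q = 1 ->
  dotv (u + v) (u + v) <= p^-1 * dotv u u + q^-1 * dotv v v.
Proof.
move=> p0 q0 pq; rewrite !mulr_sumr -big_split/= ler_sum// => i _.
rewrite !mxE; move: (u i 0) (v i 0) => x y.
have -> : q = 1 - p by lra.
have q0' : 0 < 1 - p by lra.
rewrite -subr_ge0.
have -> : p^-1 * (x * x) + (1 - p)^-1 * (y * y) - (x + y) * (x + y) =
  ((1 - p) * x - p * y) ^+ 2 / (p * (1 - p)) by field; rewrite ?gt_eqF.
by rewrite divr_ge0 ?sqr_ge0// mulr_ge0// ltW.
Qed.

End Euclidean.

Notation leb2 R := (product_measure1 (@lebesgue_measure R) (@lebesgue_measure R)).

Section Circle.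
Context {R : realType}.

(* The circle R/Z: functions on it are 1-periodic functions on R, integrated
   over this fundamental domain. *)
Definition circle : set R := `[0, 1[.
Definition circle2 : set (R * R) := circle `*` circle.

(* The distance of R/Z; the infimum is attained. *)
Definition rho (x y : R) : R := inf [set `|x - y + k%:~R| | k in [set: int]].

Lemma rho_lip (x y x' y' : R) : rho x y <= rho x' y' + `|(x - y) - (x' - y')|.
Proof.
rewrite -lerBlDr; apply: lb_le_inf; first by exists `|x' - y' + 0%:~R|, 0.
move=> _ [k _ <-]; rewrite lerBlDr.
apply: (@le_trans _ _ `|x - y + k%:~R|).
  apply: ge_inf; last by exists k.
  by exists 0 => _ [l _ <-].
rewrite [X in `|X|](_ : _ = (x' - y' + k%:~R) + ((x - y) - (x' - y'))).
  exact: ler_normD.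
by ring.
Qed.

Lemma rho_ge0 x y : 0 <= rho x y.
Proof.
by apply: lb_le_inf; [exists `|x - y + 0%:~R|, 0|move=> _ [k _ <-]].
Qed.

Lemma rho_subl x y : rho x y = rho (x - y) 0.
Proof. by rewrite /rho subr0. Qed.

Lemma rho_continuous : continuous (fun t : R => rho t 0).
Proof.
move=> t; apply/cvgrPdist_le => e e0; near=> z.
have := rho_lip t 0 z 0; have := rho_lip z 0 t 0; rewrite !subr0 => h1 h2.
rewrite distrC in h1; apply: (@le_trans _ _ `|t - z|).
  by rewrite ler_norml; apply/andP; split; lra.
by near: z; apply: cvgr_dist_le.
Unshelve. all: by end_near. Qed.

Lemma measurable_circle : measurable (circle : set (measurableTypeR R)).
Proof. exact: measurable_itv. Qed.

Lemma measurable_circle2 :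
  measurable (circle2 : set (measurableTypeR R * measurableTypeR R)).
Proof. by apply: measurableX; exact: measurable_circle. Qed.

End Circle.

Section SquareIntegral.
Context d (T : measurableType d) {R : realType} {m : nat}.
Variables (mu : {measure set T -> \bar R}) (D : set T) (w : T -> R).
Hypothesis mD : measurable D.
Hypothesis w0 : forall t, 0 <= w t.
Hypothesis mw : measurable_fun setT w.

Definition coord_measurable (f : T -> 'cV[R]_m) :=
  forall i, measurable_fun setT (fun t => f t i 0).

Let q (f : T -> 'cV[R]_m) : \bar R :=
  (\int[mu]_(t in D) (enorm (f t) ^+ 2 * w t)%:E)%E.

Let q_ge0 (f : T -> 'cV[R]_m) t : (0 <= (enorm (f t) ^+ 2 * w t)%:E)%E.
Proof. by rewrite lee_fin mulr_ge0// sqr_ge0. Qed.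

Implicit Types f g : T -> 'cV[R]_m.

Lemma measurable_sqint f : coord_measurable f ->
  measurable_fun D ((fun t => (enorm (f t) ^+ 2 * w t)%:E) : T -> \bar R).
Proof.
move=> mf; apply: (measurable_funS measurableT) => //.
apply/measurable_EFinP; apply: measurable_funM => //.
under eq_fun do rewrite enorm_sqr; apply: measurable_sum => i.
by apply: measurable_funM.
Qed.

Lemma sqint_conv f g (a b : R) : coord_measurable f -> coord_measurable g ->
  0 < a -> 0 < b -> a + b = 1 ->
  (q (fun t => (f t + g t)%R) <= a^-1%:E * q f + b^-1%:E * q g)%E.
Proof.
move=> mf mg a0 b0 ab.
have mfg : coord_measurable (fun t => (f t + g t)%R).
  by move=> i; under eq_fun do rewrite mxE; exact: measurable_funD.
have mqf := measurable_sqint mf; have mqg := measurable_sqint mg.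
have ia : 0 <= a^-1 by rewrite ltW// invr_gt0.
have ib : 0 <= b^-1 by rewrite ltW// invr_gt0.
rewrite /q -!ge0_integralZl_EFin//.
rewrite -ge0_integralD//; first last.
- exact: measurable_funeM.
- by move=> t _; rewrite mule_ge0.
- exact: measurable_funeM.
- by move=> t _; rewrite mule_ge0.
apply: ge0_le_integral => //.
- by move=> t _; rewrite lee_fin mulr_ge0 ?sqr_ge0.
- exact: measurable_sqint.
- by apply: emeasurable_funD; exact: measurable_funeM.
- move=> t _; rewrite -!EFinM -EFinD lee_fin (mulrA a^-1) (mulrA b^-1) -mulrDl ler_wpM2r//.
  by rewrite !enorm_sqr; exact: dotv_conv.
Qed.

Lemma sqint_scale f (a : R) : coord_measurable f ->
  q (fun t => a *: f t) = ((a ^+ 2)%:E * q f)%E.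
Proof.
move=> mf; have mqf := measurable_sqint mf.
rewrite /q -ge0_integralZl_EFin ?sqr_ge0//.
apply: eq_integral => t _; rewrite -EFinM !enorm_sqr mulrA; congr (_ * _)%:E.
  rewrite /dotv mulr_sumr; apply: eq_bigr => i _; rewrite !mxE; ring.
Qed.

End SquareIntegral.

Section Sobolev.
Context {R : realType} (m : nat) (s : R).
Implicit Types u v : R -> 'cV[R]_m.

Definition hs_sqnorm u : \bar R :=
  (\int[@lebesgue_measure R]_(x in circle) (enorm (u x) ^+ 2)%:E
   + \int[@lebesgue_measure R]_(x in circle) (enorm (u^`() x) ^+ 2)%:E
   + \int[leb2 R]_(z in circle2)
       (enorm (u^`() z.2 - u^`() z.1) ^+ 2
          / rho z.2 z.1 `^ (2 * s - 1))%:E)%E.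

(* For s > 3/2 every class of H^s has exactly one C^1 representative; it is
   this representative that stands for the class, and its weak derivative is
   then the classical one. *)
Definition sobolev_pred : {pred R -> 'cV[R]_m} :=
  [pred u : R -> 'cV[R]_m | `[< [/\ forall x, u (x + 1) = u x,
     forall x, derivable u x 1,
     continuous u^`()
   & (hs_sqnorm u < +oo)%E] >]].

Let muleD3 (k x y z : \bar R) : (0 <= x -> 0 <= y -> 0 <= z ->
  k * (x + y + z) = k * x + k * y + k * z)%E.
Proof. by move=> x0 y0 z0; rewrite ge0_muleDr ?adde_ge0// ge0_muleDr. Qed.

Lemma circle_cont u : (forall x, derivable u x 1) -> continuous u.
Proof.
by move=> du x; apply: differentiable_continuous; exact/derivable1_diffP.
Qed.

Let Rm := measurableTypeR R.

Lemma cont_coord u : continuous u ->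
  coord_measurable (T := Rm) u.
Proof.
move=> cu i; apply: continuous_measurable_fun => x.
apply: (@continuous_comp _ _ _ u (fun M : 'cV[R]_m => M i 0)); first exact: cu.
exact: coord_continuous.
Qed.

Let w1 : Rm -> R := cst 1.
Let w2 (z : Rm * Rm) : R := (rho z.2 z.1 `^ (2 * s - 1))^-1.
Let sl u (z : Rm * Rm) : 'cV[R]_m := u z.2 - u z.1.

Let w1_ge0 t : 0 <= w1 t. Proof. exact: ler01. Qed.
Let mw1 : measurable_fun setT w1. Proof. exact: measurable_cst. Qed.
Let w2_ge0 z : 0 <= w2 z. Proof. by rewrite invr_ge0 powR_ge0. Qed.
Let mw2 : measurable_fun setT w2.
Proof.
rewrite /w2; under eq_fun do rewrite -powRN.
apply: (measurableT_comp (measurable_powR _)).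
under eq_fun do rewrite rho_subl.
apply: (@measurableT_comp _ _ _ _ _ _ (fun t : Rm => rho t 0)).
  by apply: continuous_measurable_fun; exact: rho_continuous.
by apply: measurable_funB.
Qed.

Let msl u : continuous u -> coord_measurable (sl u).
Proof.
move=> cu i; rewrite /sl; under eq_fun do rewrite !mxE.
apply: measurable_funB.
  exact: (@measurableT_comp _ _ _ _ _ _ (fun t : Rm => u t i 0) _ _ (cont_coord cu i)).
exact: (@measurableT_comp _ _ _ _ _ _ (fun t : Rm => u t i 0) _ _ (cont_coord cu i)).
Qed.

Let hs_sqnormE u : hs_sqnorm u =
  (\int[@lebesgue_measure R]_(t in (circle : set Rm)) (enorm (u t) ^+ 2 * w1 t)%:E
   + \int[@lebesgue_measure R]_(t in (circle : set Rm))
       (enorm (u^`() t) ^+ 2 * w1 t)%:E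
   + \int[leb2 R]_(z in circle2) (enorm (sl u^`() z) ^+ 2 * w2 z)%:E)%E.
Proof.
by congr (_ + _ + _)%E; apply: eq_integral => x _; rewrite mulr1.
Qed.

Let d1D u v : (forall x, derivable u x 1) -> (forall x, derivable v x 1) ->
  (u + v)^`() = (fun x => u^`() x + v^`() x).
Proof. by move=> du dv; apply/funext => x; rewrite !derive1E deriveD. Qed.

Let d1Z a u : (forall x, derivable u x 1) ->
  (a *: u)^`() = (fun x => a *: u^`() x).
Proof. by move=> du; apply/funext => x; rewrite !derive1E deriveZ. Qed.

Lemma hs_sqnorm_conv u v (a b : R) :
  (forall x, derivable u x 1) -> continuous u^`() ->
  (forall x, derivable v x 1) -> continuous v^`() ->
  0 < a -> 0 < b -> a + b = 1 ->
  (hs_sqnorm (u + v)%R <= a^-1%:E * hs_sqnorm u + b^-1%:E * hs_sqnorm v)%E.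
Proof.
move=> du cu dv cv a0 b0 ab; rewrite !hs_sqnormE d1D//.
have ia : (0 <= a^-1%:E)%E by rewrite lee_fin invr_ge0 ltW.
have ib : (0 <= b^-1%:E)%E by rewrite lee_fin invr_ge0 ltW.
have ig d (T : measurableType d) (mu : {measure set T -> \bar R}) D
    (w : T -> R) (f : T -> 'cV[R]_m) : (forall t, 0 <= w t) ->
    (0 <= \int[mu]_(t in D) (enorm (f t) ^+ 2 * w t)%:E)%E.
  move=> w0; apply: integral_ge0 => t _.
  by rewrite lee_fin mulr_ge0// sqr_ge0.
rewrite !muleD3 ?ig//.
have slD : sl (fun x => u^`() x + v^`() x) =
    (fun z => sl u^`() z + sl v^`() z).
  by apply/funext => z; rewrite /sl opprD addrACA.
rewrite slD.
have H1 := sqint_conv lebesgue_measure measurable_circle w1_ge0 mw1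
  (cont_coord (circle_cont du)) (cont_coord (circle_cont dv)) a0 b0 ab.
have H2 := sqint_conv lebesgue_measure measurable_circle w1_ge0 mw1
  (cont_coord cu) (cont_coord cv) a0 b0 ab.
have H3 := sqint_conv (leb2 R) measurable_circle2 w2_ge0 mw2
  (msl cu) (msl cv) a0 b0 ab.
apply: (le_trans (leeD (leeD H1 H2) H3)).
by rewrite [X in (_ <= X)%E]addeACA [X in (_ <= X + _)%E]addeACA.
Qed.

Lemma hs_sqnorm_scale u (a : R) :
  (forall x, derivable u x 1) -> continuous u^`() ->
  hs_sqnorm (a *: u) = ((a ^+ 2)%:E * hs_sqnorm u)%E.
Proof.
move=> du cu; rewrite !hs_sqnormE d1Z//.
have ig d (T : measurableType d) (mu : {measure set T -> \bar R}) D
    (w : T -> R) (f : T -> 'cV[R]_m) : (forall t, 0 <= w t) ->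
    (0 <= \int[mu]_(t in D) (enorm (f t) ^+ 2 * w t)%:E)%E.
  move=> w0; apply: integral_ge0 => t _.
  by rewrite lee_fin mulr_ge0// sqr_ge0.
rewrite !muleD3 ?ig//.
have -> : sl (fun x => a *: u^`() x) = (fun z => a *: sl u^`() z).
  by apply/funext => z; rewrite /sl scalerBr.
have H1 := sqint_scale lebesgue_measure measurable_circle w1_ge0 mw1
  a (cont_coord (circle_cont du)).
have H2 := sqint_scale lebesgue_measure measurable_circle w1_ge0 mw1
  a (cont_coord cu).
have H3 := sqint_scale (leb2 R) measurable_circle2 w2_ge0 mw2 a (msl cu).
by rewrite -H1 -H2 -H3.
Qed.

Lemma hs_sqnorm_ge0 u : (0 <= hs_sqnorm u)%E.
Proof.
apply: adde_ge0; [apply: adde_ge0|]; apply: integral_ge0 => x _; rewrite lee_fin ?sqr_ge0//.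
by rewrite divr_ge0 ?sqr_ge0// powR_ge0.
Qed.

Lemma sobolev_submod_closed : submod_closed sobolev_pred.
Proof.
have d0 : ((0 : R -> 'cV[R]_m)^`()) = 0.
  by apply/funext => x; rewrite derive1_cst.
split.
- apply/asboolP; split => [x|x||].
  + by [].
  + exact: derivable_cst.
  + by rewrite d0 => x; exact: cvg_cst.
  + have := @hs_sqnorm_scale 0 0; rewrite scale0r expr0n/= mul0e => ->//.
    by rewrite d0 => x; exact: cvg_cst.
- move=> a u v /asboolP[pu du cu nu] /asboolP[pv dv cv nv].
  have dau x : derivable (a *: u) x 1 by exact: derivableZ.
  have cau : continuous (a *: u)^`().
    by rewrite d1Z// => x; apply: cvgZr; exact: cu.
  apply/asboolP; split => [x|x||].
  + by rewrite -![(a *: u + v) _]/(a *: u _ + v _) pu pv.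
  + exact: derivableD.
  + by rewrite d1D// => x; apply: cvgD; [exact: cau|exact: cv].
  + apply: (@le_lt_trans _ _ ((2^-1)^-1%:E * hs_sqnorm (a *: u)%R +
        (2^-1)^-1%:E * hs_sqnorm v)%E).
      by apply: hs_sqnorm_conv => //; lra.
    rewrite hs_sqnorm_scale//.
    move: nu nv (hs_sqnorm_ge0 u) (hs_sqnorm_ge0 v).
    by case: (hs_sqnorm u) => // p; case: (hs_sqnorm v) => // q *; rewrite ltry.
Qed.

HB.instance Definition _ :=
  GRing.isSubmodClosed.Build R (R -> 'cV[R]_m) sobolev_pred
    sobolev_submod_closed.

Record sobolev := Sobolev {
  sobolev_fun :> R -> 'cV[R]_m; _ : sobolev_fun \in sobolev_pred }.

HB.instance Definition _ := [isSub for sobolev_fun].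
HB.instance Definition _ := [Choice of sobolev by <:].
HB.instance Definition _ := [SubChoice_isSubLmodule of sobolev by <:].

Implicit Types f g : sobolev.

Lemma sobolevP f : [/\ forall x, f (x + 1) = f x,
  forall x, derivable f x 1, continuous f^`() & (hs_sqnorm f < +oo)%E].
Proof. by case: f => f /= /asboolP. Qed.

Definition hs_norm f : R := Num.sqrt (fine (hs_sqnorm f)).

Lemma hs_norm_sqr f : (hs_norm f ^+ 2)%:E = hs_sqnorm f.
Proof.
have [_ _ _ h] := sobolevP f.
rewrite sqr_sqrtr ?fine_ge0 ?hs_sqnorm_ge0// fineK//.
by rewrite ge0_fin_numE// hs_sqnorm_ge0.
Qed.

Lemma hs_norm_ge0 f : 0 <= hs_norm f. Proof. exact: sqrtr_ge0. Qed.

Lemma hs_norm_eq0 f : hs_norm f = 0 -> f = 0.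
Proof.
move=> f0; have [pf df cf _] := sobolevP f.
have cf0 := circle_cont df.
have I0 : (\int[@lebesgue_measure R]_(x in (circle : set Rm))
    (enorm (f x) ^+ 2)%:E = 0)%E.
  apply/eqP; rewrite eq_le; apply/andP; split; last first.
    by apply: integral_ge0 => x _; rewrite lee_fin sqr_ge0.
  apply: (@le_trans _ _ (hs_sqnorm f)); last by rewrite -hs_norm_sqr f0 expr0n.
  rewrite /hs_sqnorm -addeA leeDl//; apply: adde_ge0; apply: integral_ge0 => x _.
    by rewrite lee_fin sqr_ge0.
  by rewrite lee_fin divr_ge0 ?sqr_ge0// powR_ge0.
have cn : continuous (fun x : R => enorm (f x) ^+ 2).
  rewrite (_ : (fun x => _) = (fun x => \sum_i f x i 0 * f x i 0)); last first.
    by apply/funext => x; rewrite enorm_sqr.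
  have cfi i : continuous (fun x => f x i 0).
    move=> x; apply: (@continuous_comp _ _ _ f (fun M : 'cV[R]_m => M i 0)).
      exact: cf0.
    exact: coord_continuous.
  move=> x; rewrite /continuous_at.
  apply: cvg_big => [|i _]; last by apply: cvgM; exact: cfi.
  exact: add_continuous.
have mn : measurable_fun (circle : set Rm) (fun x => (enorm (f x) ^+ 2)%:E).
  apply/measurable_EFinP; apply: (measurable_funS measurableT) => //.
  exact: continuous_measurable_fun.
have open0 x : 0 < x < 1 -> f x = 0.
  move=> x01; apply/dotvv_eq0; rewrite -enorm_sqr; apply/eqP/negPn/negP => fx0.
  have fx : 0 < enorm (f x) ^+ 2 by rewrite lt_neqAle eq_sym fx0 sqr_ge0.
  have [e e0 He] : exists2 e : R, 0 < e & forall y, `|x - y| < e ->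
      0 < enorm (f y) ^+ 2 /\ 0 < y < 1.
    have : \forall y \near x, 0 < enorm (f y) ^+ 2 /\ 0 < y < 1.
      near=> y; split; first by near: y; apply: cvgr_gt fx; exact: cn.
      apply/andP; split; near: y; move/andP: x01 => [xa xb].
        by apply: lt_nbhsr; exact: xa.
      by apply: lt_nbhsl; exact: xb.
    by move=> /nbhs_ballP[e /= e0 H]; exists e.
  have : (\int[@lebesgue_measure R]_(x in (circle : set Rm))
      `|(enorm (f x) ^+ 2)%:E| = 0)%E.
    rewrite -[RHS]I0; apply: eq_integral => y _.
    by rewrite gee0_abs// lee_fin sqr_ge0.
  move/(ae_eq_integral_abs _ measurable_circle mn) => [N [mN N0 sN]].
  have : (lebesgue_measure (`](x - e)%R, (x + e)%R[%classic : set Rm) <=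
      lebesgue_measure N)%E.
    apply: le_measure; rewrite ?inE//=.
    move=> y /= ye; apply: sN => /= H.
    have [] := He y.
      rewrite distrC ltr_norml; move: ye; rewrite in_itv/= => /andP[? ?].
      by apply/andP; split; lra.
    move=> fy y01; have := H _.
    have cy : circle y.
      by rewrite /circle/= in_itv/=; case/andP: y01 => /ltW -> ->.
    by move=> /(_ cy) [] /eqP; rewrite gt_eqF.
  rewrite N0 lebesgue_measure_itv/= lte_fin ifT; last by lra.
  by rewrite -EFinD lee_fin leNgt => /negP; apply; lra.
have f00 : f 0 = 0.
  apply/dotvv_eq0; rewrite -enorm_sqr; apply/eqP/negPn/negP => n0.
  have p0 : 0 < enorm (f 0) ^+ 2 by rewrite lt_neqAle eq_sym n0 sqr_ge0.
  have : \forall y \near (0 : R), 0 < enorm (f y) ^+ 2.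
    by have := cn 0; move/cvgr_gt; apply.
  move=> /nbhs_ballP[e /= e0 He].
  pose y : R := Num.min e 1 / 2.
  have y0 : 0 < Num.min e 1 by rewrite lt_min e0 ltr01.
  have y1 : Num.min e 1 <= 1 by rewrite ge_min lexx orbT.
  have ye : Num.min e 1 <= e by rewrite ge_min lexx.
  have := He y; rewrite /ball/= sub0r normrN gtr0_norm; last by rewrite /y; lra.
  rewrite open0; last by rewrite /y; apply/andP; split; lra.
  rewrite enorm_sqr /dotv big1 ?ltxx => [|i _]; last by rewrite mxE mul0r.
  by move=> H; suff: false by []; apply: H; rewrite /y; lra.
have fn0 x (n : nat) : f (x + n%:R) = f x.
  elim: n => [|n IH]; first by rewrite addr0.
  by rewrite -natr1 addrA pf.
have fz x (k : int) : f (x + k%:~R) = f x.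
  case: k => n; first exact: fn0.
  by rewrite NegzE mulrNz -(fn0 _ n.+1) addrNK.
apply/val_inj/funext => x /=.
rewrite -(fz x (- Num.floor x)) mulrNz.
have [->|n0] := eqVneq (x - (Num.floor x)%:~R) 0; first exact: f00.
apply: open0; rewrite lt_neqAle eq_sym n0/= subr_ge0 floor_le/=.
by rewrite ltrBlDl -[X in _ + X]/(1%:~R) -intrD floorD1_gt.
Unshelve. all: by end_near. Qed.

Lemma hs_normD f g : hs_norm (f + g) <= hs_norm f + hs_norm g.
Proof.
have [f0|f0] := eqVneq (hs_norm f) 0.
  by rewrite (hs_norm_eq0 f0) add0r lerDr hs_norm_ge0.
have [g0|g0] := eqVneq (hs_norm g) 0.
  by rewrite (hs_norm_eq0 g0) addr0 lerDl hs_norm_ge0.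
have pf : 0 < hs_norm f by rewrite lt_neqAle eq_sym f0 hs_norm_ge0.
have pg : 0 < hs_norm g by rewrite lt_neqAle eq_sym g0 hs_norm_ge0.
have [_ df cf _] := sobolevP f; have [_ dg cg _] := sobolevP g.
have p := addr_gt0 pf pg.
have fin (x y z a b : R) (X Y Z : \bar R) : (x ^+ 2)%:E = X -> (y ^+ 2)%:E = Y ->
    (z ^+ 2)%:E = Z -> (Z <= a%:E * X + b%:E * Y)%E ->
    z ^+ 2 <= a * x ^+ 2 + b * y ^+ 2.
  by move=> <- <- <-; rewrite -!EFinM -EFinD lee_fin.
have ab : hs_norm f / (hs_norm f + hs_norm g) +
    hs_norm g / (hs_norm f + hs_norm g) = 1.
  by rewrite -mulrDl divff ?gt_eqF.
have h := fin _ _ _ _ _ _ _ _ (hs_norm_sqr f) (hs_norm_sqr g)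
  (hs_norm_sqr (f + g))
  (hs_sqnorm_conv df cf dg cg (divr_gt0 pf p) (divr_gt0 pg p) ab).
have concl (x y z : R) : 0 < x -> 0 < y -> 0 <= z ->
    z ^+ 2 <= (x / (x + y))^-1 * x ^+ 2 + (y / (x + y))^-1 * y ^+ 2 ->
    z <= x + y.
  move=> x0 y0 z0; have xy := addr_gt0 x0 y0.
  have -> : (x / (x + y))^-1 * x ^+ 2 + (y / (x + y))^-1 * y ^+ 2 =
    (x + y) ^+ 2 by field; rewrite ?gt_eqF.
  by rewrite ler_pXn2r// nnegrE ltW.
exact: concl pf pg (hs_norm_ge0 (f + g)) h.
Qed.

Lemma hs_normZ a f : hs_norm (a *: f) = `|a| * hs_norm f.
Proof.
have [_ df cf _] := sobolevP f.
have fin (x y c : R) (X Y : \bar R) : (x ^+ 2)%:E = X -> (y ^+ 2)%:E = Y ->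
    (Y = c%:E * X)%E -> y ^+ 2 = c * x ^+ 2.
  by move=> <- <-; rewrite -EFinM => -[].
have h := fin _ _ _ _ _ (hs_norm_sqr f) (hs_norm_sqr (a *: f))
  (hs_sqnorm_scale a df cf).
have concl (x y : R) : 0 <= x -> 0 <= y -> y ^+ 2 = a ^+ 2 * x ^+ 2 ->
    y = `|a| * x.
  move=> x0 y0 e; apply/eqP; rewrite -(@eqrXn2 _ 2) ?mulr_ge0// e exprMn.
  by rewrite real_normK ?num_real.
exact: concl (hs_norm_ge0 f) (hs_norm_ge0 (a *: f)) h.
Qed.

HB.instance Definition _ :=
  Lmodule_isNormed.Build R sobolev hs_normD hs_normZ hs_norm_eq0.

End Sobolev.

Section TangentPoint.
Context {R : realType} {m : nat} (s : R).
Implicit Types g u v : R -> 'cV[R]_m.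

(* The map induced on R/Z is an immersion and a homeomorphism onto its image. *)
Definition embedding g : Prop :=
  [/\ forall x, g^`() x != 0,
      continuous g,
      forall x y, g x = g y -> exists k : int, x - y = k%:~R
    & forall x (e : R), 0 < e -> exists2 d : R, 0 < d &
        forall y, enorm (g y - g x) < d -> rho y x < e].

Definition embeddings : set (sobolev m s) := [set g | embedding g].

Definition arcD g u (x : R) : 'cV[R]_m := (enorm (g^`() x))^-1 *: u^`() x.

Definition tanD g u (x : R) : 'M[R]_m :=
  (enorm (g^`() x) ^+ 2)^-1 *: (u^`() x *m (g^`() x)^T).

Definition mu_density g (x y : R) : R :=
  enorm (g^`() y) * enorm (g^`() x) / enorm (g y - g x).

(* Division by zero on the diagonal only affects a null set. *)
Definition mu_integrable g (F : R -> R -> R) : Prop :=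
  (leb2 R).-integrable circle2 (fun z => (F z.1 z.2 * mu_density g z.1 z.2)%:E).

Definition mu_integral g (F : R -> R -> R) : R :=
  \int[leb2 R]_(z in circle2) (F z.1 z.2 * mu_density g z.1 z.2).

Definition remainder g u (x y : R) : 'cV[R]_m :=
  (enorm (g y - g x) `^ s)^-1 *: (u y - u x - tanD g u x *m (g y - g x)).

Definition diffquot g u (x y : R) : 'cV[R]_m :=
  (enorm (g y - g x))^-1 *: (u y - u x).

Definition tp_density g (x y : R) : R := enorm (remainder g g x y) ^+ 2.

Definition B1_density g u v (x y : R) : R :=
  dotv (remainder g u x y) (remainder g v x y).

Definition B2_density g u v (x y : R) : R :=
  tp_density g x y * dotv (diffquot g u x y) (diffquot g v x y).

Definition B3_density g u v (x y : R) : R :=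
  tp_density g x y *
  (dotv (arcD g u x) (arcD g v x) + dotv (arcD g u y) (arcD g v y)).

Definition energy (g : sobolev m s) : R := mu_integral g (tp_density g).
Definition B1 g u v : R := mu_integral g (B1_density g u v).
Definition B2 g u v : R := mu_integral g (B2_density g u v).
Definition B3 g u v : R := mu_integral g (B3_density g u v).

End TangentPoint.

Arguments embeddings {R} m s _.
Arguments energy {R} m s g.

(* Main.v *)
From HB Require Import structures.
Require Import Defs.
From mathcomp Require Import all_boot all_order all_algebra.
From mathcomp Require Import all_classical all_reals all_analysis.
From mathcomp Require Import measurable_realfun ring lra.
Set Implicit Arguments.
Unset Strict Implicit.
Unset Printing Implicit Defensive.
Import Order.TTheory GRing.Theory Num.Theory.
Import numFieldNormedType.Exports.
Local Open Scope ring_scope.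
Local Open Scope classical_set_scope.

(** Write h for the signed distance from x to y on the circle, t = g'(x),
    q = (g(y) - g(x)) / h for the chord slope, and
    n = (g(y) - g(x) - h g'(x)) / |h|^(s + 1/2) for the normalized first-order
    remainder of g.  The projection that kills t sees only the remainder of
    g(y) - g(x), so that the energy density is
<<
      w (|t|^2 |n|^2 - <t, n>^2),
      w = |q|^(-(2s+1)) |g'(x)|^(-1) |g'(y)|,
>>
    with no power of |h| left over.  Here q, g'(x) and g'(y) depend linearly
    and boundedly on g as elements of the algebra of bounded measurable
    functions of (x, y), because H^s embeds into C^1 ([sobolev_C1_bound]), and
    n depends linearly and boundedly on g in L^2, because a Hardy inequality
    bounds remainders by the Sobolev-Slobodeckij seminorm
    ([nrem_coord_L2]).  So the energy is a finite sum of terms T(k(g), g, g),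
    where T(k, u, v) is the integral of k times two components of remainders,
    a bounded trilinear form, and where the coefficient k is a polynomial in
    linear terms and real powers of |q|^2, |g'(x)|^2 and |g'(y)|^2.  For an
    embedding these three functions are bounded below by a positive constant,
    by compactness of the circle ([embedding_slope_lower_bound]), and this
    persists nearby.

    Smoothness is then formal.  Maps that are n times differentiable are
    closed under bounded bilinear operations, since the derivative of B(f, g)
    consists of bounded bilinear operations applied to (f', g) and (f, g')
    ([diff_times_bil]); real powers of uniformly positive bounded functions
    differentiate into real powers ([diff_times_bpow]).  The first variation
    comes from the product rule, followed by a pointwise identity between the
    differentiated density and the densities of B1, B2 and B3
    ([energy_density_derE]). *)


(** * Iterated Frechet derivatives *)

Section Calculus.
Context {R : realType}.
Implicit Types U V W : normedModType R.

Lemma is_diff_epsP V W (f : V -> W) (F : blin V W) (x : V) :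
  is_diff x f F <-> forall e, 0 < e -> exists2 d, 0 < d &
    forall h, `|h| < d -> `|f (x + h) - f x - F h| <= e * `|h|.
Proof.
have eqF : (f \o shift x = cst (f x) + (F : V -> W) +o_ (0 : V) id) <->
    forall e, 0 < e -> exists2 d, 0 < d &
    forall h, `|h| < d -> `|f (x + h) - f x - F h| <= e * `|h|.
  split=> [/eqaddoP H e /H /nbhs_ballP[d /= d0 Hd]|H].
    exists d => // h hd; have := Hd h.
    rewrite -ball_normE /ball_/= sub0r normrN => /(_ hd).
    rewrite -[X in `|X| <= _]/(f (h + x) - (f x + F h)).
    by rewrite opprD addrA [h + x]addrC.
  apply/eqaddoP => e /H[d d0 Hd]; apply/nbhs_ballP; exists d => //= h.
  rewrite -ball_normE /ball_/= sub0r normrN => /Hd.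
  rewrite -[X in _ -> `|X| <= _]/(f (h + x) - (f x + F h)).
  by rewrite opprD addrA [h + x]addrC.
pose L : {linear V -> W} :=
  HB.pack (F : V -> W) (GRing.isLinear.Build _ _ _ _ _ (blin_linear F)).
have cL : continuous L by exact: blin_continuous.
split=> [[df dv]|/eqF H].
  by apply/eqF; have := diff_locally df; rewrite dv.
have dF : 'd f x = L :> (V -> W) by apply: diff_unique.
by split=> //; apply/diff_locallyP; rewrite dF; split => //; exact: cL.
Qed.

Lemma bounded_blin V W (f : V -> W) : linear f ->
  (exists C, forall x, `|f x| <= C * `|x|) -> f \in @blin_pred _ V W.
Proof.
move=> lf [C fC]; apply/asboolP; split => //.
pose L : {linear V -> W} :=
  HB.pack f (GRing.isLinear.Build _ _ _ _ _ lf).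
apply/(linear_bounded_continuous L)/bounded_funP => r.
exists (`|C| * `|r|) => x xr; apply: le_trans (fC x) _.
apply: (@le_trans _ _ (`|C| * `|x|)); first by rewrite ler_wpM2r// ler_norm.
by rewrite ler_wpM2l// (le_trans xr)// ler_norm.
Qed.

(** A total constructor of bounded linear maps, specified on the functions that
    are linear and bounded. *)
Lemma toblin_subproof V W (f : V -> W) : {F : blin V W | linear f ->
  (exists C, forall x, `|f x| <= C * `|x|) -> F = f :> (V -> W)}.
Proof. by exists (insubd 0 f) => lf bf; rewrite (insubdK _ (bounded_blin lf bf)). Qed.

Definition toblin V W (f : V -> W) : blin V W := sval (toblin_subproof f).

Lemma toblinE V W (f : V -> W) : linear f ->
  (exists C, forall x, `|f x| <= C * `|x|) -> toblin f = f :> (V -> W).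
Proof. exact: (svalP (toblin_subproof f)). Qed.

Lemma blin_norm V W (f : blin V W) x : `|f x| <= `|f| * `|x|.
Proof.
have [->|x0] := eqVneq x 0; first by rewrite blin_at0 !normr0 mulr0.
have xp : 0 < `|x| by rewrite normr_gt0.
have := @opnorm_ub _ _ _ f (`|x|^-1 *: x).
rewrite normrZ normfV normr_id mulVf ?gt_eqF// => /(_ (lexx _)).
rewrite blin_scale normrZ normfV normr_id ler_pdivrMl//.
by rewrite mulrC.
Qed.

Lemma blin_norm_le V W (f : blin V W) C : 0 <= C ->
  (forall x, `|f x| <= C * `|x|) -> `|f| <= C.
Proof.
move=> C0 fC; apply: opnorm_le => x x1; apply: le_trans (fC x) _.
by rewrite -[leRHS]mulr1 ler_wpM2l.
Qed.

Definition bounded_bilinear U V W (B : U -> V -> W) :=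
  [/\ forall v, linear (B ^~ v), forall u, linear (B u)
    & exists2 C, 0 <= C & forall u v, `|B u v| <= C * (`|u| * `|v|)].

Section Bilinear.
Context (U V W : normedModType R) (B : U -> V -> W).
Hypothesis bB : bounded_bilinear B.

Lemma bilDl u u' v : B (u + u') v = B u v + B u' v.
Proof. by case: bB => l _ _; have := l v 1 u u'; rewrite !scale1r. Qed.

Lemma bilDr u v v' : B u (v + v') = B u v + B u v'.
Proof. by case: bB => _ l _; have := l u 1 v v'; rewrite !scale1r. Qed.

Lemma bil0l v : B 0 v = 0.
Proof.
by apply: (@addrI _ (B 0 v)); rewrite -bilDl addr0 addr0.
Qed.

Lemma bil0r u : B u 0 = 0.
Proof. by apply: (@addrI _ (B u 0)); rewrite -bilDr addr0 addr0. Qed.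

Lemma bilZl a u v : B (a *: u) v = a *: B u v.
Proof.
by case: bB => l _ _; have := l v a u 0; rewrite !addr0 bil0l addr0.
Qed.

Lemma bilZr a u v : B u (a *: v) = a *: B u v.
Proof.
by case: bB => _ l _; have := l u a v 0; rewrite !addr0 bil0r addr0.
Qed.

Lemma bilBl u u' v : B (u - u') v = B u v - B u' v.
Proof. by rewrite -scaleN1r bilDl bilZl scaleN1r. Qed.

Lemma bilBr u v v' : B u (v - v') = B u v - B u v'.
Proof. by rewrite -scaleN1r bilDr bilZr scaleN1r. Qed.

Lemma bil_bound : exists2 C, 0 < C & forall u v, `|B u v| <= C * (`|u| * `|v|).
Proof.
case: bB => _ _ [C C0 BC]; exists (C + 1); first lra.
move=> u v; apply: le_trans (BC u v) _; rewrite ler_wpM2r//; lra.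
Qed.

End Bilinear.

(** The two halves of the product rule for B(f, g), each of them a bounded
    bilinear function of a derivative and a value. *)
Definition bil_comp_l U V W V' (B : U -> V -> W) (phi : blin V' U) (v : V) : blin V' W :=
  toblin (fun x => B (phi x) v).
Definition bil_comp_r U V W V' (B : U -> V -> W) (u : U) (phi : blin V' V) : blin V' W :=
  toblin (fun x => B u (phi x)).

Lemma bil_comp_lE U V W V' (B : U -> V -> W) (phi : blin V' U) v x :
  bounded_bilinear B -> bil_comp_l B phi v x = B (phi x) v.
Proof.
move=> bB; rewrite /bil_comp_l toblinE//.
  by move=> a y z; rewrite blin_linear bilDl// bilZl.
have [C C0 BC] := bil_bound bB.
exists (C * (`|phi| * `|v|)) => y; apply: le_trans (BC _ _) _.
rewrite -mulrA ler_pM2l// mulrAC ler_wpM2r//; exact: blin_norm.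
Qed.

Lemma bil_comp_rE U V W V' (B : U -> V -> W) u (phi : blin V' V) x :
  bounded_bilinear B -> bil_comp_r B u phi x = B u (phi x).
Proof.
move=> bB; rewrite /bil_comp_r toblinE//.
  by move=> a y z; rewrite blin_linear bilDr// bilZr.
have [C C0 BC] := bil_bound bB.
exists (C * (`|u| * `|phi|)) => y; apply: le_trans (BC _ _) _.
rewrite -!mulrA ler_pM2l// ler_wpM2l//; exact: blin_norm.
Qed.

Lemma blinP V W (f g : blin V W) : f =1 g -> f = g.
Proof. by move=> fg; apply/val_inj/funext. Qed.

Lemma bil_comp_l_bil U V W V' (B : U -> V -> W) : bounded_bilinear B ->
  bounded_bilinear (@bil_comp_l U V W V' B).
Proof.
move=> bB; split=> [v a f g|f a u v|].
- apply: blinP => x; rewrite blinD blinZ !bil_comp_lE// blinD blinZ.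
  by rewrite bilDl// bilZl.
- apply: blinP => x; rewrite blinD blinZ !bil_comp_lE//.
  by rewrite bilDr// bilZr.
- have [C C0 BC] := bil_bound bB; exists C; first exact: ltW.
  move=> f v; apply: blin_norm_le; first by rewrite !mulr_ge0// ltW.
  move=> x; rewrite bil_comp_lE//; apply: le_trans (BC _ _) _.
  by rewrite -mulrA ler_pM2l// mulrAC ler_wpM2r//; exact: blin_norm.
Qed.

Lemma bil_comp_r_bil U V W V' (B : U -> V -> W) : bounded_bilinear B ->
  bounded_bilinear (@bil_comp_r U V W V' B).
Proof.
move=> bB; split=> [f a u v|v a f g|].
- apply: blinP => x; rewrite blinD blinZ !bil_comp_rE//.
  by rewrite bilDl// bilZl.
- apply: blinP => x; rewrite blinD blinZ !bil_comp_rE// blinD blinZ.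
  by rewrite bilDr// bilZr.
- have [C C0 BC] := bil_bound bB; exists C; first exact: ltW.
  move=> u f; apply: blin_norm_le; first by rewrite !mulr_ge0// ltW.
  move=> x; rewrite bil_comp_rE//; apply: le_trans (BC _ _) _.
  by rewrite -!mulrA ler_pM2l// ler_wpM2l//; exact: blin_norm.
Qed.

Lemma blin_app_bil V W : bounded_bilinear (fun (f : blin V W) x => f x).
Proof.
split=> [v a f g|f|]; first by rewrite blinD blinZ.
  exact: blin_linear.
by exists 1 => // f x; rewrite mul1r; exact: blin_norm.
Qed.

Lemma is_diff_bil U V W V' (B : U -> V -> W) (f : V' -> U) (g : V' -> V)
    (F : blin V' U) (G : blin V' V) x : bounded_bilinear B ->
  is_diff x f F -> is_diff x g G ->
  is_diff x (fun y => B (f y) (g y))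
    (bil_comp_l B F (g x) + bil_comp_r B (f x) G : blin V' W).
Proof.
move=> bB /is_diff_epsP df /is_diff_epsP dg; apply/is_diff_epsP => e e0.
have [C C0 BC] := bil_bound bB.
(* e1, e2 and d3 give each of the three error terms a third of e *)
set Mf := `|f x| + 1; set Mg := `|g x| + `|G| + 1; set MF := `|F| + 1.
have Mf0 : 0 < Mf by rewrite ltr_wpDl.
have Mg0 : 0 < Mg by rewrite ltr_wpDl// addr_ge0.
have MF0 : 0 < MF by rewrite ltr_wpDl.
pose e1 := Num.min 1 (e / (3 * C * Mg)).
have e10 : 0 < e1 by rewrite lt_min ltr01/= !(divr_gt0, mulr_gt0).
pose e2 := Num.min 1 (e / (3 * C * Mf)).
have e20 : 0 < e2 by rewrite lt_min ltr01/= !(divr_gt0, mulr_gt0).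
have [d1 d10 h1] := df _ e10; have [d2 d20 h2] := dg _ e20.
pose d3 := Num.min 1 (e / (3 * C * (MF * Mg))).
have d30 : 0 < d3 by rewrite lt_min ltr01/= !(divr_gt0, mulr_gt0).
exists (Num.min d1 (Num.min d2 d3)); first by rewrite lt_min d10 lt_min d20.
move=> h; rewrite !lt_min => /and3P[hd1 hd2 /andP[hd31 hd32]].
have {}h1 := h1 _ hd1; have {}h2 := h2 _ hd2.
have ng : `|g (x + h)| <= Mg.
  have -> : g (x + h) = (g (x + h) - g x - G h) + G h + g x.
    by rewrite subrK subrK.
  apply: le_trans (ler_normD _ _) _; apply: le_trans (lerD (ler_normD _ _) (lexx _)) _.
  have : `|G h| <= `|G|.
    by apply: le_trans (blin_norm _ _) _; rewrite -[leRHS]mulr1 ler_wpM2l// ltW.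
  have : e2 * `|h| <= 1.
    by rewrite -[leRHS]mulr1 ler_pM//; [exact: ltW|rewrite ge_min lexx|exact: ltW].
  by rewrite /Mg; move: h2; lra.
have -> : B (f (x + h)) (g (x + h)) - B (f x) (g x) -
    (bil_comp_l B F (g x) + bil_comp_r B (f x) G : blin V' W) h =
    B (f (x + h) - f x - F h) (g (x + h)) + B (F h) (g (x + h) - g x) +
    B (f x) (g (x + h) - g x - G h).
  rewrite blinD bil_comp_lE// bil_comp_rE// !(bilBl bB, bilBr bB).
  have aux (M : zmodType) (X Y Z T P Q : M) :
      X - P - (T + Q) = (X - Y - Z) + (Z - T) + (Y - P - Q).
    by rewrite (addrA _ Z) subrK addrACA (addrA _ Y) subrK -opprD.
  exact: aux.
have dgh : `|g (x + h) - g x| <= Mg * `|h|.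
  have -> : g (x + h) - g x = (g (x + h) - g x - G h) + G h by rewrite subrK.
  apply: le_trans (ler_normD _ _) _; apply: le_trans (lerD h2 (blin_norm _ _)) _.
  rewrite -mulrDl ler_wpM2r// /Mg.
  have : e2 <= 1 by rewrite ge_min lexx.
  by have := normr_ge0 (g x); lra.
have e13 : C * e1 * Mg <= e / 3.
  have : e1 <= e / (3 * C * Mg) by rewrite ge_min lexx orbT.
  by rewrite ler_pdivlMr ?mulr_gt0// => ?; lra.
have e23 : C * e2 * Mf <= e / 3.
  have : e2 <= e / (3 * C * Mf) by rewrite ge_min lexx orbT.
  by rewrite ler_pdivlMr ?mulr_gt0// => ?; lra.
have h3 : C * (MF * Mg) * `|h| <= e / 3.
  move: hd32; rewrite ltr_pdivlMr ?mulr_gt0// => ?; lra.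
have t1 : `|B (f (x + h) - f x - F h) (g (x + h))| <= e / 3 * `|h|.
  apply: le_trans (BC _ _) _.
  apply: (@le_trans _ _ (C * (e1 * `|h| * Mg))).
    by rewrite ler_pM2l// ler_pM.
  by rewrite [X in X <= _](_ : _ = C * e1 * Mg * `|h|); [rewrite ler_wpM2r|ring].
have t2 : `|B (F h) (g (x + h) - g x)| <= e / 3 * `|h|.
  apply: le_trans (BC _ _) _.
  apply: (@le_trans _ _ (C * (MF * `|h| * (Mg * `|h|)))).
    rewrite ler_pM2l// ler_pM//; apply: le_trans (blin_norm _ _) _.
    by rewrite ler_wpM2r// /MF lerDl.
  rewrite [X in X <= _](_ : _ = C * (MF * Mg) * `|h| * `|h|); last by ring.
  by rewrite ler_wpM2r.
have t3 : `|B (f x) (g (x + h) - g x - G h)| <= e / 3 * `|h|.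
  apply: le_trans (BC _ _) _.
  apply: (@le_trans _ _ (C * (Mf * (e2 * `|h|)))).
    by rewrite ler_pM2l// ler_pM// /Mf lerDl.
  by rewrite [X in X <= _](_ : _ = C * e2 * Mf * `|h|); [rewrite ler_wpM2r|ring].
apply: le_trans (ler_normD _ _) _; apply: le_trans (lerD (ler_normD _ _) (lexx _)) _.
lra.
Qed.

Context (V : normedModType R) (U : set V).

Lemma diff_timesS n W (f : V -> W) : diff_times U n.+1 f -> diff_times U n f.
Proof.
elim: n W f => [//|n IH] W f [F [dF FF]]; exists F; split => //.
exact: IH.
Qed.

Lemma eq_diff_times n W (f g : V -> W) : f =1 g ->
  diff_times U n f -> diff_times U n g.
Proof. by move=> /funext ->. Qed.

Lemma diff_times_cst n W (w : W) : diff_times U n (fun=> w).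
Proof.
elim: n W w => [//|n IH] W w; exists (fun=> 0); split=> [x _|]; last exact: IH.
apply/is_diff_epsP => e e0; exists 1 => // h _.
by rewrite subrr sub0r oppr0 normr0 mulr_ge0// ltW.
Qed.

Lemma is_diff_lin W (f : blin V W) x : is_diff x f f.
Proof.
apply/is_diff_epsP => e e0; exists 1 => // h _.
have -> : f (x + h) = f x + f h by have := blin_linear f 1 x h; rewrite !scale1r.
by rewrite [f x + _]addrC addrK subrr normr0 mulr_ge0// ltW.
Qed.

Lemma diff_times_lin n W (f : blin V W) : diff_times U n f.
Proof.
case: n => // n; exists (fun=> f); split=> [x _|]; first exact: is_diff_lin.
exact: diff_times_cst.
Qed.

Lemma is_diff_add W (f g : V -> W) (F G : blin V W) x :
  is_diff x f F -> is_diff x g G -> is_diff x (fun y => f y + g y) (F + G : blin V W).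
Proof.
move=> /is_diff_epsP df /is_diff_epsP dg; apply/is_diff_epsP => e e0.
have e20 : 0 < e / 2 by lra.
have [d1 d10 h1] := df _ e20; have [d2 d20 h2] := dg _ e20.
exists (Num.min d1 d2); first by rewrite lt_min d10.
move=> h; rewrite lt_min => /andP[/h1 {}h1 /h2 {}h2].
rewrite blinD; have -> : f (x + h) + g (x + h) - (f x + g x) - (F h + G h) =
  (f (x + h) - f x - F h) + (g (x + h) - g x - G h).
  by rewrite opprD addrACA (opprD (F h)) [LHS]addrACA.
by apply: le_trans (ler_normD _ _) _; lra.
Qed.

Lemma diff_times_add n W (f g : V -> W) :
  diff_times U n f -> diff_times U n g -> diff_times U n (fun x => f x + g x).
Proof.
elim: n W f g => [//|n IH] W f g [F [dF FF]] [G [dG GG]].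
exists (fun x => F x + G x); split; last exact: IH.
by move=> x Ux; apply: is_diff_add; [exact: dF|exact: dG].
Qed.

(** The derivative of B(f, g) is a sum of two bounded bilinear maps, evaluated at
    (f', g) and at (f, g'), which are one time less differentiable; the induction
    therefore runs over all bounded bilinear maps at once. *)
Lemma diff_times_bil n U' V' W (B : U' -> V' -> W) (f : V -> U') (g : V -> V') :
  bounded_bilinear B -> diff_times U n f -> diff_times U n g ->
  diff_times U n (fun x => B (f x) (g x)).
Proof.
elim: n U' V' W B f g => [//|n IH] U' V' W B f g bB df dg.
have df' := diff_timesS df; have dg' := diff_timesS dg.
move: df dg => [F [dF FF]] [G [dG GG]].
exists (fun x => bil_comp_l B (F x) (g x) + bil_comp_r B (f x) (G x)); split.
  by move=> x Ux; apply: is_diff_bil => //; [exact: dF|exact: dG].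
apply: diff_times_add.
  exact: (IH _ _ _ _ F g (bil_comp_l_bil V bB) FF dg').
exact: (IH _ _ _ _ f G (bil_comp_r_bil V bB) df' GG).
Qed.

Lemma diff_times_sum n W (I : Type) (r : seq I) (f : I -> V -> W) :
  (forall i, diff_times U n (f i)) ->
  diff_times U n (fun x => \sum_(i <- r) f i x).
Proof.
move=> df; elim: r => [|i r IH].
  apply: eq_diff_times (diff_times_cst n 0) => x; by rewrite big_nil.
apply: eq_diff_times (diff_times_add (df i) IH) => x; by rewrite big_cons.
Qed.

Lemma is_diff_near W (f g : V -> W) (F : blin V W) x :
  (\forall y \near x, f y = g y) -> is_diff x f F -> is_diff x g F.
Proof.
move=> /nbhs_ballP[r /= r0 hr] /is_diff_epsP df; apply/is_diff_epsP => e /df[d d0 hd].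
exists (Num.min d r) => [|h]; first by rewrite lt_min d0.
rewrite lt_min => /andP[/hd {}hd hr']; rewrite -!hr//; first exact: ballxx.
by rewrite -ball_normE/= opprD addrA subrr sub0r normrN.
Qed.

(** Only the first derivative has to be transferred: the higher ones are
    derivatives of the same map F. *)
Lemma smooth_local W (f g : V -> W) :
  (forall x, U x -> \forall y \near x, f y = g y) ->
  smooth_on U f -> smooth_on U g.
Proof.
move=> fg sf [//|n]; have [F [dF FF]] := sf n.+1; exists F; split => // x Ux.
exact: is_diff_near (fg x Ux) (dF x Ux).
Qed.

End Calculus.

(** * The algebra of bounded functions and its power maps *)

Section PowerTaylor.
Context {R : realType}.
Implicit Types a c M x y : R.

Lemma powR_bounded a c M : 0 < c -> exists C, forall x, c <= x <= M -> x `^ a <= C.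
Proof.
move=> c0; exists (c `^ a + M `^ a) => x /andP[cx xM].
have x0 : 0 < x by exact: lt_le_trans cx.
have [a0|a0] := leP 0 a.
  apply: (@le_trans _ _ (M `^ a)); last by rewrite lerDr powR_ge0.
  by apply: ge0_ler_powR; rewrite ?nnegrE//; lra.
apply: (@le_trans _ _ (c `^ a)); last by rewrite lerDl powR_ge0.
rewrite -[a]opprK !(powRN _ (- a)) lef_pV2 ?posrE ?powR_gt0//.
by apply: ge0_ler_powR; rewrite ?nnegrE//; lra.
Qed.

Lemma powR_lipschitz a c M : 0 < c -> exists2 C, 0 <= C & forall x y,
  c <= x <= M -> c <= y <= M -> `|y `^ a - x `^ a| <= C * `|y - x|.
Proof.
move=> c0; have [C HC] := powR_bounded (a - 1) M c0.
have lip x y : c <= x <= M -> c <= y <= M -> x <= y ->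
    `|y `^ a - x `^ a| <= `|a| * `|C| * `|y - x|.
  move=> cx cy xy.
  have pos z : x <= z -> 0 < z by move=> xz; lra.
  have [z | | z /[!in_itv]/= /andP[xz zy] ->] :=
      @MVT_segment R (fun z => z `^ a) (fun z => a * z `^ (a - 1)) x y xy.
  - by rewrite in_itv/= => /andP[xz _]; apply: is_derive1_powR; apply: pos; exact: ltW.
  - apply: continuous_in_subspaceT => z; rewrite inE/= in_itv/= => /andP[xz _].
    apply/differentiable_continuous/derivable1_diffP.
    by apply: derivable_powR; rewrite in_itv/= pos.
  rewrite !normrM ler_wpM2r// ler_wpM2l// ger0_norm ?powR_ge0//.
  by apply: le_trans (ler_norm _); apply: HC; lra.
exists (`|a| * `|C|); first exact: mulr_ge0.
move=> x y cx cy; have [xy|/ltW yx] := leP x y; first exact: lip.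
by rewrite distrC [in leRHS]distrC; exact: lip.
Qed.

(** The mean value theorem, applied first to the power and then, through the
    Lipschitz bound, to its derivative. *)
Lemma powR_taylor a c M : 0 < c -> exists2 C, 0 <= C & forall x y,
  c <= x <= M -> c <= y <= M ->
  `|y `^ a - x `^ a - a * x `^ (a - 1) * (y - x)| <= C * `|y - x| ^+ 2.
Proof.
move=> c0; have [C C0 HC] := powR_lipschitz (a - 1) M c0.
exists (`|a| * C) => [|x y cx cy]; first exact: mulr_ge0.
have [z zI ->] : exists2 z, Num.min x y <= z <= Num.max x y &
    y `^ a - x `^ a = a * z `^ (a - 1) * (y - x).
  have pos z : Num.min x y <= z -> 0 < z.
    by apply: lt_le_trans; rewrite lt_min; lra.
  wlog xy : x y cx cy pos / x <= y => [H|].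
    have /orP[xy|yx] := le_total x y; first exact: H.
    have pos' z : Num.min y x <= z -> 0 < z by rewrite minC; exact: pos.
    have [z zI e] := H _ _ cy cx pos' yx.
    exists z; first by rewrite minC maxC.
    by rewrite -(opprB x y) mulrN -e opprB.
  have [z | | z /[!in_itv]/= zI ->] :=
      @MVT_segment R (fun z => z `^ a) (fun z => a * z `^ (a - 1)) x y xy.
  - rewrite in_itv/= => /andP[xz _]; apply: is_derive1_powR; apply: pos.
    by rewrite (min_idPl xy) ltW.
  - apply: continuous_in_subspaceT => z; rewrite inE/= in_itv/= => /andP[xz _].
    apply/differentiable_continuous/derivable1_diffP.
    by apply: derivable_powR; rewrite in_itv/= pos// (min_idPl xy).
  by exists z => //; rewrite (min_idPl xy) (max_idPr xy).
have {zI} [cz zx] : c <= z <= M /\ `|z - x| <= `|y - x|.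
  move: zI; rewrite /Num.min /Num.max; case: ltP => xy zI; split; try lra.
    by rewrite !ger0_norm ?subr_ge0; lra.
  by rewrite !ler0_norm ?subr_le0; lra.
rewrite -mulrBl -mulrBr !normrM expr2 mulrA ler_wpM2r// -mulrA ler_wpM2l//.
by apply: le_trans (HC _ _ cx cz) _; rewrite ler_wpM2l.
Qed.

End PowerTaylor.

Section BoundedFunctions.
Context {R : realType} d (T : measurableType d).

Definition bmf_pred : {pred T -> R} := [pred f : T -> R |
  `[< measurable_fun setT f /\ exists M, forall t, `|f t| <= M >]].

Lemma bmf_submod_closed : submod_closed bmf_pred.
Proof.
split.
- apply/asboolP; split; first exact: measurable_cst.
  by exists 0 => t; rewrite normr0.
- move=> a f g /asboolP[mf [M fM]] /asboolP[mg [N gN]]; apply/asboolP; split.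
    by apply: measurable_funD => //; exact: measurable_funM.
  exists (`|a| * M + N) => t; apply: le_trans (ler_normD _ _) _.
  by rewrite lerD// normrM ler_wpM2l.
Qed.

HB.instance Definition _ :=
  GRing.isSubmodClosed.Build R (T -> R) bmf_pred bmf_submod_closed.

Record bmf := Bmf { bmf_fun :> T -> R; _ : bmf_fun \in bmf_pred }.

HB.instance Definition _ := [isSub for bmf_fun].
HB.instance Definition _ := [Choice of bmf by <:].
HB.instance Definition _ := [SubChoice_isSubLmodule of bmf by <:].

Implicit Types f g : bmf.

Lemma bmf_measurable f : measurable_fun setT f.
Proof. by case: f => f /= /asboolP[]. Qed.

Lemma bmf_bounded f : exists M, forall t, `|f t| <= M.
Proof. by case: f => f /= /asboolP[]. Qed.

Lemma bmfD f g t : (f + g : bmf) t = f t + g t.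
Proof. by []. Qed.

Lemma bmfN f t : (- f : bmf) t = - f t.
Proof. by []. Qed.

Lemma bmfZ a f t : (a *: f : bmf) t = a * f t.
Proof. by []. Qed.

Lemma bmf_sum I (r : seq I) (F : I -> bmf) t :
  (\sum_(i <- r) F i) t = \sum_(i <- r) F i t.
Proof.
by elim: r => [|i r IH]; rewrite ?big_nil// !big_cons bmfD IH.
Qed.

Lemma bmfP f g : f =1 g -> f = g.
Proof. by move=> fg; apply/val_inj/funext. Qed.

Lemma tobmf_subproof (f : T -> R) : {g : bmf | measurable_fun setT f ->
  (exists M, forall t, `|f t| <= M) -> g = f :> (T -> R)}.
Proof. by exists (insubd 0 f) => mf fM; rewrite insubdK//; apply/asboolP. Qed.

Definition tobmf (f : T -> R) : bmf := sval (tobmf_subproof f).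

Lemma tobmfE (f : T -> R) M : measurable_fun setT f -> (forall t, `|f t| <= M) ->
  tobmf f = f :> (T -> R).
Proof. by move=> mf fM; apply: (svalP (tobmf_subproof f)) => //; exists M. Qed.

(** The value 0 is adjoined so that the supremum is taken over a nonempty set
    whatever the domain. *)
Definition bmf_norm f : R := sup [set x | x = 0 \/ exists t, x = `|f t|].

Lemma bmf_has_sup f : has_sup [set x | x = 0 \/ exists t, x = `|f t|].
Proof.
split; first by exists 0; left.
have [M fM] := bmf_bounded f; exists (Num.max 0 M) => _ [->|[t ->]].
  by rewrite le_max lexx.
by rewrite le_max fM orbT.
Qed.

Lemma bmf_norm_ub f t : `|f t| <= bmf_norm f.
Proof. by apply: ub_le_sup; [case: (bmf_has_sup f)|right; exists t]. Qed.

Lemma bmf_norm_ge0 f : 0 <= bmf_norm f.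
Proof. by apply: ub_le_sup; [case: (bmf_has_sup f)|left]. Qed.

Lemma bmf_norm_le f M : 0 <= M -> (forall t, `|f t| <= M) -> bmf_norm f <= M.
Proof.
move=> M0 fM; apply: ge_sup; first by case: (bmf_has_sup f).
by move=> _ [->|[t ->]].
Qed.

Lemma bmf_normD f g : bmf_norm (f + g) <= bmf_norm f + bmf_norm g.
Proof.
apply: bmf_norm_le => [|t]; first by rewrite addr_ge0// bmf_norm_ge0.
by rewrite bmfD (le_trans (ler_normD _ _))// lerD// bmf_norm_ub.
Qed.

Lemma bmf_normZ a f : bmf_norm (a *: f) = `|a| * bmf_norm f.
Proof.
have le b g : bmf_norm (b *: g) <= `|b| * bmf_norm g.
  apply: bmf_norm_le => [|t]; first by rewrite mulr_ge0// bmf_norm_ge0.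
  by rewrite bmfZ normrM ler_wpM2l// bmf_norm_ub.
apply/eqP; rewrite eq_le le/=; have [->|a0] := eqVneq a 0.
  by rewrite normr0 mul0r bmf_norm_ge0.
have := le a^-1 (a *: f); rewrite scalerA mulVf// scale1r normfV.
by rewrite ler_pdivlMl ?normr_gt0.
Qed.

Lemma bmf_norm_eq0 f : bmf_norm f = 0 -> f = 0.
Proof.
move=> f0; apply: bmfP => t; apply/eqP; rewrite -normr_le0 -f0.
exact: bmf_norm_ub.
Qed.

HB.instance Definition _ :=
  Lmodule_isNormed.Build R bmf bmf_normD bmf_normZ bmf_norm_eq0.

Lemma ler_bmf_norm f t : `|f t| <= `|f|.
Proof. exact: bmf_norm_ub. Qed.

Lemma bmf_ler_norm f M : 0 <= M -> (forall t, `|f t| <= M) -> `|f| <= M.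
Proof. exact: bmf_norm_le. Qed.

Lemma bmul_subproof f g : {k : bmf | forall t, k t = f t * g t}.
Proof.
exists (tobmf (fun t => f t * g t)) => t; rewrite (@tobmfE _ (`|f| * `|g|))//.
  by apply: measurable_funM; exact: bmf_measurable.
by move=> {}t; rewrite normrM ler_pM// ler_bmf_norm.
Qed.

Definition bmul f g : bmf := sval (bmul_subproof f g).

Lemma bmulE f g t : bmul f g t = f t * g t.
Proof. exact: (svalP (bmul_subproof f g)). Qed.

Lemma bmul_bilinear c : bounded_bilinear (fun f g => c *: bmul f g).
Proof.
split=> [g a f f'|g a f f'|].
- by apply: bmfP => t; rewrite !(bmfD, bmfZ, bmulE); ring.
- by apply: bmfP => t; rewrite !(bmfD, bmfZ, bmulE); ring.
- exists `|c| => // f g; rewrite normrZ ler_wpM2l//.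
  apply: bmf_ler_norm => [|t]; first exact: mulr_ge0.
  by rewrite bmulE normrM ler_pM// ler_bmf_norm.
Qed.

Lemma bmul_bilinear1 : bounded_bilinear bmul.
Proof.
by have := bmul_bilinear 1; rewrite (_ : (fun _ => _) = bmul)//;
   apply/funext => f; apply/funext => g; rewrite scale1r.
Qed.

(** Uniform positivity, which unlike pointwise positivity is an open condition
    for the supremum norm. *)
Definition bpos f := exists2 c, 0 < c & forall t, c <= f t.

Lemma bpow_subproof (a : R) f : {k : bmf | bpos f -> forall t, k t = f t `^ a}.
Proof.
exists (tobmf (fun t => f t `^ a)) => -[c c0 cf] t.
have [C HC] := powR_bounded a `|f| c0.
rewrite (@tobmfE _ C)//.
  exact: (measurableT_comp (measurable_powR _) (bmf_measurable f)).
move=> {}t; rewrite ger0_norm ?powR_ge0// HC// cf/=.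
by apply: le_trans (ler_norm _) _; exact: ler_bmf_norm.
Qed.

Definition bpow (a : R) f : bmf := sval (bpow_subproof a f).

Lemma bpowE a f t : bpos f -> bpow a f t = f t `^ a.
Proof. by move=> pf; apply: (svalP (bpow_subproof a f)). Qed.

Lemma bpos_near f : bpos f -> exists2 r, 0 < r & forall g, `|g - f| < r -> bpos g.
Proof.
move=> [c c0 cf]; exists (c / 2) => [|g gf]; first lra.
exists (c / 2) => [|t]; first lra.
have := ler_bmf_norm (g - f) t; rewrite bmfD bmfN => h.
have := cf t; have := ler_norm (- (g t - f t)); rewrite normrN; lra.
Qed.

Lemma bpow_taylor a f : bpos f -> exists2 r, 0 < r & exists2 C, 0 <= C &
  forall g, `|g| < r -> `|bpow a (f + g) - bpow a f - a *: bmul (bpow (a - 1) f) g|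
     <= C * `|g| ^+ 2.
Proof.
move=> pf; have [c c0 cf] := pf.
have c20 : 0 < c / 2 by lra.
have [C C0 HC] := powR_taylor a (`|f| + c / 2) c20.
exists (c / 2) => //; exists C => // g gr.
have fg t : c / 2 <= (f + g) t <= `|f| + c / 2.
  rewrite bmfD; have := ler_bmf_norm g t; have := cf t; have := ler_bmf_norm f t.
  have := ler_norm (f t); have := ler_norm (g t).
  by have := ler_norm (- g t); rewrite normrN; lra.
have pfg : bpos (f + g) by exists (c / 2) => // t; have /andP[] := fg t.
apply: bmf_ler_norm => [|t]; first by rewrite mulr_ge0.
rewrite !(bmfD, bmfN, bmfZ, bmulE, bpowE)//.
have := HC (f t) ((f + g) t).
have -> : (f + g) t - f t = g t by rewrite bmfD addrC addKr.
rewrite bmfD => h; rewrite (mulrA a); apply: le_trans (h _ _) _.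
- have := cf t; have := ler_bmf_norm f t; have := ler_norm (f t); lra.
- by rewrite -bmfD; exact: fg.
- by rewrite ler_wpM2l// ler_pXn2r ?nnegrE// ler_bmf_norm.
Qed.

Section Composition.
Context (V : normedModType R) (U : set V).

Lemma is_diff_bpow a (f : V -> bmf) (F : blin V bmf) x :
  bpos (f x) -> is_diff x f F ->
  is_diff x (fun y => bpow a (f y))
    (bil_comp_r (fun k h => a *: bmul k h) (bpow (a - 1) (f x)) F).
Proof.
move=> pf /is_diff_epsP df; apply/is_diff_epsP => e e0.
have [r r0 [C C0 HC]] := bpow_taylor a pf.
have bB := bmul_bilinear a.
have [K K0 HK] := bil_bound bB.
pose L := `|F| + 1; have L0 : 0 < L by rewrite ltr_wpDl.
pose N := K * (`|bpow (a - 1) (f x)| + 1).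
have N0 : 0 < N by rewrite mulr_gt0// ltr_wpDl.
pose e1 := Num.min 1 (e / (2 * N)).
have e10 : 0 < e1 by rewrite lt_min ltr01/= !(divr_gt0, mulr_gt0).
have [d1 d10 h1] := df _ e10.
pose d2 := e / (2 * (C + 1) * L ^+ 2).
have d20 : 0 < d2.
  by rewrite divr_gt0// !mulr_gt0 ?exprn_gt0//; lra.
exists (Num.min d1 (Num.min d2 (r / L))).
  by rewrite lt_min d10 lt_min d20 divr_gt0.
move=> h; rewrite lt_min => /andP[hd1]; rewrite lt_min => /andP[hd2 hdr].
have {}h1 := h1 _ hd1.
set k := f (x + h) - f x in h1 *.
have kL : `|k| <= L * `|h|.
  have -> : k = (k - F h) + F h by rewrite subrK.
  apply: le_trans (ler_normD _ _) _; apply: le_trans (lerD h1 (blin_norm _ _)) _.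
  rewrite -mulrDl ler_wpM2r// /L addrC lerD2l.
  by rewrite ge_min lexx.
have kr : `|k| < r.
  by apply: le_lt_trans kL _; move: hdr; rewrite ltr_pdivlMr// mulrC.
have fk : f (x + h) = f x + k by rewrite /k (addrC (f x)) subrK.
rewrite bil_comp_rE// fk.
have -> : bpow a (f x + k) - bpow a (f x) - a *: bmul (bpow (a - 1) (f x)) (F h)
  = (bpow a (f x + k) - bpow a (f x) - a *: bmul (bpow (a - 1) (f x)) k)
    + a *: bmul (bpow (a - 1) (f x)) (k - F h).
  have Bk : a *: bmul (bpow (a - 1) (f x)) (k - F h) =
      a *: bmul (bpow (a - 1) (f x)) k - a *: bmul (bpow (a - 1) (f x)) (F h).
    exact: (bilBr bB).
  by rewrite Bk [RHS]addrA subrK.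
apply: le_trans (ler_normD _ _) _; apply: le_trans (lerD (HC _ kr) (HK _ _)) _.
have t1 : C * `|k| ^+ 2 <= e / 2 * `|h|.
  apply: (@le_trans _ _ ((C + 1) * (L * `|h|) ^+ 2)).
    rewrite ler_pM ?exprn_ge0//; first by rewrite lerDl.
    by rewrite ler_pXn2r ?nnegrE// mulr_ge0// ltW.
  rewrite exprMn (expr2 `|h|) !mulrA ler_wpM2r//.
  move: hd2; rewrite /d2 ltr_pdivlMr; last by rewrite !mulr_gt0 ?exprn_gt0//; lra.
  move=> ?; lra.
have t2 : K * (`|bpow (a - 1) (f x)| * `|k - F h|) <= e / 2 * `|h|.
  apply: (@le_trans _ _ (N * (e1 * `|h|))).
    by rewrite /N -mulrA ler_pM2l// ler_pM// lerDl.
  rewrite mulrA ler_wpM2r//.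
  have : e1 <= e / (2 * N) by rewrite ge_min lexx orbT.
  by rewrite ler_pdivlMr ?mulr_gt0// => ?; lra.
lra.
Qed.

(** Differentiating lowers the exponent by one, so the induction is over all
    exponents simultaneously. *)
Lemma diff_times_bpow n a (f : V -> bmf) : (forall x, U x -> bpos (f x)) ->
  diff_times U n f -> diff_times U n (fun y => bpow a (f y)).
Proof.
elim: n a f => [//|n IH] a f pf df.
have df' := diff_timesS df; move: df => [F [dF FF]].
exists (fun x => bil_comp_r (fun k h => a *: bmul k h) (bpow (a - 1) (f x)) (F x)).
split; first by move=> x Ux; apply: is_diff_bpow; [exact: pf|exact: dF].
apply: (diff_times_bil (f := fun x => bpow (a - 1) (f x)) (g := F)
   (bil_comp_r_bil V (bmul_bilinear a))) => //.
exact: IH.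
Qed.

End Composition.
End BoundedFunctions.

(** * Lebesgue integrals over the circle *)

Local Notation leb := lebesgue_measure.

Section Isometries.
Context {R : realType}.
Implicit Types (f : R -> \bar R) (a b c : R).

(** A measure on the line is determined by its values on half-open intervals. *)
Lemma ge0_integral_isometry (phi : measurableTypeR R -> measurableTypeR R) f (D : set R) :
  measurable_fun setT phi ->
  (forall a b, leb (phi @^-1` `]a, b]) = leb (`]a, b] : set R)) ->
  measurable D -> measurable_fun setT f -> (forall y, (0 <= f y)%E) ->
  (\int[leb]_(y in D) f y = \int[leb]_(x in phi @^-1` D) f (phi x))%E.
Proof.
move=> mphi phiI mD mf f0.
pose m : {measure set (measurableTypeR R) -> \bar R} :=
  measure_function_pushforward__canonical__measure_function_Measure leb mphi.
transitivity (integral m D f).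
  apply: eq_measure_integral => A mA AS.
  apply: (@lebesgue_measure_unique R m) => //= _ [[a b] _ <-].
  exact/esym/phiI.
apply: (ge0_integral_pushforward mphi) => //; exact: measurable_funS mf.
Qed.

Lemma integral_translate f a b c : measurable_fun setT f -> (forall y, (0 <= f y)%E) ->
  (\int[leb]_(y in `[(a + c)%R, (b + c)%R[) f y = \int[leb]_(x in `[a, b[) f (x + c)%R)%E.
Proof.
move=> mf f0.
rewrite (@ge0_integral_isometry (fun x => x + c))//; last first.
  move=> p q; rewrite (_ : _ @^-1` _ = `]p - c, q - c]%classic); last first.
    by apply/seteqP; split=> x /=; rewrite !in_itv/= => /andP[? ?]; apply/andP; lra.
  rewrite !lebesgue_measure_itv/= !lte_fin ltrD2r -!EFinD.
  by rewrite [q - c - _](_ : _ = q - p)//; ring.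
  exact: measurable_funD.
rewrite (_ : _ @^-1` _ = `[a, b[%classic)//.
by apply/seteqP; split=> x /=; rewrite !in_itv/= => /andP[? ?]; apply/andP; lra.
Qed.

Lemma integral_reflect f a b c : measurable_fun setT f -> (forall y, (0 <= f y)%E) ->
  (\int[leb]_(y in `]a, b[) f y = \int[leb]_(x in `](c - b)%R, (c - a)%R[) f (c - x)%R)%E.
Proof.
move=> mf f0.
rewrite (@ge0_integral_isometry (fun x => c - x))//; last first.
  move=> p q; rewrite (_ : _ @^-1` _ = `[c - q, c - p[%classic); last first.
    by apply/seteqP; split=> x /=; rewrite !in_itv/= => /andP[? ?]; apply/andP; lra.
  rewrite !lebesgue_measure_itv/= !lte_fin ltrD2l ltrN2 -!EFinD.
  by rewrite [c - p - _](_ : _ = q - p)//; ring.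
  exact: measurable_funB.
rewrite (_ : _ @^-1` _ = `]c - b, c - a[%classic)//.
by apply/seteqP; split=> x /=; rewrite !in_itv/= => /andP[? ?]; apply/andP; lra.
Qed.

Lemma integral_split_co f a b c : measurable_fun setT f -> (forall y, (0 <= f y)%E) ->
  a <= b -> b <= c ->
  (\int[leb]_(y in `[a, c[) f y =
   \int[leb]_(y in `[a, b[) f y + \int[leb]_(y in `[b, c[) f y)%E.
Proof.
move=> mf f0 ab bc; rewrite -ge0_integral_setU//.
- congr (integral _ _ _); apply/seteqP; split=> x /=; rewrite !in_itv/=.
    by move=> /andP[? ?]; have [?|?] := ltP x b; [left|right]; apply/andP.
  by case=> /andP[? ?]; apply/andP; split; lra.
- exact: measurable_funS mf.
- rewrite disj_set2E; apply/eqP/seteqP; split => // x [] /=; rewrite !in_itv/=.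
  by move=> /andP[? ?] /andP[? ?]; lra.
Qed.

Lemma periodic_int (V : Type) (f : R -> V) : (forall x, f (x + 1) = f x) ->
  forall x (k : int), f (x + k%:~R) = f x.
Proof.
move=> pf x k.
have fn y (n : nat) : f (y + n%:R) = f y.
  elim: n => [|n IH]; first by rewrite addr0.
  by rewrite -natr1 addrA pf.
case: k => n; first exact: fn.
by rewrite NegzE mulrNz -(fn _ n.+1) addrNK.
Qed.

Lemma integral_period f a : measurable_fun setT f -> (forall y, (0 <= f y)%E) ->
  (forall x, f (x + 1) = f x) ->
  (\int[leb]_(y in `[0%R, 1%R[) f y = \int[leb]_(y in `[a, (a + 1)%R[) f y)%E.
Proof.
move=> mf f0 pf.
have pfk := periodic_int pf.
pose b := a - (Num.floor a)%:~R.
have [b0 b1] : 0 <= b /\ b < 1.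
  rewrite /b subr_ge0 floor_le; split => //.
  by rewrite ltrBlDl -[X in _ + X]/(1%:~R) -intrD floorD1_gt.
have [k ->] : exists k : int, a = b + k%:~R.
  by exists (Num.floor a); rewrite subrK.
move: b b0 b1 => b b0 b1.
have -> : b + k%:~R + 1 = b + 1 + k%:~R by rewrite addrAC.
rewrite integral_translate//; under [RHS]eq_integral do rewrite pfk.
rewrite (@integral_split_co _ 0 b 1)// ?ltW//.
rewrite (@integral_split_co _ b 1 (b + 1))//; [|exact: ltW|by rewrite lerDr].
rewrite addeC; congr (_ + _)%E.
have := @integral_translate f 0 b 1 mf f0; rewrite add0r => ->.
by under [RHS]eq_integral do rewrite pf.
Qed.

End Isometries.

Section Wrap.
Context {R : realType}.
Implicit Types t x y : R.

(** The representative of t modulo the integers that lies in [-1/2, 1/2). *)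
Definition sdist t : R := t - (Num.floor (t + 1 / 2))%:~R.

Lemma sdist_bound t : - (1 / 2) <= sdist t < 1 / 2.
Proof.
rewrite /sdist; have := floor_le (t + 1 / 2); have := floorD1_gt (t + 1 / 2).
rewrite intrD => ? ?; apply/andP; split; lra.
Qed.

Lemma norm_sdist_le t : `|sdist t| <= 1 / 2.
Proof. by have /andP[? ?] := sdist_bound t; rewrite ler_norml; lra. Qed.

Lemma sdistDz t (k : int) : sdist (t + k%:~R) = sdist t.
Proof. by rewrite /sdist [t + _ + 1 / 2]addrAC floorDrz ?intr_int// intrD intrKfloor; ring. Qed.

Lemma sdist_id t : - (1 / 2) <= t < 1 / 2 -> sdist t = t.
Proof.
move=> /andP[t1 t2]; rewrite /sdist (_ : Num.floor _ = 0) ?subr0//.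
apply/eqP; rewrite floor_eq/=; apply/andP; split; lra.
Qed.

Lemma sdistE t : exists k : int, sdist t = t + k%:~R.
Proof. by exists (- Num.floor (t + 1 / 2)); rewrite mulrNz. Qed.

Lemma sdist_eq0 t : sdist t = 0 -> exists k : int, t = k%:~R.
Proof.
by move=> /eqP; rewrite subr_eq0 => /eqP; exists (Num.floor (t + 1 / 2)).
Qed.

Lemma measurable_sdist : measurable_fun setT sdist.
Proof.
apply: measurable_funB => //; apply: nondecreasing_measurable => // x y xy.
by rewrite ler_int; apply: le_floor; rewrite lerD2r.
Qed.

Lemma rho_sdist x y : rho x y = `|sdist (x - y)|.
Proof.
apply/eqP; rewrite eq_le; apply/andP; split.
  have [k ->] := sdistE (x - y); apply: ge_inf; last by exists k.
  by exists 0 => _ [l _ <-].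
apply: lb_le_inf; first by exists `|x - y + 0%:~R|, 0.
move=> _ [k _ <-]; rewrite -(sdistDz (x - y) k).
move: (x - y + _) => t; have := norm_sdist_le t; have [l] := sdistE t.
have [->|l0] := eqVneq l 0; first by rewrite addr0 => ->.
move=> e h; apply: le_trans h _.
have : 1 <= `|l%:~R : R| by rewrite -intr_norm -[X in X <= _]/(1%:~R) ler_int -gtz0_ge1 normr_gt0.
have -> : l%:~R = sdist t - t :> R by rewrite e addrC addKr.
move=> h; have := ler_normB (sdist t) t; have := norm_sdist_le t; lra.
Qed.

End Wrap.

(** * Embedding of the Sobolev space into C^1 *)

Section Tonelli.
Context {R : realType}.
Local Notation Rm := (measurableTypeR R).
Variables (D1 D2 : set Rm) (mD1 : measurable D1) (mD2 : measurable D2).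
Variable G : Rm * Rm -> \bar R.
Hypotheses (mG : measurable_fun setT G) (G0 : forall z, (0 <= G z)%E).

Let mGD : measurable_fun setT (G \_ (D1 `*` D2)).
Proof.
apply/(measurable_restrictT _ _).1; first exact: measurableX.
exact: measurable_funS mG.
Qed.

Lemma tonelli_rect :
  (\int[leb2 R]_(z in D1 `*` D2) G z =
   \int[leb]_(x in D1) \int[leb]_(y in D2) G (x, y))%E.
Proof.
rewrite integral_mkcond fubini_tonelli1//; last first.
  by move=> z; rewrite patchE; case: ifP.
rewrite [RHS]integral_mkcond; apply: eq_integral => x _.
rewrite /fubini_F patchE; case: ifPn => [/set_mem xD|xD].
  rewrite [RHS]integral_mkcond; apply: eq_integral => y _.
  rewrite !patchE; congr (if _ then _ else _).
  by apply/idP/idP => [/set_mem[_ /= yD]|/set_mem yD]; rewrite inE//; split.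
rewrite integral0_eq// => y _; rewrite patchE ifF//; apply/negP => /set_mem[/= xD' _].
by move/negP: xD; apply; rewrite inE.
Qed.

Lemma measurable_section_integral :
  measurable_fun setT (fun x => \int[leb]_(y in D2) G (x, y))%E.
Proof.
rewrite (_ : (fun x => _) = fubini_F leb (G \_ (setT `*` D2))); last first.
  apply/funext => x; rewrite /fubini_F [LHS]integral_mkcond.
  apply: eq_integral => y _; rewrite !patchE; congr (if _ then _ else _).
  by apply/idP/idP => [/set_mem yD|/set_mem[_ /= yD]]; rewrite inE//; split.
apply: measurable_fun_fubini_tonelli_F => [|z]; last by rewrite patchE; case: ifP.
apply/(measurable_restrictT _ _).1; first exact: measurableX.
exact: measurable_funS mG.
Qed.

End Tonelli.

Section Averages.
Context {R : realType}.
Variables (v : R -> R) (cv : continuous v).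
Implicit Types p l c : R.

Definition avg p l : R := l^-1 * \int[leb]_(t in `[p, p + l]) v t.

Lemma continuous_itv_integrable (f : R -> R) a b : continuous f ->
  leb.-integrable `[a, b] (EFin \o f).
Proof.
move=> cf; apply: continuous_compact_integrable; first exact: segment_compact.
exact: continuous_subspaceT.
Qed.

Lemma leb_itv_len p l : 0 < l -> fine (leb (`[p, p + l] : set R)) = l.
Proof.
by move=> l0; rewrite lebesgue_measure_itv/= lte_fin ltrDl l0/=; ring.
Qed.

Lemma continuous_normB c : continuous (fun t => `|v t - c|).
Proof.
move=> t; apply: (@continuous_comp _ _ _ (fun t => v t - c) (@Num.norm _ R)); last exact: norm_continuous.
by apply: cvgB; [exact: cv|exact: cvg_cst].
Qed.

Lemma avg_subc p l c : 0 < l -> avg p l - c = l^-1 * \int[leb]_(t in `[p, p + l]) (v t - c).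
Proof.
move=> l0; rewrite RintegralB//; last 2 first.
- exact: continuous_itv_integrable.
- by apply: (continuous_itv_integrable _ _ (f := cst c)) => ?; exact: cvg_cst.
rewrite Rintegral_cst// [X in c * X](leb_itv_len p l0).
by rewrite /avg; field; rewrite gt_eqF.
Qed.

Lemma norm_avg_subc p l c : 0 < l ->
  `|avg p l - c| <= l^-1 * \int[leb]_(t in `[p, p + l]) `|v t - c|.
Proof.
move=> l0; rewrite avg_subc// normrM ger0_norm; last by rewrite invr_ge0 ltW.
rewrite ler_pM2l ?invr_gt0//; apply: le_normr_Rintegral => //.
apply: (continuous_itv_integrable _ _ (f := fun t => v t - c)) => t.
by apply: cvgB; [exact: cv|exact: cvg_cst].
Qed.

Lemma EFin_norm_avg_subc p l c : 0 < l ->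
  (`|avg p l - c|%:E <= \int[leb]_(t in `[p, (p + l)%R]) (l^-1 * `|v t - c|)%:E)%E.
Proof.
move=> l0; have i := continuous_itv_integrable p (p + l) (continuous_normB (c := c)).
under eq_integral do rewrite EFinM.
rewrite integralZl//= -[X in (_ * X)%E]fineK ?integrable_fin_num//.
by rewrite -EFinM lee_fin; exact: norm_avg_subc.
Qed.

Lemma norm_avg_subc_le p l c e : 0 < l -> (forall t, p <= t <= p + l -> `|v t - c| <= e) ->
  `|avg p l - c| <= e.
Proof.
move=> l0 ve; apply: le_trans (norm_avg_subc _ _ l0) _.
rewrite ler_pdivrMl// mulrC.
have -> : e * l = \int[leb]_(t in `[p, p + l]) e.
  by rewrite Rintegral_cst// [X in _ = _ * X](leb_itv_len p l0).
apply: le_Rintegral => //.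
- exact: (continuous_itv_integrable _ _ (continuous_normB (c := c))).
- by apply: (continuous_itv_integrable _ _ (f := cst e)) => ?; exact: cvg_cst.
Qed.

Lemma avg_norm_le p l : 0 < l ->
  (`|avg p l|%:E <= (l^-1)%:E * \int[leb]_(t in `[p, (p + l)%R]) (`|v t|)%:E)%E.
Proof.
move=> l0; have := EFin_norm_avg_subc p 0 l0; rewrite subr0 => /le_trans; apply.
under eq_integral do rewrite EFinM subr0.
rewrite integralZl//.
have := continuous_itv_integrable p (p + l) (continuous_normB (c := 0)).
by apply: eq_integrable => // t _ /=; rewrite subr0.
Qed.

Lemma avg_diff p l p' l' : 0 < l -> 0 < l' ->
  (`|avg p' l' - avg p l|%:E <=
   \int[leb2 R]_(z in `[p', (p' + l')%R] `*` `[p, (p + l)%R])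
     ((l'^-1 * l^-1) * `|v z.2 - v z.1|)%:E)%E.
Proof.
move=> l0 l'0.
have mH : measurable_fun setT (fun z : measurableTypeR R * measurableTypeR R =>
    ((l'^-1 * l^-1) * `|v z.2 - v z.1|)%:E).
  apply/measurable_EFinP; apply: measurable_funM => //.
  apply: (measurableT_comp (@normr_measurable R setT)).
  by apply: measurable_funB; apply: measurableT_comp (continuous_measurable_fun cv) _.
have H0 z : (0 <= ((l'^-1 * l^-1) * `|v z.2 - v z.1|)%:E)%E.
  by rewrite lee_fin !mulr_ge0// invr_ge0 ltW.
rewrite tonelli_rect//=.
apply: le_trans (EFin_norm_avg_subc _ _ l'0) _.
apply: ge0_le_integral => //.
- by move=> t _; rewrite lee_fin mulr_ge0// invr_ge0 ltW.
- apply/measurable_EFinP; apply: measurable_funM => //.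
  apply: (measurable_funS measurableT) => //.
  by apply: continuous_measurable_fun; exact: continuous_normB.
- apply: (measurable_funS measurableT) => //.
  exact: (measurable_section_integral _ mH H0).
- move=> t _; apply: (@le_trans _ _ (l'^-1%:E * \int[leb]_(y in `[p, (p + l)%R])
      (l^-1 * `|v y - v t|)%:E)%E).
    rewrite EFinM lee_pmul2l// ?lte_fin ?invr_gt0// distrC.
    exact: EFin_norm_avg_subc.
  rewrite -ge0_integralZl_EFin//.
  + by rewrite le_eqVlt; apply/orP; left; apply/eqP/eq_integral => y _; rewrite -EFinM mulrA.
  + by move=> y _; rewrite lee_fin mulr_ge0// invr_ge0 ltW.
  + apply/measurable_EFinP; apply: measurable_funM => //.
    apply: (measurable_funS measurableT) => //.
    by apply: continuous_measurable_fun; exact: continuous_normB.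
  + by rewrite invr_ge0 ltW.
Qed.

End Averages.

Section Morrey.
Context {R : realType}.
Local Notation Rm := (measurableTypeR R).
Implicit Types (v : R -> R) (x y p l : R).

Lemma rho_le x y : rho x y <= `|x - y|.
Proof.
rewrite /rho; apply: ge_inf; last by exists 0 => //; rewrite addr0.
by exists 0 => _ [l _ <-].
Qed.

Lemma rho_gt0 x y : x != y -> `|x - y| < 1 -> 0 < rho x y.
Proof.
move=> xy d1; rewrite lt_neqAle rho_ge0 andbT eq_sym rho_sdist normr_eq0.
apply/negP => /eqP/sdist_eq0[k e]; move: d1; rewrite e -intr_norm -[X in _ < X]/(1%:~R).
rewrite ltr_int => k1; have k0 : k = 0.
  by apply/eqP/negPn/negP => k0; move: k1; rewrite ltNge -gtz0_ge1 normr_gt0 k0.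
by move/eqP: xy; apply; apply/eqP; rewrite -subr_eq0 e k0.
Qed.

Lemma measurable_sdist_sub :
  measurable_fun setT (fun z : Rm * Rm => sdist (z.2 - z.1)).
Proof.
by apply: (measurableT_comp measurable_sdist); exact: measurable_funB.
Qed.

Lemma measurable_rho_powR (a : R) :
  measurable_fun setT (fun z : Rm * Rm => (rho z.2 z.1 `^ a)^-1).
Proof.
under eq_fun do rewrite rho_sdist -powRN.
apply: (measurableT_comp (measurable_powR _)).
by apply: (measurableT_comp (@normr_measurable R setT)); exact: measurable_sdist_sub.
Qed.

Section Step.
Variables (v : R -> R) (cv : continuous v) (eta : R) (eta0 : 0 < eta).
Let kappa := 2 + 2 * eta.

Let W (z : Rm * Rm) : R := (v z.2 - v z.1) ^+ 2 / rho z.2 z.1 `^ kappa.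

Let W0 z : 0 <= W z. Proof. by rewrite divr_ge0 ?sqr_ge0// powR_ge0. Qed.

Let mW : measurable_fun setT W.
Proof.
apply: measurable_funM; last exact: measurable_rho_powR.
apply: measurable_funX; apply: measurable_funB.
  exact: measurableT_comp (continuous_measurable_fun cv) _.
exact: measurableT_comp (continuous_measurable_fun cv) _.
Qed.

Hypothesis JW : (\int[leb2 R]_(z in circle2) (W z)%:E <= 1)%E.

(** The difference of the two means is at most the mean of |v(y) - v(t)| over the
    product of the intervals.  There the weighted inequality between arithmetic
    and geometric means, 2 A / l^2 <= c A^2 / r + r / (c l^4), with r the power
    of the distance and c = l^eta, splits off the seminorm and leaves a
    remainder which is also of order l^eta. *)
Lemma avg_step p l p' : 0 < l -> l <= 1 / 2 -> 0 <= p -> p + l < 1 -> p <= p' ->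
  p' + l / 2 <= p + l -> `|avg v p' (l / 2) - avg v p l| <= 2 * l `^ eta.
Proof.
move=> l0 l2 p0 pl1 pp' pl'.
pose lam := l `^ eta; have lam0 : 0 < lam by exact: powR_gt0.
pose I' : set Rm := `[p', p' + l / 2]%classic; pose I : set Rm := `[p, p + l]%classic.
have mI : measurable I by exact: measurable_itv.
have mI' : measurable I' by exact: measurable_itv.
have mII : measurable (I' `*` I) by exact: measurableX.
have lk : l `^ kappa = l ^+ 2 * lam ^+ 2.
  rewrite /kappa powRD ?(gt_eqF l0) ?implybT//; congr (_ * _).
    by rewrite -powR_mulrn// ltW.
  by rewrite /lam -powR_mulrn ?powR_ge0// -powRrM mulrC.
(* distinct points of an interval of length at most 1/2 have positive
   distance on the circle *)
have pt (t y : R) : p' <= t <= p' + l / 2 -> p <= y <= p + l ->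
    (l / 2)^-1 * l^-1 * `|v y - v t| <= lam * W (t, y) + lam / l ^+ 2.
  move=> /andP[t1 t2] /andP[y1 y2].
  rewrite /W/=.
  have [->|ty] := eqVneq y t.
    rewrite subrr normr0 mulr0 expr0n/= mul0r mulr0 add0r divr_ge0 ?sqr_ge0//.
    exact: ltW.
  have d1 : `|y - t| <= l by rewrite ler_norml; apply/andP; split; lra.
  have r0 : 0 < rho y t by apply: rho_gt0 => //; lra.
  have rl : rho y t `^ kappa <= l ^+ 2 * lam ^+ 2.
    rewrite -lk; apply: ge0_ler_powR; rewrite ?nnegrE; [|exact: ltW|exact: ltW|].
      by rewrite addr_ge0// mulr_ge0// ltW.
    exact: le_trans (rho_le _ _) d1.
  have : 0 < rho y t `^ kappa by exact: powR_gt0.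
  move: (_ `^ kappa) rl => r rl rp.
  rewrite -[X in lam * (X / _)]real_normK ?num_real//.
  move: (`|_|) => A.
  apply: (@le_trans _ _ (lam * (A ^+ 2 / r) + r / (lam * l ^+ 4))).
    rewrite -subr_ge0.
    rewrite (_ : _ - _ = lam / r * (A - r / (lam * l ^+ 2)) ^+ 2); last first.
      by field; rewrite ?gt_eqF.
    by rewrite mulr_ge0 ?sqr_ge0//; apply: divr_ge0; exact: ltW.
  rewrite lerD2l ler_pdivrMr; last by rewrite mulr_gt0 ?exprn_gt0.
  by rewrite (_ : lam / _ * _ = l ^+ 2 * lam ^+ 2)//; field; rewrite gt_eqF.
rewrite -lee_fin; apply: le_trans (avg_diff cv _ _ l0 _) _; first by rewrite divr_gt0.
apply: (@le_trans _ _ (\int[leb2 R]_(z in I' `*` I)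
    (lam%:E * (W z)%:E + (lam / l ^+ 2)%:E))%E).
  apply: ge0_le_integral => //.
  - by move=> z _; rewrite lee_fin !mulr_ge0// invr_ge0 ltW// divr_gt0.
  - apply/measurable_EFinP; apply: measurable_funM => //.
    apply: (measurableT_comp (@normr_measurable R setT)).
    apply: (measurable_funS measurableT) => //; apply: measurable_funB.
      exact: measurableT_comp (continuous_measurable_fun cv) _.
    exact: measurableT_comp (continuous_measurable_fun cv) _.
  - apply: (measurable_funS measurableT) => //; apply: emeasurable_funD => //.
    by apply: measurable_funeM; exact/measurable_EFinP.
  - move=> [t y] [/=]; rewrite /I' /I/= !in_itv/= => tI yI.
    by rewrite -EFinM -EFinD lee_fin; exact: pt.
have mWI : measurable_fun (I' `*` I) (fun z => (W z)%:E).
  by apply: (measurable_funS measurableT) => //; exact/measurable_EFinP.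
rewrite ge0_integralD//; last 3 first.
- by move=> z _; rewrite -EFinM lee_fin mulr_ge0// ltW.
- exact: measurable_funeM.
- by move=> z _; rewrite lee_fin divr_ge0 ?sqr_ge0// ltW.
rewrite ge0_integralZl_EFin//; [|by move=> z _; rewrite lee_fin|exact: ltW].
have mE : (leb2 R (I' `*` I) = leb I' * leb I)%E by exact: product_measure1E.
rewrite integral_cst// [X in (_ + _ * X)%E]mE.
rewrite !lebesgue_measure_itv/= !lte_fin !ltrDl l0 divr_gt0//= -!EFinD -!EFinM.
apply: (@le_trans _ _ (lam%:E * 1 + (lam / 2)%:E)%E).
  apply: leeD; last first.
    by rewrite lee_fin le_eqVlt; apply/orP; left; apply/eqP; field; rewrite gt_eqF.
  rewrite lee_pmul2l//; apply: le_trans JW.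
  apply: ge0_subset_integral => //.
  - exact: measurable_circle2.
  - by apply: (measurable_funS measurableT) => //; exact/measurable_EFinP.
  - by move=> z _; rewrite lee_fin.
  - move=> [t y] [/=]; rewrite /I' /I/= !in_itv/= => /andP[t1 t2] /andP[y1 y2].
    by split; rewrite /circle /= in_itv/=; apply/andP; split; lra.
by rewrite mule1 -EFinD lee_fin -/lam; lra.
Qed.

Hypothesis I1 : (\int[leb]_(x in circle) (v x ^+ 2)%:E <= 1)%E.

Let theta : R := 2^-1 `^ eta.

Let theta01 : 0 < theta < 1.
Proof.
rewrite /theta powR_gt0//=.
by have := @gt0_ltr_powR R _ eta0 2^-1 1; rewrite powR1; apply; rewrite ?nnegrE; lra.
Qed.

(** Means over dyadic intervals shrinking to x converge to v(x), and by
    [avg_step] their increments are bounded by a geometric series. *)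
Lemma morrey_bound_interval x (p : nat -> R) : (forall k, [/\ 0 <= p k,
    p k + 2^-1 ^+ k.+1 < 1, p k <= x <= p k + 2^-1 ^+ k.+1,
    p k <= p k.+1 & p k.+1 + 2^-1 ^+ k.+2 <= p k + 2^-1 ^+ k.+1]) ->
  `|v x| <= 2 + 2 / (1 - theta).
Proof.
move=> Hp; have /andP[th0 th1] := theta01.
pose d k : R := 2^-1 ^+ k.+1.
have d0 k : 0 < d k by rewrite exprn_gt0// invr_gt0.
have dS k : d k.+1 = d k / 2 by rewrite /d exprSr.
have d2 k : d k <= 1 / 2.
  elim: k => [|k IH]; first by rewrite /d expr1 mul1r.
  by rewrite dS; have := d0 k; lra.
have dth k : d k `^ eta = theta ^+ k.+1.
  rewrite /d /theta; elim: k.+1 => [|n IH]; first by rewrite !expr0 powR1.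
  by rewrite !exprS powRM ?exprn_ge0 ?invr_ge0// IH.
have step k : `|avg v (p k.+1) (d k.+1) - avg v (p k) (d k)| <= 2 * theta ^+ k.+1.
  have [a b _ c e] := Hp k.
  rewrite -dth dS; apply: avg_step => //.
  by rewrite -dS.
have a0 : `|avg v (p 0%N) (d 0%N)| <= 2.
  have [p0 p1 _ _ _] := Hp 0%N.
  rewrite -lee_fin; apply: le_trans (avg_norm_le cv _ (d0 _)) _.
  have d02 : d 0%N = 2^-1 by rewrite /d expr1.
  rewrite d02 in p1 *.
  have mv2 : measurable_fun setT (fun x => v x ^+ 2).
    by apply: measurable_funX; exact: continuous_measurable_fun.
  have mI : measurable (`[p 0%N, p 0%N + 2^-1]%classic : set Rm) by exact: measurable_itv.
  have mv2I : measurable_fun (`[p 0%N, p 0%N + 2^-1]%classic : set Rm)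
      (fun x => (v x ^+ 2)%:E).
    by apply: (measurable_funS measurableT) => //; exact/measurable_EFinP.
  apply: (@le_trans _ _ (2^-1^-1%:E * \int[leb]_(t in `[p 0%N, (p 0%N + 2^-1)%R])
      (2^-1%:E * (v t ^+ 2)%:E + 2^-1%:E))%E).
    rewrite lee_pmul2l// ?lte_fin ?invr_gt0//.
    apply: ge0_le_integral => //.
    - apply: (measurable_funS measurableT) => //; apply/measurable_EFinP.
      apply: (measurableT_comp (@normr_measurable R setT)).
      exact: continuous_measurable_fun.
    - by apply: emeasurable_funD => //; exact: measurable_funeM.
    - move=> t _; rewrite -EFinM -EFinD lee_fin -[v t ^+ 2]real_normK ?num_real//.
      by move: `|v t| => A; have := sqr_ge0 (A - 1); lra.
  rewrite ge0_integralD//; last 2 first.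
  - by move=> t _; rewrite -EFinM lee_fin mulr_ge0// sqr_ge0.
  - exact: measurable_funeM.
  rewrite ge0_integralZl_EFin//; last by move=> t _; rewrite lee_fin sqr_ge0.
  have mE : leb (`[p 0%N, p 0%N + 2^-1] : set R) = (2^-1)%:E.
    rewrite lebesgue_measure_itv/= lte_fin ltrDl invr_gt0 ltr0n/= -EFinD.
    by rewrite addrC addKr.
  rewrite integral_cst// [X in (_ * (_ + _ * X))%E]mE -EFinM.
  have le1 : (\int[leb]_(t in `[p 0%N, (p 0%N + 2^-1)%R]) (v t ^+ 2)%:E <= 1)%E.
    apply: le_trans I1; apply: ge0_subset_integral => //.
    - exact: measurable_circle.
    - by apply: (measurable_funS measurableT) => //; exact/measurable_EFinP.
    - by move=> t _; rewrite lee_fin sqr_ge0.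
    - by move=> t; rewrite /circle /= !in_itv/= => /andP[? ?]; apply/andP; split; lra.
  apply: (@le_trans _ _ (2^-1^-1%:E * (2^-1%:E * 1 + 2^-1%:E))%E).
    rewrite lee_pmul2l// ?lte_fin ?invr_gt0//; apply: leeD.
      by rewrite lee_pmul2l// lte_fin invr_gt0.
    by rewrite lee_fin; lra.
  by rewrite mule1 -EFinD -EFinM lee_fin; lra.
(* 2 bounds the first mean, the other term is a partial geometric sum *)
have ak k : `|avg v (p k) (d k)| <= 2 + 2 * (1 - theta ^+ k.+1) / (1 - theta).
  elim: k => [|k IH].
    by rewrite expr1 mulfK ?subr_eq0 1?eq_sym ?(lt_eqF th1)//; lra.
  have -> : avg v (p k.+1) (d k.+1) =
    (avg v (p k.+1) (d k.+1) - avg v (p k) (d k)) + avg v (p k) (d k) by rewrite subrK.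
  apply: le_trans (ler_normD _ _) _; apply: le_trans (lerD (step k) IH) _.
  rewrite le_eqVlt; apply/orP; left; apply/eqP; rewrite (exprSr theta k.+1).
  by field; rewrite subr_eq0 eq_sym lt_eqF.
have ak' k : `|avg v (p k) (d k)| <= 2 + 2 / (1 - theta).
  apply: le_trans (ak k) _; rewrite lerD2l ler_pM2r ?invr_gt0 ?subr_gt0//.
  by have := exprn_gt0 k.+1 th0; lra.
apply/ler_addgt0Pr => e e0.
have [r /= r0 Hr] : exists2 r : R, 0 < r & forall y, `|x - y| < r -> `|v x - v y| < e.
  have : v y @[y --> x] --> v x by exact: cv.
  move=> /cvgrPdist_lt /(_ _ e0) /nbhs_ballP[r /= r0 H].
  by exists r => // y xy; apply: H; rewrite /= -ball_normE.
have [k dk] : exists k, d k < r.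
  have [n _ /(_ n (leqnn _))] := near_infty_natSinv_expn_lt (PosNum r0).
  rewrite /= div1r -exprVn => h; exists n; apply: le_lt_trans h.
  by rewrite /d exprSr ler_piMr ?exprn_ge0//; lra.
have [_ _ /andP[x1 x2] _ _] := Hp k.
have := ak' k; have : `|avg v (p k) (d k) - v x| <= e.
  apply: norm_avg_subc_le => // t /andP[t1 t2]; rewrite distrC ltW//; apply: Hr.
  apply: le_lt_trans dk; rewrite -/(d k) in x2; rewrite ler_norml; apply/andP; split; lra.
move: (avg _ _ _) => A; have := ler_normB A (A - v x).
by rewrite opprB addrC subrK; lra.
Qed.
End Step.
End Morrey.

Section MorreyCircle.
Context {R : realType}.
Local Notation Rm := (measurableTypeR R).

Lemma morrey_bound (v : R -> R) (eta : R) : continuous v -> 0 < eta ->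
  (\int[leb2 R]_(z in circle2)
     ((v z.2 - v z.1) ^+ 2 / rho z.2 z.1 `^ (2 + 2 * eta))%:E <= 1)%E ->
  (\int[leb]_(x in circle) (v x ^+ 2)%:E <= 1)%E ->
  forall x, 0 <= x < 1 -> `|v x| <= 2 + 2 / (1 - 2^-1 `^ eta).
Proof.
move=> cv eta0 JW I1 x /andP[x0 x1].
have d0 k : 0 < 2^-1 ^+ k.+1 :> R by rewrite exprn_gt0// invr_gt0.
have dS k : 2^-1 ^+ k.+2 = 2^-1 ^+ k.+1 / 2 :> R by rewrite exprSr.
have d2 k : 2^-1 ^+ k.+1 <= 1 / 2 :> R.
  elim: k => [|k IH]; first by rewrite expr1 mul1r.
  by rewrite dS; have := d0 k; lra.
(* on the side of x on which the intervals stay in the fundamental domain *)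
have [x2|x2] := ltP x (1 / 2).
- apply: (@morrey_bound_interval _ v cv _ eta0 JW I1 x (fun=> x)) => k.
  by have := d0 k; have := d2 k; rewrite dS => ? ?; split; lra.
- apply: (@morrey_bound_interval _ v cv _ eta0 JW I1 x
    (fun k => x - 2^-1 ^+ k.+1)) => k.
  by have := d0 k; have := d2 k; rewrite dS => ? ?; split; lra.
Qed.

End MorreyCircle.

Section SobolevCoordinates.
Context {R : realType} (m : nat) (s : R).
Local Notation Rm := (measurableTypeR R).
Implicit Types (u v : sobolev m s) (i : 'I_m) (x y : R).

Definition pos_coord u i x : R := u x i 0.
Definition der_coord u i x : R := derive1 u x i 0.

Lemma is_derive_coord u i x : is_derive x 1 (pos_coord u i) (der_coord u i x).
Proof.
have [_ du _ _] := sobolevP u.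
split; first exact: ((derivable_mxP _ _ _).1 (du x)).
by rewrite /der_coord derive1E derive_mx// mxE.
Qed.

Lemma der_coord_continuous u i : continuous (der_coord u i).
Proof.
have [_ _ cu _] := sobolevP u => x.
apply: (@continuous_comp _ _ _ (derive1 u) (fun M : 'cV[R]_m => M i 0)); first exact: cu.
exact: coord_continuous.
Qed.

Lemma pos_coord_continuous u i : continuous (pos_coord u i).
Proof.
move=> x; apply/differentiable_continuous/derivable1_diffP.
exact: (@ex_derive _ _ _ _ _ _ _ (is_derive_coord u i x)).
Qed.

Lemma sobolev_periodic u x : u (x + 1) = u x.
Proof. by have [pu _ _ _] := sobolevP u. Qed.

Lemma derive1_periodic u x : derive1 u (x + 1) = derive1 u x.
Proof.
rewrite !derive1E /derive; set F := (F in lim (F @ _) = _).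
suff -> : F = fun h : R => h^-1 *: (((u : R -> 'cV[R]_m) \o shift x) (h *: 1) - u x) by [].
by apply/funext => h; rewrite /F /= addrA !sobolev_periodic.
Qed.

Lemma pos_coord_int u i x (k : int) : pos_coord u i (x + k%:~R) = pos_coord u i x.
Proof. by rewrite /pos_coord (periodic_int (sobolev_periodic u)). Qed.

Lemma der_coord_int u i x (k : int) : der_coord u i (x + k%:~R) = der_coord u i x.
Proof. by rewrite /der_coord (periodic_int (derive1_periodic u)). Qed.

Lemma pos_coord_linear a u v i x :
  pos_coord (a *: u + v) i x = a * pos_coord u i x + pos_coord v i x.
Proof. by rewrite /pos_coord -[sobolev_fun _]/(a *: (u : R -> _) + v) !mxE. Qed.

Lemma der_coord_linear a u v i x :
  der_coord (a *: u + v) i x = a * der_coord u i x + der_coord v i x.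
Proof.
have [_ du _ _] := sobolevP u; have [_ dv _ _] := sobolevP v.
rewrite /der_coord -[sobolev_fun _]/(a *: (u : R -> _) + v) !derive1E deriveD//.
  by rewrite deriveZ// !mxE.
exact: derivableZ.
Qed.

Lemma coord_sqr_le_enorm (w : 'cV[R]_m) i : w i 0 ^+ 2 <= enorm w ^+ 2.
Proof.
rewrite enorm_sqr /dotv (bigD1 i)//= -expr2 lerDl.
by apply: sumr_ge0 => j _; rewrite -expr2 sqr_ge0.
Qed.

Lemma hs_norm_sqrE u : (`|u| ^+ 2)%:E = hs_sqnorm s u.
Proof. exact: hs_norm_sqr. Qed.

Lemma der_coord_L2 u i :
  (\int[leb]_(x in circle) (der_coord u i x ^+ 2)%:E <= (`|u| ^+ 2)%:E)%E.
Proof.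
have [_ du cu _] := sobolevP u.
rewrite hs_norm_sqrE /hs_sqnorm.
apply: (@le_trans _ _ (\int[leb]_(x in circle) (enorm (derive1 u x) ^+ 2)%:E)%E).
  apply: ge0_le_integral => //.
  - exact: measurable_circle.
  - by move=> x _; rewrite lee_fin sqr_ge0.
  - apply: (measurable_funS measurableT) => //; apply/measurable_EFinP/measurable_funX.
    by apply: continuous_measurable_fun; exact: der_coord_continuous.
  - have m1 : measurable_fun setT (cst 1 : Rm -> R) by exact: measurable_cst.
    have := @measurable_sqint _ _ R m (circle : set Rm) _ m1 _ (cont_coord cu).
    by under eq_fun do rewrite mulr1.
  - by move=> x _; rewrite lee_fin; exact: coord_sqr_le_enorm.
rewrite -addeA addeCA leeDl// adde_ge0//; apply: integral_ge0 => x _;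
  rewrite lee_fin ?sqr_ge0//.
by rewrite divr_ge0 ?sqr_ge0// powR_ge0.
Qed.

Lemma der_coord_seminorm u i :
  (\int[leb2 R]_(z in circle2) ((der_coord u i z.2 - der_coord u i z.1) ^+ 2
      / rho z.2 z.1 `^ (2 * s - 1))%:E <= (`|u| ^+ 2)%:E)%E.
Proof.
have [_ du cu _] := sobolevP u.
rewrite hs_norm_sqrE /hs_sqnorm.
apply: (@le_trans _ _ (\int[leb2 R]_(z in circle2)
   (enorm (derive1 u z.2 - derive1 u z.1) ^+ 2 / rho z.2 z.1 `^ (2 * s - 1))%:E)%E).
  have mw := @measurable_rho_powR R (2 * s - 1).
  apply: ge0_le_integral => //.
  - exact: measurable_circle2.
  - by move=> x _; rewrite lee_fin divr_ge0 ?sqr_ge0// powR_ge0.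
  - apply: (measurable_funS measurableT) => //; apply/measurable_EFinP.
    apply: measurable_funM => //; apply: measurable_funX; apply: measurable_funB.
      apply: (measurableT_comp (continuous_measurable_fun _)) => //.
      exact: der_coord_continuous.
    apply: (measurableT_comp (continuous_measurable_fun _)) => //.
    exact: der_coord_continuous.
  - apply: (@measurable_sqint _ _ R m (circle2 : set (Rm * Rm)) _ mw
      (fun z => derive1 u z.2 - derive1 u z.1)) => j.
    under eq_fun do rewrite !mxE.
    apply: measurable_funB.
      exact: (@measurableT_comp _ _ _ _ _ _ (fun t : Rm => derive1 u t j 0) _ _ (cont_coord cu j)).
    exact: (@measurableT_comp _ _ _ _ _ _ (fun t : Rm => derive1 u t j 0) _ _ (cont_coord cu j)).
  - move=> x _; rewrite lee_fin ler_wpM2r ?invr_ge0 ?powR_ge0//.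
    rewrite [X in X ^+ 2 <= _](_ : _ = (derive1 u x.2 - derive1 u x.1) i 0); last by rewrite !mxE.
    exact: coord_sqr_le_enorm.
rewrite leeDr// adde_ge0//; apply: integral_ge0 => x _;
  by rewrite lee_fin ?sqr_ge0//.
Qed.

Hypothesis hs : 3 / 2 < s.

(** After scaling to norm one, the components of u' satisfy the hypotheses of
    [morrey_bound] with eta = s - 3/2. *)
Lemma sobolev_C1_bound : exists2 C, 0 <= C & forall u i x, `|der_coord u i x| <= C * `|u|.
Proof.
pose eta := s - 3 / 2; have eta0 : 0 < eta by rewrite subr_gt0.
have th1 : 2^-1 `^ eta < 1.
  by have := @gt0_ltr_powR R _ eta0 2^-1 1; rewrite powR1; apply; rewrite ?nnegrE; lra.
pose C := 2 + 2 / (1 - 2^-1 `^ eta).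
have C0 : 0 <= C by rewrite addr_ge0// divr_ge0// subr_ge0 ltW.
exists C => // u i x.
have unit_bound v : `|v| <= 1 -> `|der_coord v i x| <= C.
  move=> v1.
  have v2 : `|v| ^+ 2 <= 1 by rewrite expr_le1.
  rewrite -(der_coord_int v i x (- Num.floor x)) mulrNz.
  apply: morrey_bound => //.
  - exact: der_coord_continuous.
  - rewrite (_ : 2 + 2 * eta = 2 * s - 1); last by rewrite /eta; field.
    by apply: le_trans (der_coord_seminorm v i) _; rewrite lee_fin.
  - by apply: le_trans (der_coord_L2 v i) _; rewrite lee_fin.
  - rewrite subr_ge0 floor_le/= ltrBlDl -[X in _ + X]/(1%:~R) -intrD.
    exact: floorD1_gt.
have [->|u0] := eqVneq u 0.
  rewrite normr0 mulr0 normr_le0; have := der_coord_linear (-1) 0 0 i x.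
  by rewrite scaler0 addr0 mulN1r addNr => ->.
have n0 : 0 < `|u| by rewrite normr_gt0.
have := unit_bound (`|u|^-1 *: u + 0).
rewrite addr0 normrZ normfV normr_id mulVf ?gt_eqF// => /(_ (lexx _)).
rewrite -[_ *: u]addr0 der_coord_linear.
have -> : der_coord 0 i x = 0.
  have := der_coord_linear (-1) 0 0 i x.
  by rewrite scaler0 addr0 mulN1r addNr => ->.
by rewrite addr0 normrM normfV normr_id ler_pdivrMl// mulrC.
Qed.

End SobolevCoordinates.

(** * A weighted Hardy inequality *)

Section Swap.
Context {R : realType}.
Local Notation Rm := (measurableTypeR R).
Variables (D1 D2 : set Rm) (mD1 : measurable D1) (mD2 : measurable D2).
Variable G : Rm * Rm -> \bar R.
Hypotheses (mG : measurable_fun setT G) (G0 : forall z, (0 <= G z)%E).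

Lemma tonelli_swap :
  (\int[leb]_(x in D1) \int[leb]_(y in D2) G (x, y) =
   \int[leb]_(y in D2) \int[leb]_(x in D1) G (x, y))%E.
Proof.
pose H := G \_ (D1 `*` D2).
have mH : measurable_fun setT H.
  apply/(measurable_restrictT _ _).1; first exact: measurableX.
  exact: measurable_funS mG.
have H0 z : (0 <= H z)%E by rewrite /H patchE; case: ifP.
rewrite -(tonelli_rect mD1 mD2 mG G0) integral_mkcond -/H.
rewrite fubini_tonelli1// (fubini_tonelli H)//.
rewrite [RHS]integral_mkcond; apply: eq_integral => y _.
rewrite /fubini_G patchE; case: ifPn => [/set_mem yD|yD].
  rewrite [RHS]integral_mkcond; apply: eq_integral => x _.
  rewrite /H !patchE; congr (if _ then _ else _).
  by apply/idP/idP => [/set_mem[/= xD _]|/set_mem xD]; rewrite inE//; split.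
rewrite integral0_eq// => x _; rewrite /H patchE ifF//; apply/negP => /set_mem[/= _ yD'].
by move/negP: yD; apply; rewrite inE.
Qed.

End Swap.

Section Hardy.
Context {R : realType}.
Local Notation Rm := (measurableTypeR R).
Variables (g w : R -> R) (cg : continuous g).
Hypotheses (dw : forall t : R, is_derive t (1 : R) w (g t)) (w00 : w 0 = 0).

Let cw : continuous w.
Proof.
move=> x; apply/differentiable_continuous/derivable1_diffP.
exact: (@ex_derive _ _ _ _ _ _ _ (dw x)).
Qed.

(** The Cauchy-Schwarz inequality for w(h), the integral of g over [0, h], in
    the form of a tangent line: g^2 >= 2 c g - c^2, where c = w(h) / h makes the
    integral of the right-hand side equal to w(h)^2 / h. *)
Lemma sqr_primitive_le (h : R) : 0 < h ->
  ((w h ^+ 2 / h)%:E <= \int[leb]_(t in `]0%R, h[) (g t ^+ 2)%:E)%E.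
Proof.
move=> h0; pose c := w h / h.
(* F is the primitive of the tangent line f *)
pose f t := c *+ 2 * g t - c ^+ 2; pose F t := c *+ 2 * w t - c ^+ 2 * t.
have cf : continuous f.
  by move=> t; apply: cvgB; [apply: cvgMl_tmp; exact: cg|exact: cvg_cst].
have dF (t : R) : is_derive t (1 : R) F (f t).
  by rewrite /F; apply: is_derive_eq; rewrite /f /GRing.scale/= mulr1.
have cF : continuous F.
  move=> x; apply/differentiable_continuous/derivable1_diffP.
  exact: (@ex_derive _ _ _ _ _ _ _ (dF x)).
have -> : w h ^+ 2 / h = F h - F 0.
  by rewrite /F w00 /c; field; rewrite gt_eqF.
rewrite -(@integral_itv_bndoo R 0 h (fun t => (g t ^+ 2)%:E) true false); last first.
  apply/measurable_EFinP; apply: (measurable_funS measurableT) => //.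
  by apply: measurable_funX; exact: continuous_measurable_fun.
rewrite EFinB -(@continuous_FTC2 _ f F 0 h)//; last 3 first.
- exact: continuous_subspaceT.
- split; first by move=> t _; exact: (@ex_derive _ _ _ _ _ _ _ (dF t)).
    exact/cvg_at_right_filter/cF.
  exact/cvg_at_left_filter/cF.
- by move=> t _; rewrite derive1E; exact: derive_val.
apply: le_integral => //.
- exact: (continuous_itv_integrable 0 h cf).
- apply: (continuous_itv_integrable 0 h (f := fun t => g t ^+ 2)) => t.
  by apply: (@continuous_comp _ _ _ g (fun x => x ^+ 2)); [exact: cg|exact: exprn_continuous].
- move=> t _; rewrite lee_fin /f; have := sqr_ge0 (g t - c).
  by rewrite sqrrB mulr2n; lra.
Qed.

Lemma integral_powR_tail (a t L : R) : 0 < a -> 0 < t -> t < L ->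
  (\int[leb]_(h in `]t, L[) (h `^ (- (a + 1)))%:E <= (a^-1 * t `^ (- a))%:E)%E.
Proof.
move=> a0 t0 tL.
pose F h := - a^-1 * h `^ (- a); pose f h := h `^ (- (a + 1)).
have dF (h : R) : 0 < h -> is_derive h (1 : R) F (f h).
  move=> h0; have := is_derive1_powR (- a) h0 => d; rewrite /F; apply: is_derive_eq.
  rewrite /f /GRing.scale/= (_ : - a - 1 = - (a + 1)); last by ring.
  by field; rewrite gt_eqF.
have cF h : 0 < h -> {for h, continuous F}.
  move=> h0; apply/differentiable_continuous/derivable1_diffP.
  exact: (@ex_derive _ _ _ _ _ _ _ (dF h h0)).
have cf h : 0 < h -> {for h, continuous f}.
  move=> h0; apply/differentiable_continuous/derivable1_diffP.
  by apply: derivable_powR; rewrite in_itv/= h0.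
rewrite -(@integral_itv_bndoo R t L (fun h => (f h)%:E) true false); last first.
  apply/measurable_EFinP; apply: (measurable_funS measurableT) => //.
  exact: measurable_powR.
rewrite (@continuous_FTC2 _ f F t L)//; last 3 first.
- apply: continuous_in_subspaceT => h; rewrite inE/= in_itv/= => /andP[th _].
  by apply: cf; exact: lt_le_trans th.
- split.
  + move=> h; rewrite in_itv/= => /andP[th _].
    exact: (@ex_derive _ _ _ _ _ _ _ (dF h (lt_trans t0 th))).
  + exact/cvg_at_right_filter/cF.
  + by apply/cvg_at_left_filter/cF; exact: lt_trans tL.
- move=> h; rewrite in_itv/= => /andP[th _]; rewrite derive1E.
  exact: (@derive_val _ _ _ _ _ _ _ (dF h (lt_trans t0 th))).
rewrite -EFinB lee_fin /F !mulNr opprK addrC lerBlDr lerDl.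
by rewrite mulr_ge0 ?powR_ge0// invr_ge0 ltW.
Qed.

(** Bound w(h)^2 / h by the integral of g^2 over (0, h), exchange the order of
    integration, and integrate the remaining power of h over (t, L). *)
Lemma hardy_inequality (a L : R) : 0 < a -> 0 < L ->
  (\int[leb]_(h in `]0%R, L[) (w h ^+ 2 / h `^ (a + 2))%:E <=
   (a^-1)%:E * \int[leb]_(t in `]0%R, L[) (g t ^+ 2 / t `^ a)%:E)%E.
Proof.
move=> a0 L0.
have mg : measurable_fun setT g by exact: continuous_measurable_fun.
have mg2 : measurable_fun setT (fun t => g t ^+ 2) by exact: measurable_funX.
have mgE (D : set Rm) : measurable D -> measurable_fun D (fun t => (g t ^+ 2)%:E).
  by move=> mD; apply: (measurable_funS measurableT) => //; exact/measurable_EFinP.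
have mp : measurable_fun setT (fun h : R => h `^ (- (a + 1))) by exact: measurable_powR.
have mpE (D : set Rm) : measurable D ->
    measurable_fun D (fun h : R => (h `^ (- (a + 1)))%:E).
  by move=> mD; apply: (measurable_funS measurableT) => //; exact/measurable_EFinP.
pose G (z : Rm * Rm) : \bar R :=
  (if z.2 < z.1 then g z.2 ^+ 2 * z.1 `^ (- (a + 1)) else 0)%:E.
have mG : measurable_fun setT G.
  apply/measurable_EFinP; apply: measurable_fun_ifT => //.
    exact: measurable_fun_ltr.
  by apply: measurable_funM; [exact: measurableT_comp mg2 _|exact: measurableT_comp mp _].
have G0 z : (0 <= G z)%E.
  by rewrite /G lee_fin; case: ifP => // _; rewrite mulr_ge0 ?sqr_ge0// powR_ge0.
have mI : measurable (`]0, L[%classic : set Rm) by exact: measurable_itv.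
apply: (@le_trans _ _ (\int[leb]_(h in `]0%R, L[) \int[leb]_(t in `]0%R, L[) G (h, t))%E).
  apply: ge0_le_integral => //.
  - by move=> h _; rewrite lee_fin divr_ge0 ?sqr_ge0// powR_ge0.
  - apply/measurable_EFinP; apply: (measurable_funS measurableT) => //.
    apply: measurable_funM; first by apply: measurable_funX; exact: continuous_measurable_fun.
    by under eq_fun do rewrite -powRN; exact: measurable_powR.
  - apply: (measurable_funS measurableT) => //.
    exact: (measurable_section_integral mI mG G0).
  - move=> h /=; rewrite in_itv/= => /andP[h0 hL].
    have e : w h ^+ 2 / h `^ (a + 2) = h `^ (- (a + 1)) * (w h ^+ 2 / h).
      rewrite (_ : a + 2 = (a + 1) + 1); last by ring.
      rewrite powRD ?(gt_eqF h0) ?implybT// powRr1 ?ltW// powRN invfM.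
      by ring.
    rewrite e EFinM.
    apply: (@le_trans _ _ ((h `^ (- (a + 1)))%:E * \int[leb]_(t in `]0%R, h[) (g t ^+ 2)%:E)%E).
      by rewrite lee_wpmul2l ?lee_fin ?powR_ge0//; exact: sqr_primitive_le.
    rewrite -ge0_integralZl_EFin ?powR_ge0//; [|by move=> t _; rewrite lee_fin sqr_ge0|exact: mgE].
    apply: (@le_trans _ _ (\int[leb]_(t in `]0%R, h[) G (h, t))%E).
      rewrite le_eqVlt; apply/orP; left; apply/eqP; apply: eq_integral => t.
      rewrite inE/= in_itv/= => /andP[_ th].
      by rewrite /G/= th -EFinM mulrC.
    apply: ge0_subset_integral => //.
      apply: (measurable_funS measurableT) => //.
      exact: (measurableT_comp mG (pair1_measurable (h : Rm))).
    by move=> t /=; rewrite !in_itv/= => /andP[-> th]; exact: lt_trans hL.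
rewrite tonelli_swap// -ge0_integralZl_EFin//; last 3 first.
- by move=> t _; rewrite lee_fin divr_ge0 ?sqr_ge0// powR_ge0.
- apply/measurable_EFinP; apply: (measurable_funS measurableT) => //.
  apply: measurable_funM => //.
  by under eq_fun do rewrite -powRN; exact: measurable_powR.
- by rewrite invr_ge0 ltW.
have mI' : measurable (`]0, L[%classic : set Rm) by exact: measurable_itv.
apply: ge0_le_integral => //.
- by move=> t _; apply: integral_ge0.
- apply: (measurable_funS measurableT) => //.
  apply: (@measurable_section_integral R _ mI (fun z => G (z.2, z.1))) => //.
  apply: (measurableT_comp mG); exact: measurable_swap.
- apply/measurable_EFinP; apply: (measurable_funS measurableT) => //.
  apply: measurable_funM => //; apply: measurable_funM => //.
  by under eq_fun do rewrite -powRN; exact: measurable_powR.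
- move=> t /=; rewrite in_itv/= => /andP[t0 tL].
  apply: (@le_trans _ _ ((g t ^+ 2)%:E * \int[leb]_(h in `]t, L[) (h `^ (- (a + 1)))%:E)%E).
    rewrite -ge0_integralZl_EFin ?sqr_ge0//; last 2 first.
    + by move=> h _; rewrite lee_fin powR_ge0.
    + exact: mpE.
    rewrite le_eqVlt; apply/orP; left; apply/eqP.
    rewrite [LHS]integral_mkcond [RHS]integral_mkcond.
    apply: eq_integral => h _; rewrite !patchE /G/=.
    have [th|ht] := ltP t h; rewrite !mem_setE !in_itv/=.
      by rewrite th (lt_trans t0 th)/= EFinM; case: ifP.
    by rewrite [t < h]ltNge ht/=; case: ifP.
  apply: (@le_trans _ _ ((g t ^+ 2)%:E * (a^-1 * t `^ (- a))%:E)%E).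
    by rewrite lee_wpmul2l ?lee_fin ?sqr_ge0//; exact: integral_powR_tail.
  by rewrite -!EFinM powRN lee_fin mulrCA.
Qed.

End Hardy.

(** * Square integrability of first-order remainders *)

Section Fold.
Context {R : realType}.

(** A period centred at x is split into its two halves, the left one being
    reflected, which allows one-sided estimates at x to be applied to both. *)
Lemma integral_fold (f : R -> \bar R) (x : R) :
  measurable_fun setT f -> (forall y, (0 <= f y)%E) -> (forall y, f (y + 1) = f y) ->
  (\int[leb]_(y in `[0%R, 1%R[) f y =
   \int[leb]_(h in `]0%R, (1 / 2)%R[) f (x + 1 * h)%R +
   \int[leb]_(h in `]0%R, (1 / 2)%R[) f (x + -1 * h)%R)%E.
Proof.
move=> mf f0 pf.
have mfS (D : set R) : measurable D -> measurable_fun D f.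
  by move=> mD; exact: measurable_funS mf.
rewrite (integral_period (x - 1 / 2) mf f0 pf).
rewrite (_ : x - 1 / 2 + 1 = 1 / 2 + x); last by field.
rewrite (@integral_split_co _ f _ x)//; [|lra|lra].
rewrite addeC; congr (_ + _)%E.
  have := @integral_translate _ f 0 (1 / 2) x mf f0; rewrite add0r => ->.
  rewrite (@integral_itv_bndoo R 0 (1 / 2) (fun h => f (h + x)) true true).
    by apply: eq_integral => h _; rewrite addrC mul1r.
  apply: (measurable_funS measurableT) => //.
  apply: (measurableT_comp mf); exact: measurable_funD.
rewrite (@integral_itv_bndoo R (x - 1 / 2) x f true true); last exact: mfS.
rewrite (@integral_reflect _ f _ _ x)// subrr.
rewrite (_ : x - (x - 1 / 2) = 1 / 2); last by ring.
by apply: eq_integral => h _; rewrite mulN1r.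
Qed.

End Fold.

Section Remainder.
Context {R : realType} (m : nat) (s : R).
Local Notation Rm := (measurableTypeR R).
Implicit Types (u v : sobolev m s) (i : 'I_m) (x y : R) (z : Rm * Rm).

(** First-order Taylor remainder of u at z.1, evaluated at z.2; the normalized
    one is square integrable over the torus and vanishes, like the remainder,
    on the diagonal. *)
Definition rem_coord u i z : R :=
  pos_coord u i z.2 - pos_coord u i z.1 - sdist (z.2 - z.1) * der_coord u i z.1.

Definition nrem_coord u i z : R :=
  rem_coord u i z / `|sdist (z.2 - z.1)| `^ (s + 1 / 2).

Lemma measurable_pos_coord u i : measurable_fun setT (pos_coord u i).
Proof. by apply: continuous_measurable_fun; exact: pos_coord_continuous. Qed.

Lemma measurable_der_coord u i : measurable_fun setT (der_coord u i).
Proof. by apply: continuous_measurable_fun; exact: der_coord_continuous. Qed.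

Lemma measurable_nrem_coord u i : measurable_fun setT (nrem_coord u i).
Proof.
have mp := measurable_pos_coord u i; have md := measurable_der_coord u i.
have ms := @measurable_sdist_sub R.
apply: measurable_funM.
  apply: measurable_funB; first by apply: measurable_funB; exact: measurableT_comp mp _.
  by apply: measurable_funM => //; exact: measurableT_comp md _.
under eq_fun do rewrite -powRN.
apply: (measurableT_comp (measurable_powR _)).
exact: (measurableT_comp (@normr_measurable R setT)).
Qed.

Lemma nrem_coord_sqr u i z :
  nrem_coord u i z ^+ 2 = rem_coord u i z ^+ 2 / `|sdist (z.2 - z.1)| `^ (2 * s - 1 + 2).
Proof.
rewrite /nrem_coord exprMn exprVn; congr (_ * _^-1).
by rewrite -powR_mulrn ?powR_ge0// -powRrM; congr (_ `^ _); field.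
Qed.

Lemma nrem_coord_linear a u v i z :
  nrem_coord (a *: u + v) i z = a * nrem_coord u i z + nrem_coord v i z.
Proof. by rewrite /nrem_coord /rem_coord !pos_coord_linear !der_coord_linear; ring. Qed.

Lemma sdist_half (h : R) : 0 < h < 1 / 2 -> sdist h = h /\ sdist (- h) = - h.
Proof. by move=> /andP[h0 h1]; split; apply: sdist_id; apply/andP; lra. Qed.

Hypothesis hs : 1 / 2 < s.

(** For fixed x the remainder along x + e h has derivative
    e (u'(x + e h) - u'(x)) in h, so the Hardy inequality trades the remainder
    for the increment of u' and two powers of h. *)
Lemma nrem_coord_half_section u i x (e : R) : `|e| = 1 ->
  (\int[leb]_(h in `]0%R, (1 / 2)%R[) (nrem_coord u i (x, x + e * h) ^+ 2)%:E <=
   (2 * s - 1)^-1%:E * \int[leb]_(h in `]0%R, (1 / 2)%R[)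
     ((der_coord u i (x + e * h) - der_coord u i x) ^+ 2
        / rho (x + e * h) x `^ (2 * s - 1))%:E)%E.
Proof.
move=> e1.
have a0 : 0 < 2 * s - 1 by move: hs => ?; lra.
have half0 : 0 < 1 / 2 :> R by lra.
have ee : e ^+ 2 = 1 by rewrite -real_normK ?num_real// e1 expr1n.
pose w h := pos_coord u i (x + e * h) - pos_coord u i x - e * h * der_coord u i x.
pose g h := e * (der_coord u i (x + e * h) - der_coord u i x).
have dl (h : R) : is_derive h (1 : R) (fun h : R => x + e * h) e.
  by apply: is_derive_eq; rewrite add0r mul1r /GRing.scale/= mulr1.
have dw (h : R) : is_derive h (1 : R) w (g h).
  have d1 := is_derive_coord u i (x + e * h).
  have d2 := @is_derive1_comp _ (pos_coord u i) (fun h : R => x + e * h) h _ _ d1 (dl h).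
  have d3 : is_derive h (1 : R) (fun h : R => e * h * der_coord u i x) (e * der_coord u i x).
    by apply: is_derive_eq; rewrite /GRing.scale/=; ring.
  by apply: is_derive_eq; rewrite /g; ring.
have w0 : w 0 = 0 by rewrite /w mulr0 addr0; ring.
have cg : continuous g.
  move=> h; apply: cvgMl_tmp; apply: cvgB; last exact: cvg_cst.
  apply: (@continuous_comp _ _ _ (fun h : R => x + e * h)); last exact: der_coord_continuous.
  by apply: cvgD; [exact: cvg_cst|apply: cvgMl_tmp; exact: cvg_id].
have sd h : h \in `]0, 1 / 2[%classic -> sdist (x + e * h - x) = e * h.
  rewrite inE/= in_itv/= => /sdist_half[h1 h2]; rewrite addrC addKr.
  have /orP[/eqP->|/eqP->] : (e == 1) || (e == -1) by rewrite -eqf_sqr expr1n ee.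
    by rewrite mul1r.
  by rewrite mulN1r.
have ndh h : h \in `]0, 1 / 2[%classic -> `|e * h| = h.
  rewrite inE/= in_itv/= => /andP[h0 _].
  by rewrite normrM e1 mul1r gtr0_norm.
have eN h : h \in `]0, 1 / 2[%classic ->
    nrem_coord u i (x, x + e * h) ^+ 2 = w h ^+ 2 / h `^ (2 * s - 1 + 2).
  by move=> hI; rewrite nrem_coord_sqr /rem_coord/= sd// ndh.
have eD h : h \in `]0, 1 / 2[%classic ->
    (der_coord u i (x + e * h) - der_coord u i x) ^+ 2 / rho (x + e * h) x `^ (2 * s - 1)
    = g h ^+ 2 / h `^ (2 * s - 1).
  by move=> hI; rewrite rho_sdist sd// ndh// /g exprMn ee mul1r.
have eq1 : (\int[leb]_(h in `]0%R, (1 / 2)%R[) (nrem_coord u i (x, x + e * h) ^+ 2)%:E =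
    \int[leb]_(h in `]0%R, (1 / 2)%R[) (w h ^+ 2 / h `^ (2 * s - 1 + 2))%:E)%E.
  by apply: eq_integral => h hI; rewrite eN.
have eq2 : (\int[leb]_(h in `]0%R, (1 / 2)%R[) ((der_coord u i (x + e * h) - der_coord u i x) ^+ 2
        / rho (x + e * h) x `^ (2 * s - 1))%:E =
    \int[leb]_(h in `]0%R, (1 / 2)%R[) (g h ^+ 2 / h `^ (2 * s - 1))%:E)%E.
  by apply: eq_integral => h hI; rewrite eD.
rewrite eq1 eq2; exact: hardy_inequality.
Qed.

Lemma nrem_coord_section u i x :
  (\int[leb]_(y in circle) (nrem_coord u i (x, y) ^+ 2)%:E <=
   (2 * s - 1)^-1%:E * \int[leb]_(y in circle)
     ((der_coord u i y - der_coord u i x) ^+ 2 / rho y x `^ (2 * s - 1))%:E)%E.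
Proof.
pose N y := (nrem_coord u i (x, y) ^+ 2)%:E.
pose D y := ((der_coord u i y - der_coord u i x) ^+ 2 / rho y x `^ (2 * s - 1))%:E.
have mp := measurable_pos_coord u i; have md := measurable_der_coord u i.
have mN : measurable_fun setT N.
  apply/measurable_EFinP/measurable_funX.
  exact: (measurableT_comp (measurable_nrem_coord u i) (pair1_measurable (x : Rm))).
have N0 y : (0 <= N y)%E by rewrite lee_fin sqr_ge0.
have mDx : measurable_fun setT (fun y : Rm => der_coord u i y - der_coord u i x).
  exact: (measurable_funB md (measurable_cst _)).
have mD : measurable_fun setT D.
  apply/measurable_EFinP; apply: measurable_funM; first exact: measurable_funX.
  exact: (measurableT_comp (measurable_rho_powR (2 * s - 1)) (pair1_measurable (x : Rm))).
have D0 y : (0 <= D y)%E.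
  by rewrite lee_fin divr_ge0 ?sqr_ge0// powR_ge0.
have Np y : N (y + 1) = N y.
  rewrite /N /nrem_coord /rem_coord/= -[y + 1]/(y + 1%:~R) pos_coord_int.
  by rewrite [y + _ - x]addrAC sdistDz.
have Dp y : D (y + 1) = D y.
  rewrite /D !rho_sdist -[y + 1]/(y + 1%:~R) der_coord_int.
  by rewrite [y + _ - x]addrAC sdistDz.
have I0 (e : R) : (0 <= \int[leb]_(h in `]0%R, (1 / 2)%R[) D (x + e * h)%R)%E.
  exact: integral_ge0.
have eN := integral_fold x mN N0 Np; have eD := integral_fold x mD D0 Dp.
apply: (@le_trans _ _ ((2 * s - 1)^-1%:E * \int[leb]_(h in `]0%R, (1 / 2)%R[) D (x + 1 * h)%R +
  (2 * s - 1)^-1%:E * \int[leb]_(h in `]0%R, (1 / 2)%R[) D (x + -1 * h)%R)%E); last first.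
  by rewrite -ge0_muleDr// -eD.
rewrite [leLHS]eN; apply: leeD.
  exact: (nrem_coord_half_section u i x (normr1 _)).
exact: (nrem_coord_half_section u i x (normrN1 _)).
Qed.

Lemma nrem_coord_L2 u i :
  (\int[leb2 R]_(z in circle2) (nrem_coord u i z ^+ 2)%:E <=
   ((2 * s - 1)^-1 * `|u| ^+ 2)%:E)%E.
Proof.
have a0 : 0 < 2 * s - 1 by move: hs => ?; lra.
have mN : measurable_fun setT (fun z => (nrem_coord u i z ^+ 2)%:E).
  by apply/measurable_EFinP/measurable_funX; exact: measurable_nrem_coord.
have md := measurable_der_coord u i.
pose D z := ((der_coord u i z.2 - der_coord u i z.1) ^+ 2 / rho z.2 z.1 `^ (2 * s - 1))%:E.
have mD : measurable_fun setT D.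
  apply/measurable_EFinP; apply: measurable_funM; last exact: measurable_rho_powR.
  by apply: measurable_funX; apply: measurable_funB; exact: measurableT_comp md _.
have D0 z : (0 <= D z)%E by rewrite lee_fin divr_ge0 ?sqr_ge0// powR_ge0.
have mc := @measurable_circle R.
rewrite tonelli_rect//; last by move=> z; rewrite lee_fin sqr_ge0.
apply: (@le_trans _ _ (\int[leb]_(x in circle) ((2 * s - 1)^-1%:E * \int[leb]_(y in circle) D (x, y)))%E).
  apply: ge0_le_integral => //.
  - by move=> x _; apply: integral_ge0 => y _; rewrite lee_fin sqr_ge0.
  - apply: (measurable_funS measurableT) => //.
    by apply: (measurable_section_integral mc mN) => z; rewrite lee_fin sqr_ge0.
  - apply: measurable_funeM; apply: (measurable_funS measurableT) => //.
    exact: (measurable_section_integral mc mD).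
  - by move=> x _; exact: nrem_coord_section.
rewrite ge0_integralZl_EFin//; last 3 first.
- by move=> x _; exact: integral_ge0.
- apply: (measurable_funS measurableT) => //.
  exact: (measurable_section_integral mc mD).
- by rewrite invr_ge0 ltW.
rewrite EFinM -tonelli_rect// lee_pmul2l ?lte_fin ?invr_gt0//.
exact: der_coord_seminorm.
Qed.

End Remainder.

(** * Chord slopes of embeddings *)

Section Slope.
Context {R : realType} (m : nat) (s : R).
Local Notation Rm := (measurableTypeR R).
Implicit Types (u v : sobolev m s) (i : 'I_m) (x y h : R).

(** Difference quotient, completed by the derivative at h = 0 so that it is
    continuous and, for an embedding and |h| <= 1/2, nonzero as a vector. *)
Definition slope u i x h : R :=
  if h == 0 then der_coord u i x else (pos_coord u i (x + h) - pos_coord u i x) / h.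

Lemma slope_MVT u i x h : exists2 t, `|t - x| <= `|h| & slope u i x h = der_coord u i t.
Proof.
rewrite /slope; have [->|h0] := eqVneq h 0.
  by exists x => //; rewrite subrr normr0.
have cp a b : {within `[a, b], continuous (pos_coord u i)}.
  by apply: continuous_subspaceT; exact: pos_coord_continuous.
have dp (a b t : R) : t \in `]a, b[%R -> is_derive t (1 : R) (pos_coord u i) (der_coord u i t).
  by move=> _; exact: is_derive_coord.
have [hp|hn] := ltP 0 h.
- have [|t] := @MVT_segment R _ _ x (x + h) _ (@dp _ _) (@cp _ _); first by rewrite lerDl ltW.
  rewrite in_itv/= => /andP[t1 t2] ->; exists t.
    by rewrite (gtr0_norm hp) ger0_norm; lra.
  by rewrite (addrC x h) addrK mulfK.
- have [|t] := @MVT_segment R _ _ (x + h) x _ (@dp _ _) (@cp _ _); first by rewrite gerDl.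
  rewrite in_itv/= => /andP[t1 t2] e; exists t.
    by rewrite (ler0_norm hn) ler0_norm; lra.
  by rewrite -opprB e opprD addNKr mulrN opprK mulfK.
Qed.

Lemma slope_linear a u v i x h :
  slope (a *: u + v) i x h = a * slope u i x h + slope v i x h.
Proof.
rewrite /slope !der_coord_linear !pos_coord_linear; case: ifPn => // h0.
by field.
Qed.

Lemma slopeE u i x h : pos_coord u i (x + h) - pos_coord u i x = h * slope u i x h.
Proof.
rewrite /slope; have [->|h0] := eqVneq h 0; first by rewrite addr0 subrr mul0r.
by rewrite mulrC divfK.
Qed.

Lemma slope_int u i x h (k : int) : slope u i (x + k%:~R) h = slope u i x h.
Proof. by rewrite /slope der_coord_int addrAC !pos_coord_int. Qed.

Lemma slope_continuous u i : continuous (fun z : R * R => slope u i z.1 z.2).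
Proof.
move=> [x h]; have [h0|h0] := eqVneq h 0.
  apply/cvgrPdist_le => e e0.
  have : der_coord u i y @[y --> x] --> der_coord u i x by exact: der_coord_continuous.
  move=> /cvgrPdist_le /(_ _ e0) /nbhs_ballP[r /= r0 Hr].
  have r20 : 0 < r / 2 by lra.
  exists (ball x (r / 2), ball h (r / 2)) => /=.
    by split; apply: nbhsx_ballx.
  move=> [y k] [/= xy hk]; have [t ty ->] := slope_MVT u i y k.
  rewrite /slope h0 eqxx; apply: Hr; move: xy hk; rewrite -!ball_normE/= h0 sub0r normrN.
  move=> xy hk; have := ler_normB (x - y) (t - y).
  by rewrite opprB addrA subrK; lra.
rewrite /continuous_at /=.
have -> : slope u i x h = (pos_coord u i (x + h) - pos_coord u i x) / h.
  by rewrite /slope (negbTE h0).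
apply: (cvg_trans (near_eq_cvg _)); last first.
  apply: (@cvgM _ _ (nbhs (x, h)) _ (fun z : R * R => pos_coord u i (z.1 + z.2) - pos_coord u i z.1)
     (fun z => z.2^-1) _ _).
    apply: cvgB.
      apply: (@continuous_comp _ _ _ (fun z : R * R => z.1 + z.2)); last exact: pos_coord_continuous.
      by apply: cvgD; [exact: cvg_fst|exact: cvg_snd].
    apply: (@continuous_comp _ _ _ (fun z : R * R => z.1)); last exact: pos_coord_continuous.
    exact: cvg_fst.
  by apply: cvgV => //; exact: cvg_snd.
have : \forall z \near (x, h), z.2 != 0.
  have hn : 0 < `|h| by rewrite normr_gt0.
  exists (setT, ball h `|h|) => /=.
    by split; [exact: filterT|exact: nbhsx_ballx].
  move=> [y k] [/= _]; rewrite -ball_normE/= => hk.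
  by apply/eqP => k0; move: hk; rewrite k0 subr0 ltxx.
apply: filterS => -[y k] /= k0.
by rewrite /slope (negbTE k0).
Qed.

(** The slope between two points of the circle, along the shorter arc. *)
Definition chord u i (z : Rm * Rm) : R := slope u i z.1 (sdist (z.2 - z.1)).

Lemma chordE u i z :
  pos_coord u i z.2 - pos_coord u i z.1 = sdist (z.2 - z.1) * chord u i z.
Proof.
rewrite -slopeE; have [k ->] := sdistE (z.2 - z.1).
by rewrite addrA (addrC z.1) subrK pos_coord_int.
Qed.

Lemma rem_coordE u i z :
  rem_coord u i z = sdist (z.2 - z.1) * (chord u i z - der_coord u i z.1).
Proof. by rewrite /rem_coord chordE mulrBr. Qed.

Lemma invr_powR (t : R) : t^-1 = t * (t ^+ 2) `^ (-1).
Proof.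
rewrite powR_inv1 ?sqr_ge0//; have [->|t0] := eqVneq t 0; first by rewrite invr0 mul0r.
by field.
Qed.

Lemma measurable_chord u i : measurable_fun setT (chord u i).
Proof.
have mp := measurable_pos_coord u i; have md := measurable_der_coord u i.
have ms := @measurable_sdist_sub R.
apply: measurable_fun_ifT.
- by apply: measurable_fun_eqr => //; exact: measurable_cst.
- exact: measurableT_comp md _.
- apply: measurable_funM.
    apply: measurable_funB; last exact: measurableT_comp mp _.
    by apply: (measurableT_comp mp); exact: measurable_funD.
  under eq_fun do rewrite invr_powR.
  apply: measurable_funM => //; apply: (measurableT_comp (measurable_powR _)).
  exact: measurable_funX.
Qed.

(** The vector of slopes vanishes nowhere: at h = 0 because u is an immersion,
    at 0 < |h| <= 1/2 because u is injective on the circle.  Its length is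
    continuous and periodic in x, so it has a positive minimum. *)
Lemma embedding_slope_lower_bound u : embedding u ->
  exists2 c, 0 < c & forall x h, `|h| <= 1 / 2 -> c <= \sum_i slope u i x h ^+ 2.
Proof.
move=> [du0 cu inj _].
pose F (z : R * R) := \sum_i slope u i z.1 z.2 ^+ 2.
have cF : continuous F.
  move=> z; rewrite /F /continuous_at.
  apply: cvg_big => [|i _]; first exact: add_continuous.
  apply: (@continuous_comp _ _ _ (fun z : R * R => slope u i z.1 z.2) (fun x => x ^+ 2)).
    exact: slope_continuous.
  exact: exprn_continuous.
pose K : set (R * R) := `[0, 1]%classic `*` `[- (1 / 2), 1 / 2]%classic.
have [] := @compact_EVT_min (R * R)%type R F K.
- by exists (0, 0); split; rewrite /= in_itv/=; apply/andP; split; lra.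
- by apply: compact_setX; exact: segment_compact.
- exact: continuous_subspaceT.
move=> [x0 h0]; rewrite inE => -[/= _ h0I] minF.
exists (F (x0, h0)).
  rewrite lt_neqAle eq_sym sumr_ge0 ?andbT => [|i _]; last exact: sqr_ge0.
  apply/negP => /eqP/psumr_eq0P F0.
  have {}F0 i : slope u i x0 h0 = 0.
    by apply/eqP; rewrite -sqrf_eq0 F0// => j _; exact: sqr_ge0.
  have [h00|h00] := eqVneq h0 0.
    have /eqP[] := du0 x0; apply/matrixP => i j; rewrite (ord1 j) mxE.
    by have := F0 i; rewrite /slope h00 eqxx.
  have /inj[k] : u (x0 + h0) = u x0.
    apply/matrixP => i j; rewrite (ord1 j); apply/eqP; rewrite -subr_eq0.
    by rewrite -[X in X - _]/(pos_coord u i _) -[X in _ - X]/(pos_coord u i _) slopeE F0 mulr0.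
  rewrite addrC addKr => hk; move: h0I; rewrite in_itv/= => /andP[h1 h2].
  have : `|h0| < 1 by rewrite ltr_norml; apply/andP; split; lra.
  rewrite hk -intr_norm -[X in _ < X]/(1%:~R) ltr_int ltNge -gtz0_ge1 normr_gt0.
  by move=> /negP; apply; apply/eqP => k0; move/eqP: h00; apply; rewrite hk k0.
move=> x h hI; have := minF (x - (Num.floor x)%:~R, h).
have -> : F (x - (Num.floor x)%:~R, h) = \sum_i slope u i x h ^+ 2.
  by apply: eq_bigr => i _; rewrite /= -mulrNz slope_int.
apply; rewrite inE; split; rewrite /= in_itv/=.
  rewrite subr_ge0 floor_le/= ltW// ltrBlDl -[X in _ + X]/(1%:~R) -intrD.
  exact: floorD1_gt.
by rewrite -ler_norml.
Qed.

End Slope.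

(** * Integrable densities and bounded trilinear forms *)

Section Classes.
Context {R : realType}.
Local Notation Z := (measurableTypeR R * measurableTypeR R)%type.
Local Notation bm := (@bmf R _ Z).
Implicit Types (f g : Z -> R) (k : bm).

Definition L1 f : Prop := (leb2 R).-integrable circle2 (EFin \o f).

Definition L2 f : Prop := measurable_fun setT f /\
  (\int[leb2 R]_(z in circle2) (f z ^+ 2)%:E < +oo)%E.

Definition Int f : R := \int[leb2 R]_(z in circle2) f z.

Let mc2 := @measurable_circle2 R.

Lemma eq_L1 f g : f =1 g -> L1 f -> L1 g.
Proof. by move=> /funext ->. Qed.

Lemma L1D f g : L1 f -> L1 g -> L1 (fun z => f z + g z).
Proof. by move=> Lf Lg; apply: (integrableD mc2 Lf Lg). Qed.

Lemma L1Z c f : L1 f -> L1 (fun z => c * f z).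
Proof. by move=> Lf; apply: (integrableZl mc2 c Lf). Qed.

Lemma L1B f g : L1 f -> L1 g -> L1 (fun z => f z - g z).
Proof. by move=> Lf Lg; apply: (integrableB mc2 Lf Lg). Qed.

Lemma IntD f g : L1 f -> L1 g -> Int (fun z => f z + g z) = Int f + Int g.
Proof. by move=> Lf Lg; apply: RintegralD. Qed.

Lemma IntB f g : L1 f -> L1 g -> Int (fun z => f z - g z) = Int f - Int g.
Proof. by move=> Lf Lg; apply: RintegralB. Qed.

Lemma IntZ c f : L1 f -> Int (fun z => c * f z) = c * Int f.
Proof. by move=> Lf; apply: RintegralZl. Qed.

Lemma L1_0 : L1 (fun=> 0).
Proof. exact: integrable0. Qed.

Lemma L1_sum I (r : seq I) (F : I -> Z -> R) : (forall i, L1 (F i)) ->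
  L1 (fun z => \sum_(i <- r) F i z).
Proof.
move=> LF; elim: r => [|i r IH].
  by apply: eq_L1 L1_0 => z; rewrite big_nil.
by apply: eq_L1 (L1D (LF i) IH) => z; rewrite big_cons.
Qed.

Lemma Int_sum I (r : seq I) (F : I -> Z -> R) : (forall i, L1 (F i)) ->
  Int (fun z => \sum_(i <- r) F i z) = \sum_(i <- r) Int (F i).
Proof.
move=> LF; elim: r => [|i r IH].
  rewrite big_nil -[RHS](mul0r (Int (fun=> 0))) -IntZ; last exact: L1_0.
  by congr Int; apply/funext => z; rewrite big_nil mul0r.
rewrite big_cons -IH -IntD//; last exact: L1_sum.
by congr Int; apply/funext => z; rewrite big_cons.
Qed.

Lemma L2_sqr f : L2 f -> L1 (fun z => f z ^+ 2).
Proof.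
move=> [mf If]; apply/integrableP; split.
  apply: (measurable_funS measurableT) => //; apply/measurable_EFinP.
  exact: measurable_funX.
apply: le_lt_trans If; rewrite le_eqVlt; apply/orP; left; apply/eqP.
by apply: eq_integral => z _ /=; rewrite ger0_norm// sqr_ge0.
Qed.

Lemma L1_le f g : measurable_fun setT f -> L1 g -> (forall z, `|f z| <= g z) -> L1 f.
Proof.
move=> mf Lg fg; apply: le_integrable Lg => //.
  by apply: (measurable_funS measurableT) => //; exact/measurable_EFinP.
move=> z _ /=; rewrite lee_fin; apply: le_trans (fg z) _; exact: ler_norm.
Qed.

Lemma L2M_L1 f g : L2 f -> L2 g -> L1 (fun z => f z * g z).
Proof.
move=> Lf Lg; have [mf _] := Lf; have [mg _] := Lg.
apply: (L1_le _ (L1D (L2_sqr Lf) (L2_sqr Lg))); first exact: measurable_funM.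
move=> z; rewrite normrM -(real_normK (num_real (f z))) -(real_normK (num_real (g z))).
move: `|f z| `|g z| (normr_ge0 (f z)) (normr_ge0 (g z)) => a b a0 b0.
have := sqr_ge0 (a - b); have := mulr_ge0 a0 b0; rewrite sqrrB => ? ?; lra.
Qed.

Lemma L1_L2 f : measurable_fun setT f -> L1 (fun z => f z ^+ 2) -> L2 f.
Proof.
move=> mf /integrableP[_ h]; split => //; apply: le_lt_trans h.
rewrite le_eqVlt; apply/orP; left; apply/eqP; apply: eq_integral => z _ /=.
by rewrite ger0_norm// sqr_ge0.
Qed.

Lemma eq_L2 f g : f =1 g -> L2 f -> L2 g.
Proof. by move=> /funext ->. Qed.

Lemma bmulL1 k f : L1 f -> L1 (fun z => k z * f z).
Proof.
move=> Lf; have mf : measurable_fun circle2 f by apply/measurable_EFinP; have /integrableP[] := Lf.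
have /= Lkf := integrable_norm (L1Z `|k| Lf).
apply: le_integrable Lkf => //.
  apply/measurable_EFinP; apply: measurable_funM => //.
  by apply: (measurable_funS measurableT) => //; exact: bmf_measurable.
move=> z _ /=; rewrite lee_fin normr_id !normrM normr_id.
by rewrite ler_wpM2r//; exact: ler_bmf_norm.
Qed.

Lemma bmulL2 k f : L2 f -> L2 (fun z => k z * f z).
Proof.
move=> Lf; have [mf _] := Lf; apply: L1_L2.
  by apply: measurable_funM => //; exact: bmf_measurable.
apply: eq_L1 (bmulL1 (bmul k k) (L2_sqr Lf)) => z /=.
by rewrite bmulE; ring.
Qed.

Lemma L2D f g : L2 f -> L2 g -> L2 (fun z => f z + g z).
Proof.
move=> Lf Lg; have [mf _] := Lf; have [mg _] := Lg.
apply: L1_L2; first exact: measurable_funD.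
apply: eq_L1 (L1D (L1D (L2_sqr Lf) (L2_sqr Lg)) (L1Z 2 (L2M_L1 Lf Lg))) => z /=; ring.
Qed.

Lemma L2N f : L2 f -> L2 (fun z => - f z).
Proof.
move=> Lf; have [mf _] := Lf; apply: L1_L2; first exact: measurable_funN.
by apply: eq_L1 (L2_sqr Lf) => z; rewrite sqrrN.
Qed.

Lemma L2_sum I (r : seq I) (F : I -> Z -> R) : (forall i, L2 (F i)) ->
  L2 (fun z => \sum_(i <- r) F i z).
Proof.
move=> LF; elim: r => [|i r IH].
  apply: L1_L2; first by under eq_fun do rewrite big_nil; exact: measurable_cst.
  by apply: eq_L1 L1_0 => z; rewrite big_nil expr0n.
by apply: eq_L2 (L2D (LF i) IH) => z; rewrite big_cons.
Qed.

End Classes.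

(** The weights are chosen for a and b to be the norms of two functions whose
    values are p and q: both terms then integrate to K a b / 2, as in the
    Cauchy-Schwarz inequality. *)
Lemma weighted_AMGM (R : realFieldType) (K a b p q : R) : 0 <= K -> 0 < a -> 0 < b ->
  K * (p * q) <= K * (b / a) / 2 * p ^+ 2 + K * (a / b) / 2 * q ^+ 2.
Proof.
move=> K0 a0 b0; rewrite -subr_ge0.
rewrite (_ : _ - _ = K / 2 / (a * b) * (b * p - a * q) ^+ 2).
  by rewrite mulr_ge0 ?sqr_ge0// !divr_ge0// mulr_ge0// ltW.
by field; rewrite ?gt_eqF.
Qed.

Section Forms.
Context {R : realType} (m : nat) (s : R).
Local Notation Z := (measurableTypeR R * measurableTypeR R)%type.
Local Notation bm := (@bmf R _ Z).
Local Notation H := (sobolev m s).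
Implicit Types (u v : H) (i j : 'I_m) (k : bm).
Hypothesis hs : 3 / 2 < s.

Let mc2 := @measurable_circle2 R.

Lemma nrem_L2 u i : L2 (nrem_coord u i).
Proof.
split; first exact: measurable_nrem_coord.
have h2 : 1 / 2 < s by move: hs => ?; lra.
by apply: le_lt_trans (nrem_coord_L2 h2 u i) _; rewrite ltry.
Qed.

Lemma nrem_Int_sqr u i : Int (fun z => nrem_coord u i z ^+ 2) <= (2 * s - 1)^-1 * `|u| ^+ 2.
Proof.
have h2 : 1 / 2 < s by move: hs => ?; lra.
rewrite -lee_fin /Int /Rintegral fineK; last first.
  exact: (integrable_fin_num mc2 (L2_sqr (nrem_L2 u i))).
exact: nrem_coord_L2.
Qed.

(** The trilinear form through which the energy depends on the curve: k is a
    bounded coefficient and u, v enter through their remainders. *)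
Definition l2form i j k u v : R := Int (fun z => k z * (nrem_coord u i z * nrem_coord v j z)).

Lemma l2form_L1 i j k u v : L1 (fun z => k z * (nrem_coord u i z * nrem_coord v j z)).
Proof. by apply: bmulL1; apply: L2M_L1; exact: nrem_L2. Qed.

Lemma l2form_linear1 i j a k k' u v :
  l2form i j (a *: k + k') u v = a * l2form i j k u v + l2form i j k' u v.
Proof.
rewrite /l2form -IntZ; last exact: l2form_L1.
rewrite -IntD; [|exact/L1Z/l2form_L1|exact: l2form_L1].
by congr Int; apply/funext => z; rewrite bmfD bmfZ; ring.
Qed.

Lemma l2form_linear2 i j k a u u' v :
  l2form i j k (a *: u + u') v = a * l2form i j k u v + l2form i j k u' v.
Proof.
rewrite /l2form -IntZ; last exact: l2form_L1.
rewrite -IntD; [|exact/L1Z/l2form_L1|exact: l2form_L1].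
by congr Int; apply/funext => z; rewrite nrem_coord_linear; ring.
Qed.

Lemma l2form_linear3 i j k a u v v' :
  l2form i j k u (a *: v + v') = a * l2form i j k u v + l2form i j k u v'.
Proof.
rewrite /l2form -IntZ; last exact: l2form_L1.
rewrite -IntD; [|exact/L1Z/l2form_L1|exact: l2form_L1].
by congr Int; apply/funext => z; rewrite nrem_coord_linear; ring.
Qed.

Lemma l2form_bound i j k u v :
  `|l2form i j k u v| <= (2 * s - 1)^-1 * `|k| * `|u| * `|v|.
Proof.
have a0 : 0 < 2 * s - 1 by move: hs => ?; lra.
have form0 a b c w : a = 0 \/ b = 0 -> l2form i j c a b = w -> w = 0.
  case=> -> <-.
    have := l2form_linear2 i j c 0 0 0 b; rewrite scaler0 addr0 mul0r add0r.
    by have := l2form_linear2 i j c 1 0 0 b; rewrite scaler0 addr0 mul1r => /esym; lra.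
  have := l2form_linear3 i j c 1 a 0 0; rewrite scaler0 addr0 mul1r; lra.
have [->|u0] := eqVneq u 0; first by rewrite (form0 _ _ _ _ _ erefl) ?normr0 ?mulr0 ?mul0r//; left.
have [->|v0] := eqVneq v 0; first by rewrite (form0 _ _ _ _ _ erefl) ?normr0 ?mulr0//; right.
have : 0 <= `|k| by []; have {u0} : 0 < `|u| by rewrite normr_gt0.
have {v0} : 0 < `|v| by rewrite normr_gt0.
have := nrem_Int_sqr u i; have := nrem_Int_sqr v j; have := ler_bmf_norm k.
move: `|k| `|u| `|v| => K U V kK Iv Iu V0 U0 K0.
pose a := V / U; pose b := U / V.
have La := L1Z (K * a / 2) (L2_sqr (nrem_L2 u i)).
have Lb := L1Z (K * b / 2) (L2_sqr (nrem_L2 v j)).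
apply: (@le_trans _ _ (Int (fun z => K * a / 2 * nrem_coord u i z ^+ 2 +
   K * b / 2 * nrem_coord v j z ^+ 2))).
  apply: le_trans (le_normr_Rintegral mc2 (l2form_L1 i j k u v)) _.
  apply: le_Rintegral => //.
  - exact: integrable_norm (l2form_L1 i j k u v).
  - exact: L1D La Lb.
  move=> z _; rewrite normrM [`|nrem_coord u i z * _|]normrM.
  rewrite -(real_normK (num_real (nrem_coord u i z))).
  rewrite -(real_normK (num_real (nrem_coord v j z))).
  move: `|nrem_coord u i z| `|nrem_coord v j z| (normr_ge0 (nrem_coord u i z))
    (normr_ge0 (nrem_coord v j z)) => p q p0 q0.
  apply: (@le_trans _ _ (K * (p * q))); last exact: weighted_AMGM.
  by rewrite ler_wpM2r ?mulr_ge0.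
rewrite IntD// !IntZ; [|exact: L2_sqr (nrem_L2 _ _)|exact: L2_sqr (nrem_L2 _ _)].
apply: le_trans (lerD (ler_wpM2l _ Iu) (ler_wpM2l _ Iv)) _.
- by apply: divr_ge0 => //; apply: mulr_ge0 => //; apply: divr_ge0; exact: ltW.
- by apply: divr_ge0 => //; apply: mulr_ge0 => //; apply: divr_ge0; exact: ltW.
rewrite le_eqVlt; apply/orP; left; apply/eqP.
by rewrite /a /b; field; rewrite ?gt_eqF.
Qed.

Definition l2form_map i j k u : blin H R := toblin (l2form i j k u).

Lemma l2form_mapE i j k u v : l2form_map i j k u v = l2form i j k u v.
Proof.
rewrite /l2form_map toblinE//; first by move=> a w w'; exact: l2form_linear3.
by exists ((2 * s - 1)^-1 * `|k| * `|u|) => w; exact: l2form_bound.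
Qed.

Lemma l2form_map_bilinear i j : bounded_bilinear (l2form_map i j).
Proof.
have a0 : 0 < 2 * s - 1 by move: hs => ?; lra.
split=> [u a k k'|k a u u'|].
- apply: blinP => v; rewrite blinD blinZ.
  rewrite (l2form_mapE i j _ u v) (l2form_mapE i j k u v) (l2form_mapE i j k' u v).
  exact: l2form_linear1.
- apply: blinP => v; rewrite blinD blinZ.
  have e w : l2form_map i j k w v = l2form i j k w v by exact: l2form_mapE.
  apply: (eq_trans (e _)); apply: (eq_trans (l2form_linear2 i j k a u u' v)).
  exact: (esym (congr2 (fun p q => a * p + q) (e u) (e u'))).
- exists (2 * s - 1)^-1 => [|k u]; first by rewrite invr_ge0 ltW.
  apply: blin_norm_le => [|v]; first by rewrite !mulr_ge0// invr_ge0 ltW.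
  by rewrite l2form_mapE mulrA; exact: l2form_bound.
Qed.

End Forms.

(** * Coefficients of the energy density *)

Section Rules.
Context {R : realType} d (T : measurableType d) (V : normedModType R).
Local Notation bm := (@bmf R d T).
Implicit Types (f g : V -> bm) (x u : V).

(** Differentiability of a map into bounded functions, with a derivative that is
    known through its values at the points t. *)
Definition has_der f x (D : V -> T -> R) : Prop :=
  exists2 F : blin V bm, is_diff x f F & forall u t, F u t = D u t.

Lemma eq_has_der f g x D D' : f =1 g -> (forall u t, D u t = D' u t) ->
  has_der f x D -> has_der g x D'.
Proof.
by move=> /funext -> DD [F dF FD]; exists F => // u t; rewrite FD.
Qed.

Lemma has_der_lin (L : blin V bm) x : has_der L x (fun u t => L u t).
Proof. by exists L => //; exact: is_diff_lin. Qed.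

Lemma has_derM f g x D E : has_der f x D -> has_der g x E ->
  has_der (fun y => bmul (f y) (g y)) x (fun u t => D u t * g x t + f x t * E u t).
Proof.
move=> [F dF FD] [G dG GE]; have bB := @bmul_bilinear1 R d T.
exists (bil_comp_l (@bmul R d T) F (g x) + bil_comp_r (@bmul R d T) (f x) G).
  exact: is_diff_bil.
by move=> u t; rewrite blinD bil_comp_lE// bil_comp_rE// bmfD !bmulE FD GE.
Qed.

Lemma has_der_sum I (r : seq I) (f : I -> V -> bm) x (D : I -> V -> T -> R) :
  (forall i, has_der (f i) x (D i)) ->
  has_der (fun y => \sum_(i <- r) f i y) x (fun u t => \sum_(i <- r) D i u t).
Proof.
move=> fD; elim: r => [|i r [F dF FD]].
  exists 0 => [|u t]; last by rewrite big_nil.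
  apply/is_diff_epsP => e e0; exists 1 => // h _; rewrite !big_nil.
  by rewrite subrr sub0r oppr0 normr0 mulr_ge0// ltW.
have [G dG GD] := fD i; exists (G + F) => [|u t]; last first.
  by rewrite blinD bmfD GD FD big_cons.
have -> : (fun y => \sum_(i0 <- i :: r) f i0 y) =
    (fun y => f i y + \sum_(i0 <- r) f i0 y).
  by apply/funext => y; rewrite big_cons.
exact: is_diff_add.
Qed.

Lemma has_der_pow f x D a : bpos (f x) -> has_der f x D ->
  has_der (fun y => bpow a (f y)) x (fun u t => a * f x t `^ (a - 1) * D u t).
Proof.
move=> pf [F dF FD]; have bB := @bmul_bilinear R d T a.
exists (bil_comp_r (fun k h => a *: bmul k h) (bpow (a - 1) (f x)) F).
  exact: is_diff_bpow.
by move=> u t; rewrite bil_comp_rE// bmfZ bmulE bpowE// FD mulrA.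
Qed.

Lemma has_der_near_pos f x D : has_der f x D -> bpos (f x) ->
  \forall y \near x, bpos (f y).
Proof.
move=> [F [df _] _] /bpos_near[r r0 Hr].
have : f y @[y --> x] --> f x by exact: differentiable_continuous.
move=> /cvgrPdist_lt /(_ _ r0); apply: filterS => y.
by rewrite distrC; exact: Hr.
Qed.

End Rules.

Section Maps.
Context {R : realType} (m : nat) (s : R).
Local Notation Z := (measurableTypeR R * measurableTypeR R)%type.
Local Notation bm := (@bmf R _ Z).
Local Notation H := (sobolev m s).
Implicit Types (u v : H) (i j : 'I_m) (z : Z).
Hypothesis hs : 3 / 2 < s.

(** A linear family of functions whose values are values of derivatives of
    components is bounded for the supremum norm, by the embedding into C^1. *)
Let bounded_map (f : H -> Z -> R) : (forall u, measurable_fun setT (f u)) ->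
  (forall a u v z, f (a *: u + v) z = a * f u z + f v z) ->
  (forall u z, exists i t, f u z = der_coord u i t) ->
  forall u z, (toblin (fun u => tobmf (f u)) : blin H bm) u z = f u z.
Proof.
move=> mf lf fd; have [C C0 HC] := @sobolev_C1_bound R m s hs.
have fC u z : `|f u z| <= C * `|u| by have [i [t ->]] := fd u z; exact: HC.
have E u : tobmf (f u) = f u :> (Z -> R) by exact: (tobmfE (mf u) (fC u)).
move=> u z; rewrite toblinE ?E//.
  by move=> a v w; apply: bmfP => t; rewrite bmfD bmfZ !E lf.
exists C => v; apply: bmf_ler_norm => [|t]; first exact: mulr_ge0.
by rewrite E.
Qed.

Lemma chord_map_subproof i : {L : blin H bm | forall u z, L u z = chord u i z}.
Proof.
exists (toblin (fun u => tobmf (chord u i))) => u z.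
apply: (bounded_map (f := fun u => chord u i)).
- by move=> v; exact: measurable_chord.
- by move=> *; rewrite /chord slope_linear.
- by move=> v t; have [t' _ e] := slope_MVT v i t.1 (sdist (t.2 - t.1)); exists i, t'.
Qed.

Lemma der1_map_subproof i : {L : blin H bm | forall u z, L u z = der_coord u i z.1}.
Proof.
exists (toblin (fun u => tobmf (fun z : Z => der_coord u i z.1))) => u z.
apply: (bounded_map (f := fun u z => der_coord u i z.1)).
- by move=> v; apply: (measurableT_comp (measurable_der_coord v i)).
- by move=> *; rewrite der_coord_linear.
- by move=> v t; exists i, t.1.
Qed.

Lemma der2_map_subproof i : {L : blin H bm | forall u z, L u z = der_coord u i z.2}.
Proof.
exists (toblin (fun u => tobmf (fun z : Z => der_coord u i z.2))) => u z.
apply: (bounded_map (f := fun u z => der_coord u i z.2)).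
- by move=> v; apply: (measurableT_comp (measurable_der_coord v i)).
- by move=> *; rewrite der_coord_linear.
- by move=> v t; exists i, t.2.
Qed.

Definition chord_map i : blin H bm := sval (chord_map_subproof i).
Definition der1_map i : blin H bm := sval (der1_map_subproof i).
Definition der2_map i : blin H bm := sval (der2_map_subproof i).

Lemma chord_mapE i u z : chord_map i u z = chord u i z.
Proof. exact: (svalP (chord_map_subproof i)). Qed.

Lemma der1_mapE i u z : der1_map i u z = der_coord u i z.1.
Proof. exact: (svalP (der1_map_subproof i)). Qed.

Lemma der2_mapE i u z : der2_map i u z = der_coord u i z.2.
Proof. exact: (svalP (der2_map_subproof i)). Qed.

Definition sqlen (L : 'I_m -> blin H bm) u : bm := \sum_i bmul (L i u) (L i u).

Lemma sqlenE L u z : sqlen L u z = \sum_i L i u z * L i u z.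
Proof. by rewrite bmf_sum; apply: eq_bigr => i _; rewrite bmulE. Qed.

Lemma sqlen_has_der L u :
  has_der (sqlen L) u (fun v z => 2 * \sum_i L i u z * L i v z).
Proof.
have := has_der_sum (index_enum _) (fun i => has_derM (has_der_lin (L i) u) (has_der_lin (L i) u)).
apply: eq_has_der => // v z; rewrite mulr_sumr; apply: eq_bigr => i _; ring.
Qed.

Lemma sqlen_diff_times L U n : diff_times U n (sqlen L).
Proof.
apply: diff_times_sum => i.
by apply: (diff_times_bil (@bmul_bilinear1 R _ Z)); exact: diff_times_lin.
Qed.

(** The open set of curves that contains the embeddings and on which all the
    powers in the energy density are smooth. *)
Definition regular u : Prop :=
  [/\ bpos (sqlen chord_map u), bpos (sqlen der1_map u) & bpos (sqlen der2_map u)].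

Lemma embedding_regular u : embedding u -> regular u.
Proof.
move=> /embedding_slope_lower_bound[c c0 Hc].
have dc x : c <= \sum_i der_coord u i x ^+ 2.
  have := Hc x 0; rewrite normr0 => /(_ _); under eq_bigr do rewrite /slope eqxx.
  by apply; lra.
split; exists c => // z; rewrite sqlenE.
- under eq_bigr do rewrite chord_mapE -expr2; apply: Hc; exact: norm_sdist_le.
- by under eq_bigr do rewrite der1_mapE -expr2; exact: dc.
- by under eq_bigr do rewrite der2_mapE -expr2; exact: dc.
Qed.

Lemma regular_near u : regular u -> \forall v \near u, regular v.
Proof.
move=> [p1 p2 p3].
have n1 := has_der_near_pos (sqlen_has_der chord_map u) p1.
have n2 := has_der_near_pos (sqlen_has_der der1_map u) p2.
have n3 := has_der_near_pos (sqlen_has_der der2_map u) p3.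
by apply: filterS3 n1 n2 n3 => v; split.
Qed.

(** |q|^(-(2s+1)) |g'(x)|^(-1) |g'(y)|, the coefficient that remains when the
    energy density is written in terms of normalized remainders. *)
Definition weight u : bm :=
  bmul (bmul (bpow (- (2 * s + 1) / 2) (sqlen chord_map u)) (bpow (- (1 / 2)) (sqlen der1_map u)))
    (bpow (1 / 2) (sqlen der2_map u)).

Lemma weightE u z : regular u -> weight u z =
  sqlen chord_map u z `^ (- (2 * s + 1) / 2) * sqlen der1_map u z `^ (- (1 / 2)) *
    sqlen der2_map u z `^ (1 / 2).
Proof.
move=> [p1 p2 p3]; apply: (eq_trans (bmulE _ _ z)).
rewrite (bpowE _ z p3); congr (_ * _); apply: (eq_trans (bmulE _ _ z)).
by rewrite (bpowE _ z p1) (bpowE _ z p2).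
Qed.

Definition pkernel i j u : bm := bmul (weight u) (bmul (der1_map i u) (der1_map j u)).

Lemma pkernelE i j u z : pkernel i j u z = weight u z * (der_coord u i z.1 * der_coord u j z.1).
Proof. by rewrite bmulE (bmulE (der1_map i u)) (der1_mapE i) (der1_mapE j). Qed.

Lemma pkernel_diff_times U n i j : (forall u, U u -> regular u) -> diff_times U n (pkernel i j).
Proof.
move=> reg; have bB := @bmul_bilinear1 R _ Z.
apply: (diff_times_bil bB); last first.
  by apply: (diff_times_bil bB); exact: diff_times_lin.
apply: (diff_times_bil bB).
  apply: (diff_times_bil bB).
    by apply: diff_times_bpow; [move=> u /reg[]|exact: sqlen_diff_times].
  by apply: diff_times_bpow; [move=> u /reg[]|exact: sqlen_diff_times].
by apply: diff_times_bpow; [move=> u /reg[]|exact: sqlen_diff_times].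
Qed.

(** Logarithmic derivative of the weight at u in the direction v. *)
Definition weight_der u v z : R :=
  - (2 * s + 1) * (\sum_i chord u i z * chord v i z) / sqlen chord_map u z
  - (\sum_i der_coord u i z.1 * der_coord v i z.1) / sqlen der1_map u z
  + (\sum_i der_coord u i z.2 * der_coord v i z.2) / sqlen der2_map u z.

Lemma powR_sub1 (a t : R) : 0 < t -> t `^ (a - 1) = t `^ a / t.
Proof. by move=> t0; rewrite powRB ?(gt_eqF t0) ?implybT// powRr1// ltW. Qed.

Lemma bpos_gt0 (f : bm) z : bpos f -> 0 < f z.
Proof. by move=> [c c0 cf]; exact: lt_le_trans (cf z). Qed.

Lemma weight_has_der u : regular u ->
  has_der weight u (fun v z => weight u z * weight_der u v z).
Proof.
move=> reg; have [p1 p2 p3] := reg.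
have d1 := has_der_pow (- (2 * s + 1) / 2) p1 (sqlen_has_der chord_map u).
have d2 := has_der_pow (- (1 / 2)) p2 (sqlen_has_der der1_map u).
have d3 := has_der_pow (1 / 2) p3 (sqlen_has_der der2_map u).
apply: eq_has_der (has_derM (has_derM d1 d2) d3) => // v z.
have q0 := bpos_gt0 z p1; have a0 := bpos_gt0 z p2; have b0 := bpos_gt0 z p3.
have e1 : \sum_i chord_map i u z * chord_map i v z = \sum_i chord u i z * chord v i z.
  by apply: eq_bigr => i _; rewrite (chord_mapE i u z) (chord_mapE i v z).
have e2 : \sum_i der1_map i u z * der1_map i v z =
    \sum_i der_coord u i z.1 * der_coord v i z.1.
  by apply: eq_bigr => i _; rewrite (der1_mapE i u z) (der1_mapE i v z).
have e3 : \sum_i der2_map i u z * der2_map i v z =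
    \sum_i der_coord u i z.2 * der_coord v i z.2.
  by apply: eq_bigr => i _; rewrite (der2_mapE i u z) (der2_mapE i v z).
rewrite [in LHS](bmulE (bpow _ (sqlen chord_map u))) (weightE z reg).
rewrite (bpowE _ z p1) (bpowE _ z p2) (bpowE _ z p3) e1 e2 e3 /weight_der.
rewrite (powR_sub1 _ q0) (powR_sub1 _ a0) (powR_sub1 _ b0).
move: (sqlen chord_map u z) (sqlen der1_map u z) (sqlen der2_map u z) q0 a0 b0.
move=> q a b q0 a0 b0.
move: (q `^ _) (a `^ _) (b `^ _) (\sum_i _) (\sum_i _) (\sum_i _) => Q A B X Y W.
by field; rewrite ?gt_eqF.
Qed.

Lemma pkernel_has_der i j u : regular u ->
  has_der (pkernel i j) u (fun v z => weight u z *
    (weight_der u v z * (der_coord u i z.1 * der_coord u j z.1) +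
     (der_coord v i z.1 * der_coord u j z.1 + der_coord u i z.1 * der_coord v j z.1))).
Proof.
move=> reg.
have dd := has_derM (has_der_lin (der1_map i) u) (has_der_lin (der1_map j) u).
apply: eq_has_der (has_derM (weight_has_der reg) dd) => // v z.
rewrite (bmulE (der1_map i u)) (der1_mapE i u z) (der1_mapE j u z).
by rewrite (der1_mapE i v z) (der1_mapE j v z); ring.
Qed.

End Maps.

(** * The densities in terms of normalized remainders *)

Section Pointwise.
Context {R : realType} (m : nat) (s : R).
Local Notation Z := (measurableTypeR R * measurableTypeR R)%type.
Local Notation H := (sobolev m s).
Implicit Types (g u v : H) (i j : 'I_m) (z : Z).

(** The powers of h cancel: -2 s from the two remainders, 2 s + 1 from their
    normalization and -1 from the measure. *)
Lemma normalization (h q a b : R) : 0 < h -> 0 < q -> 0 < a -> 0 < b ->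
  ((h * Num.sqrt q) `^ s)^-1 ^+ 2 * (h `^ (s + 1 / 2)) ^+ 2 *
    (Num.sqrt b * Num.sqrt a / (h * Num.sqrt q)) =
  q `^ (- (2 * s + 1) / 2) * a `^ (- (1 / 2)) * b `^ (1 / 2) * a.
Proof.
move=> h0 q0 a0 b0.
have sq0 : 0 < Num.sqrt q by rewrite sqrtr_gt0.
have sa0 : 0 < Num.sqrt a by rewrite sqrtr_gt0.
have sh0 : 0 < Num.sqrt h by rewrite sqrtr_gt0.
have half t : 0 < t -> t `^ (1 / 2) = Num.sqrt t.
  by move=> t0; rewrite div1r powR12_sqrt// ltW.
have e1 : (h * Num.sqrt q) `^ s = h `^ s * Num.sqrt q `^ s by rewrite powRM// ltW.
have e2 : h `^ (s + 1 / 2) = h `^ s * Num.sqrt h.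
  by rewrite powRD ?(gt_eqF h0) ?implybT// half.
have e3 : q `^ (- (2 * s + 1) / 2) = (Num.sqrt q `^ s ^+ 2 * Num.sqrt q)^-1.
  rewrite (_ : - (2 * s + 1) / 2 = - (1 / 2 * (s * 2 + 1))); last by field.
  rewrite powRN powRrM half//; congr (_^-1).
  rewrite powRD ?(gt_eqF sq0) ?implybT// powRr1 ?ltW//; congr (_ * _).
  by rewrite powRrM powR_mulrn// powR_ge0.
have e4 : a `^ (- (1 / 2)) * a = Num.sqrt a.
  rewrite powRN half// -{2}(sqr_sqrtr (ltW a0)) expr2 mulKf// gt_eqF//.
rewrite e1 e2 e3 half// [RHS]mulrAC -[X in _ = X * _]mulrA e4.
have eh : Num.sqrt h ^+ 2 = h by rewrite sqr_sqrtr// ltW.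
have hs0 : 0 < h `^ s by exact: powR_gt0.
have qs0 : 0 < Num.sqrt q `^ s by exact: powR_gt0.
rewrite exprMn eh; move: (h `^ s) (Num.sqrt q `^ s) hs0 qs0 => hs qs hs0 qs0.
move: (Num.sqrt q) (Num.sqrt a) (Num.sqrt b) sq0 => rq ra rb rq0.
by field; rewrite ?gt_eqF.
Qed.

Hypothesis hs : 3 / 2 < s.
Local Notation Q g z := (sqlen (chord_map hs) g z).
Local Notation A g z := (sqlen (der1_map hs) g z).
Local Notation S g z := (sqlen (der2_map hs) g z).

Lemma sqlen_chordE g z : Q g z = \sum_i chord g i z * chord g i z.
Proof. by rewrite sqlenE; apply: eq_bigr => i _; rewrite (chord_mapE hs i g z). Qed.

Lemma sqlen_der1E g z : A g z = \sum_i der_coord g i z.1 * der_coord g i z.1.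
Proof. by rewrite sqlenE; apply: eq_bigr => i _; rewrite (der1_mapE hs i g z). Qed.

Lemma sqlen_der2E g z : S g z = \sum_i der_coord g i z.2 * der_coord g i z.2.
Proof. by rewrite sqlenE; apply: eq_bigr => i _; rewrite (der2_mapE hs i g z). Qed.

Lemma regular_gt0 g z : regular hs g -> [/\ 0 < Q g z, 0 < A g z & 0 < S g z].
Proof. by move=> [p1 p2 p3]; split; exact: bpos_gt0. Qed.

Lemma dotv_chord g z :
  dotv (g z.2 - g z.1) (g z.2 - g z.1) = sdist (z.2 - z.1) ^+ 2 * Q g z.
Proof.
rewrite sqlen_chordE mulr_sumr; apply: eq_bigr => i _.
by rewrite !mxE -[g z.2 i 0 - _]/(pos_coord g i z.2 - pos_coord g i z.1) chordE; ring.
Qed.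

Lemma enorm_chord g z :
  enorm (g z.2 - g z.1) = `|sdist (z.2 - z.1)| * Num.sqrt (Q g z).
Proof. by rewrite /enorm dotv_chord sqrtrM ?sqr_ge0// sqrtr_sqr. Qed.

Lemma enorm_der1 g z : enorm (derive1 g z.1) = Num.sqrt (A g z).
Proof. by rewrite /enorm sqlen_der1E. Qed.

Lemma enorm_der2 g z : enorm (derive1 g z.2) = Num.sqrt (S g z).
Proof. by rewrite /enorm sqlen_der2E. Qed.

(** The coefficient of g'(x) in the projection of the normalized remainder of g
    onto the tangent. *)
Definition tangential g z : R :=
  (\sum_i der_coord g i z.1 * nrem_coord g i z) / A g z.

(** What is left of the remainder of u in the density of B1; for u = g it is the
    component of the remainder of g normal to the curve. *)
Definition normal_part g u i z : R := nrem_coord u i z - der_coord u i z.1 * tangential g z.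

Lemma rem_nrem u i z :
  rem_coord u i z = `|sdist (z.2 - z.1)| `^ (s + 1 / 2) * nrem_coord u i z.
Proof.
rewrite /nrem_coord; have [h0|h0] := eqVneq (sdist (z.2 - z.1)) 0.
  by rewrite rem_coordE h0 !(mul0r, mulr0).
by rewrite mulrC divfK// gt_eqF// powR_gt0// normr_gt0.
Qed.

(** Replacing u(y) - u(x) by h u'(x) plus the remainder of u, and likewise for g,
    the terms h u'(x) cancel. *)
Lemma remainder_coord g u i z : regular hs g ->
  remainder s g u z.1 z.2 i 0 = (enorm (g z.2 - g z.1) `^ s)^-1 *
    (`|sdist (z.2 - z.1)| `^ (s + 1 / 2) * normal_part g u i z).
Proof.
move=> /(regular_gt0 z)[_ A0 _]; rewrite /remainder mxE; congr (_ * _).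
rewrite !mxE -[u z.2 i 0 - _]/(pos_coord u i z.2 - pos_coord u i z.1) chordE.
set h := sdist _.
have -> : \sum_j Defs.tanD g u z.1 i j * (g z.2 - g z.1) j 0 =
    (A g z)^-1 * der_coord u i z.1 * (\sum_j der_coord g j z.1 * (h * chord g j z)).
  rewrite mulr_sumr; apply: eq_bigr => j _; rewrite !mxE big_ord1 [ord0]ord1 !mxE enorm_der1.
  rewrite sqr_sqrtr ?(ltW A0)// -[g z.2 j 0 - _]/(pos_coord g j z.2 - pos_coord g j z.1).
  by rewrite chordE /der_coord -/h; ring.
have -> : \sum_j der_coord g j z.1 * (h * chord g j z) =
    `|h| `^ (s + 1 / 2) * (\sum_j der_coord g j z.1 * nrem_coord g j z) + h * A g z.
  rewrite sqlen_der1E !mulr_sumr -big_split/=; apply: eq_bigr => j _.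
  have e := rem_nrem g j z; rewrite rem_coordE -/h in e.
  by rewrite [X in _ = X + _]mulrCA -e; ring.
rewrite /normal_part mulrBr -rem_nrem rem_coordE -/h /tangential.
by field; rewrite gt_eqF.
Qed.

(** On the diagonal, where the distance vanishes, both sides are zero because the
    normalized remainders are. *)
Lemma B1_densityE g u v z : regular hs g ->
  B1_density s g u v z.1 z.2 * mu_density g z.1 z.2 =
  weight hs g z * A g z * \sum_i normal_part g u i z * normal_part g v i z.
Proof.
move=> reg; have [Q0 A0 S0] := regular_gt0 z reg.
pose h : R := `|sdist (z.2 - z.1)|.
pose P := ((h * Num.sqrt (Q g z)) `^ s)^-1; pose K := h `^ (s + 1 / 2).
pose N := \sum_i normal_part g u i z * normal_part g v i z.
have e (w : H) i : remainder s g w z.1 z.2 i 0 = P * (K * normal_part g w i z).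
  by rewrite (remainder_coord w i z reg) enorm_chord.
have eB : B1_density s g u v z.1 z.2 = P ^+ 2 * K ^+ 2 * N.
  rewrite /N mulr_sumr; apply: eq_bigr => i _.
  by apply: (eq_trans (congr2 *%R (e u i) (e v i))); ring.
have eM : mu_density g z.1 z.2 = Num.sqrt (S g z) * Num.sqrt (A g z) / (h * Num.sqrt (Q g z)).
  by rewrite /mu_density enorm_der1 enorm_der2 enorm_chord.
rewrite eB eM mulrAC -/N.
have [h0|h0] := eqVneq (sdist (z.2 - z.1)) 0; last first.
  have hp : 0 < h by rewrite normr_gt0.
  by rewrite (normalization hp Q0 A0 S0) (weightE z reg).
have n0 w i : nrem_coord w i z = 0 by rewrite /nrem_coord rem_coordE h0 !mul0r.
have t0 : tangential g z = 0.
  by rewrite /tangential big1 ?mul0r// => i _; rewrite n0 mulr0.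
have -> : N = 0.
  by rewrite /N big1// => i _; rewrite /normal_part !n0 t0 mulr0 subrr mul0r.
by rewrite !mulr0.
Qed.

Lemma tp_densityE g x y : tp_density s g x y = B1_density s g g g x y.
Proof. by rewrite /tp_density enorm_sqr. Qed.

Lemma dotv_arcD g u v x : dotv (arcD g u x) (arcD g v x) =
  (\sum_i der_coord u i x * der_coord v i x) / enorm (derive1 g x) ^+ 2.
Proof.
rewrite /dotv mulr_suml; apply: eq_bigr => i _; rewrite !mxE /der_coord.
move: (enorm _) (derive1 u x i 0) (derive1 v x i 0) => e a b.
by rewrite expr2 invfM; ring.
Qed.

Lemma B3_densityE g u v z :
  B3_density s g u v z.1 z.2 * mu_density g z.1 z.2 =
  tp_density s g z.1 z.2 * mu_density g z.1 z.2 *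
  ((\sum_i der_coord u i z.1 * der_coord v i z.1) / A g z +
   (\sum_i der_coord u i z.2 * der_coord v i z.2) / S g z).
Proof.
have e1 : enorm (derive1 g z.1) ^+ 2 = A g z by rewrite enorm_sqr sqlen_der1E.
have e2 : enorm (derive1 g z.2) ^+ 2 = S g z by rewrite enorm_sqr sqlen_der2E.
apply: (eq_trans (mulrAC _ _ _)).
apply: (congr2 (fun a b => tp_density s g z.1 z.2 * mu_density g z.1 z.2 * (a + b))).
  exact: (eq_trans (dotv_arcD g u v z.1) (congr1 (fun a => _ / a) e1)).
exact: (eq_trans (dotv_arcD g u v z.2) (congr1 (fun a => _ / a) e2)).
Qed.

Lemma dotv_diffquot g u v z : sdist (z.2 - z.1) != 0 ->
  dotv (diffquot g u z.1 z.2) (diffquot g v z.1 z.2) =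
  (\sum_i chord u i z * chord v i z) / Q g z.
Proof.
move=> h0; have eQ : enorm (g z.2 - g z.1) ^+ 2 = sdist (z.2 - z.1) ^+ 2 * Q g z.
  by rewrite enorm_sqr dotv_chord.
transitivity (\sum_i (pos_coord u i z.2 - pos_coord u i z.1) *
    (pos_coord v i z.2 - pos_coord v i z.1) / enorm (g z.2 - g z.1) ^+ 2).
  apply: eq_bigr => i _; rewrite !mxE /pos_coord.
  move: (enorm _) (u z.2 i 0) (u z.1 i 0) (v z.2 i 0) (v z.1 i 0) => e a b c d.
  by rewrite expr2 invfM; ring.
rewrite eQ invfM mulr_suml; apply: eq_bigr => i _; rewrite (chordE u) (chordE v).
move: (sdist _) (Q g z)^-1 (chord u i z) (chord v i z) h0 => h q a b h0.
by field.
Qed.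

Lemma B2_densityE g u v z :
  B2_density s g u v z.1 z.2 * mu_density g z.1 z.2 =
  tp_density s g z.1 z.2 * mu_density g z.1 z.2 *
  ((\sum_i chord u i z * chord v i z) / Q g z).
Proof.
rewrite /B2_density; have [h0|h0] := eqVneq (sdist (z.2 - z.1)) 0.
  suff -> : mu_density g z.1 z.2 = 0 by rewrite !(mulr0, mul0r).
  by rewrite /mu_density enorm_chord h0 normr0 mul0r invr0 mulr0.
apply: (eq_trans (mulrAC _ _ _)); congr (_ * _); exact: dotv_diffquot.
Qed.

End Pointwise.

(** * The energy as a sum of trilinear forms *)

Section DirectionalDerivatives.
Context {R : realType} (V : normedModType R).
Implicit Types (f g : V -> R) (x u : V).

Definition has_dir f x (D : V -> R) : Prop :=
  exists2 F : blin V R, is_diff x f F & forall u, F u = D u.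

Lemma has_dirB f g x D E : has_dir f x D -> has_dir g x E ->
  has_dir (fun y => f y - g y) x (fun u => D u - E u).
Proof.
move=> [F dF FD] [G dG GE]; exists (F - G) => [|u]; last by rewrite -FD -GE.
exact: (is_diffB dF dG).
Qed.

Lemma has_dir_sum I (r : seq I) (f : I -> V -> R) x (D : I -> V -> R) :
  (forall i, has_dir (f i) x (D i)) ->
  has_dir (fun y => \sum_(i <- r) f i y) x (fun u => \sum_(i <- r) D i u).
Proof.
move=> fD; elim: r => [|i r [F dF FD]].
  exists 0 => [|u]; last by rewrite big_nil.
  have -> : (fun y => \sum_(i <- [::]) f i y) = cst 0.
    by apply/funext => y; rewrite big_nil.
  exact: is_diff_cst.
have [G dG GD] := fD i; exists (G + F) => [|u]; last by rewrite blinD GD FD big_cons.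
have -> : (fun y => \sum_(i0 <- i :: r) f i0 y) =
    (fun y => f i y + \sum_(i0 <- r) f i0 y).
  by apply/funext => y; rewrite big_cons.
exact: is_diff_add.
Qed.

Lemma scale_bilinear : bounded_bilinear (fun (a : R) (b : R) => a * b).
Proof.
split=> [v a b c|a b c d|]; rewrite /GRing.scale/=; [ring|ring|].
by exists 1 => // a b; rewrite mul1r normrM.
Qed.

Lemma diff_timesB (U : set V) n f g :
  diff_times U n f -> diff_times U n g -> diff_times U n (fun x => f x - g x).
Proof.
move=> df dg; have dN := diff_times_bil scale_bilinear (diff_times_cst U n (-1 : R)) dg.
apply: eq_diff_times (diff_times_add df dN) => x; by rewrite mulN1r.
Qed.

Lemma id_linear_bound : linear (@id V) /\ exists C, forall x : V, `|id x| <= C * `|x|.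
Proof. by split=> //; exists 1 => x; rewrite mul1r. Qed.

Definition blin_id : blin V V := toblin id.

Lemma blin_idE x : blin_id x = x.
Proof. by have [l b] := id_linear_bound; rewrite /blin_id (toblinE l b). Qed.

Lemma blin_id_fun : blin_id = id :> (V -> V).
Proof. by apply/funext => x; exact: blin_idE. Qed.

End DirectionalDerivatives.

Section Energy.
Context {R : realType} (m : nat) (s : R) (hs : 3 / 2 < s).
Local Notation Z := (measurableTypeR R * measurableTypeR R)%type.
Local Notation bm := (@bmf R _ Z).
Local Notation H := (sobolev m s).
Local Notation Q g z := (sqlen (chord_map hs) g z).
Local Notation A g z := (sqlen (der1_map hs) g z).
Local Notation S g z := (sqlen (der2_map hs) g z).
Implicit Types (g u v : H) (i j : 'I_m) (z : Z).

Lemma l2form_diff_times (U : set H) n i j (k : H -> bm) :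
  diff_times U n k -> diff_times U n (fun u => l2form i j (k u) u u).
Proof.
move=> dk; have did := diff_times_lin U n (blin_id H).
have d1 := diff_times_bil (l2form_map_bilinear hs i j) dk did.
have d2 := diff_times_bil (blin_app_bil H R) d1 did.
apply: eq_diff_times d2 => u; by rewrite blin_idE l2form_mapE.
Qed.

Lemma l2form_has_dir i j (k : H -> bm) g (D : H -> Z -> R) : has_der k g D ->
  has_dir (fun u => l2form i j (k u) u u) g
    (fun u => Int (fun z => D u z * (nrem_coord g i z * nrem_coord g j z) +
      k g z * (nrem_coord u i z * nrem_coord g j z) +
      k g z * (nrem_coord g i z * nrem_coord u j z))) /\
  forall u, L1 (fun z => D u z * (nrem_coord g i z * nrem_coord g j z) +
      k g z * (nrem_coord u i z * nrem_coord g j z) +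
      k g z * (nrem_coord g i z * nrem_coord u j z)).
Proof.
move=> [K dK KD].
have DE u : D u = K u by apply/funext => z; rewrite KD.
have LK u := l2form_L1 hs i j (K u) g g.
have Lk1 u := l2form_L1 hs i j (k g) u g; have Lk2 u := l2form_L1 hs i j (k g) g u.
split=> [|u]; last by rewrite DE; apply: L1D (L1D (LK u) (Lk1 u)) (Lk2 u).
suff [F dF FE] : has_dir (fun u => l2form i j (k u) u u) g
    (fun u => l2form i j (K u) g g + l2form i j (k g) u g + l2form i j (k g) g u).
  exists F => // u; rewrite FE DE.
  by rewrite (IntD (L1D (LK u) (Lk1 u)) (Lk2 u)) (IntD (LK u) (Lk1 u)).
have did : is_diff g (@id H) (blin_id H) by rewrite -{1}(blin_id_fun H); exact: is_diff_lin.
have bB := l2form_map_bilinear hs i j.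
have d1 := is_diff_bil bB dK did.
have d2 := is_diff_bil (blin_app_bil H R) d1 did.
have -> : (fun u => l2form i j (k u) u u) =
    (fun u => (l2form_map i j (k u) u : blin H R) u).
  by apply/funext => u; rewrite l2form_mapE.
eexists; first exact: d2.
move=> u; have bA := blin_app_bil H R.
have e1 : (bil_comp_l (l2form_map i j) K g + bil_comp_r (l2form_map i j) (k g) (blin_id H)
     : blin H (blin H R)) u = l2form_map i j (K u) g + l2form_map i j (k g) u.
  apply: (congr2 (fun a b : blin H R => a + b)); first exact: (bil_comp_lE K g u bB).
  exact: (eq_trans (bil_comp_rE (k g) (blin_id H) u bB) (congr1 _ (blin_idE u))).
apply: (congr2 (fun a b => a + b)).
  apply: (eq_trans (bil_comp_lE _ g u bA)).
  apply: (eq_trans (congr1 (fun f : blin H R => f g) e1)).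
  exact: (congr2 (fun a b => a + b) (l2form_mapE hs _ _ _ _ _) (l2form_mapE hs _ _ _ _ _)).
apply: (eq_trans (bil_comp_rE _ (blin_id H) u bA)).
by apply: (eq_trans (l2form_mapE hs _ _ _ _ _)); rewrite blin_idE.
Qed.

(** The energy density |t|^2 |n|^2 - <t, n>^2, times the weight, expanded over
    pairs of components: each term is a trilinear form with a smooth
    coefficient. *)
Definition model_energy u : R :=
  \sum_i \sum_j (l2form i i (pkernel hs j j u) u u - l2form i j (pkernel hs i j u) u u).

Lemma model_energy_smooth (U : set H) :
  (forall u, U u -> regular hs u) -> smooth_on U model_energy.
Proof.
move=> reg n; apply: diff_times_sum => i; apply: diff_times_sum => j.
by apply: diff_timesB; apply: l2form_diff_times; exact: pkernel_diff_times.
Qed.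

Definition energy_density g z : R :=
  \sum_i \sum_j (pkernel hs j j g z * (nrem_coord g i z * nrem_coord g i z) -
    pkernel hs i j g z * (nrem_coord g i z * nrem_coord g j z)).

Definition energy_density_der g u z : R := \sum_i \sum_j
  (weight hs g z * (weight_der hs g u z * (der_coord g j z.1 * der_coord g j z.1) +
     (der_coord u j z.1 * der_coord g j z.1 + der_coord g j z.1 * der_coord u j z.1)) *
     (nrem_coord g i z * nrem_coord g i z) +
   pkernel hs j j g z * (nrem_coord u i z * nrem_coord g i z) +
   pkernel hs j j g z * (nrem_coord g i z * nrem_coord u i z) -
   (weight hs g z * (weight_der hs g u z * (der_coord g i z.1 * der_coord g j z.1) +
     (der_coord u i z.1 * der_coord g j z.1 + der_coord g i z.1 * der_coord u j z.1)) *
     (nrem_coord g i z * nrem_coord g j z) +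
   pkernel hs i j g z * (nrem_coord u i z * nrem_coord g j z) +
   pkernel hs i j g z * (nrem_coord g i z * nrem_coord u j z))).

Lemma energy_density_L1 g : L1 (energy_density g).
Proof. by do 2 (apply: L1_sum => ?); apply: L1B; exact: l2form_L1. Qed.

Lemma model_energyE g : model_energy g = Int (energy_density g).
Proof.
have LB i j : L1 (fun z => pkernel hs j j g z * (nrem_coord g i z * nrem_coord g i z) -
    pkernel hs i j g z * (nrem_coord g i z * nrem_coord g j z)).
  by apply: L1B; exact: l2form_L1.
rewrite /energy_density Int_sum => [|i]; last exact: L1_sum.
apply: eq_bigr => i _; rewrite Int_sum//; apply: eq_bigr => j _.
by rewrite IntB//; exact: l2form_L1.
Qed.

Lemma model_energy_has_dir g : regular hs g ->
  has_dir model_energy g (fun u => Int (energy_density_der g u)) /\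
  forall u, L1 (energy_density_der g u).
Proof.
move=> reg.
have H1 i j := l2form_has_dir i j (pkernel_has_der i j reg).
have H2 i j := l2form_has_dir i i (pkernel_has_der j j reg).
have LB u i j := L1B ((H2 i j).2 u) ((H1 i j).2 u).
have LS u i := L1_sum (index_enum _) (LB u i).
split=> [|u]; last exact: (L1_sum _ (LS u)).
have D := has_dir_sum (index_enum _)
  (fun i => has_dir_sum (index_enum _) (fun j => has_dirB (H2 i j).1 (H1 i j).1)).
have [F dF FE] := D; exists F => // u; rewrite FE.
rewrite (Int_sum _ (LS u)); apply: eq_bigr => i _.
rewrite (Int_sum _ (LB u i)); apply: eq_bigr => j _.
by rewrite (IntB ((H2 i j).2 u) ((H1 i j).2 u)).
Qed.

End Energy.

(** * First variation *)

Section Sums.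
Context {R : realFieldType} (m : nat).
Implicit Types (a b c d n t nu tu : 'I_m -> R) (w k l : R).

Lemma double_sum w a b : \sum_i \sum_j w * (a i * b j) = w * ((\sum_i a i) * (\sum_j b j)).
Proof.
rewrite big_distrl mulr_sumr; apply: eq_bigr => i _ /=.
by rewrite mulr_sumr mulr_sumr.
Qed.

Lemma dot_expand a b c d k : \sum_i (a i - b i * k) * (c i - d i * k) =
  \sum_i a i * c i - k * \sum_i a i * d i - k * \sum_i b i * c i + k ^+ 2 * \sum_i b i * d i.
Proof.
rewrite !mulr_sumr -!sumrB -big_split/=; apply: eq_bigr => i _; ring.
Qed.

Lemma energy_sum w n t : \sum_i \sum_j (w * (t j * t j) * (n i * n i) - w * (t i * t j) * (n i * n j)) =
  w * ((\sum_i n i * n i) * (\sum_i t i * t i) - (\sum_i t i * n i) ^+ 2).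
Proof.
transitivity (\sum_i \sum_j (w * ((n i * n i) * (t j * t j)) + (- w) * ((t i * n i) * (t j * n j)))).
  by apply: eq_bigr => i _; apply: eq_bigr => j _; ring.
under eq_bigr do rewrite big_split/=; rewrite big_split/= !double_sum; ring.
Qed.

Lemma energy_der_sum w l n t nu tu : \sum_i \sum_j
  (w * (l * (t j * t j) + (tu j * t j + t j * tu j)) * (n i * n i) +
   w * (t j * t j) * (nu i * n i) + w * (t j * t j) * (n i * nu i) -
   (w * (l * (t i * t j) + (tu i * t j + t i * tu j)) * (n i * n j) +
   w * (t i * t j) * (nu i * n j) + w * (t i * t j) * (n i * nu j))) =
  w * (l * ((\sum_i n i * n i) * (\sum_i t i * t i) - (\sum_i t i * n i) ^+ 2) +
     2 * (\sum_i n i * n i) * (\sum_i t i * tu i) + 2 * (\sum_i n i * nu i) * (\sum_i t i * t i)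
     - 2 * (\sum_i t i * n i) * (\sum_i n i * tu i) - 2 * (\sum_i t i * n i) * (\sum_i t i * nu i)).
Proof.
transitivity (\sum_i \sum_j (w * l * ((n i * n i) * (t j * t j)) +
  (2 * w) * ((n i * n i) * (t j * tu j)) + (2 * w) * ((n i * nu i) * (t j * t j)) +
  (- (w * l)) * ((t i * n i) * (t j * n j)) + (- w) * ((n i * tu i) * (t j * n j)) +
  (- w) * ((t i * n i) * (n j * tu j)) + (- w) * ((t i * nu i) * (t j * n j)) +
  (- w) * ((t i * n i) * (t j * nu j)))).
  by apply: eq_bigr => i _; apply: eq_bigr => j _; ring.
under eq_bigr do rewrite !big_split/=; rewrite !big_split/= !double_sum.
move: (\sum_i n i * n i) (\sum_i t i * t i) (\sum_i t i * tu i) (\sum_i n i * nu i)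
  (\sum_i t i * n i) (\sum_i n i * tu i) (\sum_i t i * nu i) => *; ring.
Qed.

End Sums.

Section FirstVariation.
Context {R : realType} (m : nat) (s : R) (hs : 3 / 2 < s).
Local Notation Z := (measurableTypeR R * measurableTypeR R)%type.
Local Notation bm := (@bmf R _ Z).
Local Notation H := (sobolev m s).
Local Notation Q g z := (sqlen (chord_map hs) g z).
Local Notation A g z := (sqlen (der1_map hs) g z).
Local Notation S g z := (sqlen (der2_map hs) g z).
Implicit Types (g u v : H) (i j : 'I_m) (z : Z).

Lemma energy_densityE g z : regular hs g ->
  energy_density hs g z = tp_density s g z.1 z.2 * mu_density g z.1 z.2.
Proof.
move=> reg; have [Q0 A0 S0] := regular_gt0 z reg.
rewrite tp_densityE (B1_densityE g g z reg) /normal_part dot_expand -sqlen_der1E.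
transitivity (weight hs g z * ((\sum_i nrem_coord g i z * nrem_coord g i z) * A g z -
   (\sum_i der_coord g i z.1 * nrem_coord g i z) ^+ 2)).
  rewrite sqlen_der1E -energy_sum; apply: eq_bigr => i _; apply: eq_bigr => j _.
  by rewrite (pkernelE hs j j g z) (pkernelE hs i j g z).
have -> : \sum_i nrem_coord g i z * der_coord g i z.1 = \sum_i der_coord g i z.1 * nrem_coord g i z.
  by apply: eq_bigr => i _; rewrite mulrC.
rewrite /tangential.
move: (weight hs g z) (A g z) A0 (\sum_i _) (\sum_i _) => w a a0 N T.
by field; rewrite gt_eqF.
Qed.

(** Both sides are expressed through the scalar products of g' and u' and of the
    remainders of g and u.  The logarithmic derivative of the weight produces B2
    and the parts of B3; its term in g'(x) has the opposite sign of the one in B3,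
    and the derivatives of the projection account for the difference. *)
Lemma energy_density_derE g u z : regular hs g ->
  energy_density_der hs g u z =
  2 * (B1_density s g g u z.1 z.2 * mu_density g z.1 z.2) -
  (2 * s + 1) * (B2_density s g g u z.1 z.2 * mu_density g z.1 z.2) +
  B3_density s g g u z.1 z.2 * mu_density g z.1 z.2.
Proof.
move=> reg; have [Q0 A0 S0] := regular_gt0 z reg.
rewrite (B2_densityE hs g g u z) (B3_densityE hs g g u z) -(energy_densityE z reg).
rewrite (B1_densityE g u z reg) /normal_part dot_expand.
have eE : energy_density hs g z =
    weight hs g z * ((\sum_i nrem_coord g i z * nrem_coord g i z) * A g z -
   (\sum_i der_coord g i z.1 * nrem_coord g i z) ^+ 2).
  rewrite sqlen_der1E -energy_sum; apply: eq_bigr => i _; apply: eq_bigr => j _.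
  by rewrite (pkernelE hs j j g z) (pkernelE hs i j g z).
transitivity (weight hs g z * (weight_der hs g u z *
    ((\sum_i nrem_coord g i z * nrem_coord g i z) * A g z -
     (\sum_i der_coord g i z.1 * nrem_coord g i z) ^+ 2) +
   2 * (\sum_i nrem_coord g i z * nrem_coord g i z) * (\sum_i der_coord g i z.1 * der_coord u i z.1) +
   2 * (\sum_i nrem_coord g i z * nrem_coord u i z) * A g z -
   2 * (\sum_i der_coord g i z.1 * nrem_coord g i z) * (\sum_i nrem_coord g i z * der_coord u i z.1) -
   2 * (\sum_i der_coord g i z.1 * nrem_coord g i z) * (\sum_i der_coord g i z.1 * nrem_coord u i z))).
  rewrite sqlen_der1E -energy_der_sum; apply: eq_bigr => i _; apply: eq_bigr => j _.
  by rewrite (pkernelE hs j j g z) (pkernelE hs i j g z).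
rewrite eE /weight_der /tangential.
move: (weight hs g z) (A g z) (Q g z) (S g z) A0 Q0 S0 => w a q b a0 q0 b0.
set N := \sum_i nrem_coord g i z * nrem_coord g i z.
set T := \sum_i der_coord g i z.1 * nrem_coord g i z.
set Y := \sum_i chord g i z * chord u i z.
set P := \sum_i der_coord g i z.1 * der_coord u i z.1.
set Y2 := \sum_i der_coord g i z.2 * der_coord u i z.2.
set M := \sum_i nrem_coord g i z * nrem_coord u i z.
set X1 := \sum_i nrem_coord g i z * der_coord u i z.1.
set X2 := \sum_i der_coord g i z.1 * nrem_coord u i z.
move: N T Y P Y2 M X1 X2 => N T Y P Y2 M X1 X2.
by field; rewrite ?gt_eqF.
Qed.

End FirstVariation.

Section Integrability.
Context {R : realType} (m : nat) (s : R) (hs : 3 / 2 < s).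
Local Notation Z := (measurableTypeR R * measurableTypeR R)%type.
Local Notation bm := (@bmf R _ Z).
Local Notation H := (sobolev m s).
Local Notation Q g z := (sqlen (chord_map hs) g z).
Local Notation A g z := (sqlen (der1_map hs) g z).
Local Notation S g z := (sqlen (der2_map hs) g z).
Implicit Types (g u v : H) (i j : 'I_m) (z : Z).

Lemma tp_L1 g : regular hs g -> L1 (fun z : Z => tp_density s g z.1 z.2 * mu_density g z.1 z.2).
Proof.
by move=> reg; apply: eq_L1 (energy_density_L1 hs g) => z; rewrite energy_densityE.
Qed.

Lemma energyE g : regular hs g -> energy m s g = model_energy hs g.
Proof.
move=> reg; rewrite model_energyE; congr Int.
by apply/funext => z; rewrite energy_densityE.
Qed.

Lemma inv_bounded (k : bm) z : bpos k -> bpow (-1) k z = (k z)^-1.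
Proof. by move=> pk; rewrite (bpowE _ z pk) powR_inv1// ltW// bpos_gt0. Qed.

Lemma normal_part_L2 g u i : regular hs g -> L2 (normal_part hs g u i).
Proof.
move=> [_ pA _].
have LT : L2 (fun z => \sum_j der1_map hs j g z * nrem_coord g j z).
  by apply: L2_sum => j; apply: bmulL2; exact: nrem_L2.
have Lt := bmulL2 (der1_map hs i u) (bmulL2 (bpow (-1) (sqlen (der1_map hs) g)) LT).
apply: eq_L2 (L2D (nrem_L2 hs u i) (L2N Lt)) => z.
rewrite /normal_part /tangential (inv_bounded z pA) (der1_mapE hs i u z).
have -> : \sum_j der1_map hs j g z * nrem_coord g j z =
    \sum_j der_coord g j z.1 * nrem_coord g j z.
  by apply: eq_bigr => j _; rewrite (der1_mapE hs j g z).
by rewrite [X in _ - _ * X]mulrC.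
Qed.

Lemma B1_L1 g u v : regular hs g ->
  L1 (fun z : Z => B1_density s g u v z.1 z.2 * mu_density g z.1 z.2).
Proof.
move=> reg.
have LN : L1 (fun z => \sum_i normal_part hs g u i z * normal_part hs g v i z).
  by apply: L1_sum => i; apply: L2M_L1; exact: normal_part_L2.
apply: eq_L1 (bmulL1 (bmul (weight hs g) (sqlen (der1_map hs) g)) LN) => z.
by rewrite (B1_densityE u v z reg) bmulE.
Qed.

Let quotient (L : 'I_m -> blin H bm) g u v : bm :=
  bmul (\sum_i bmul (L i u) (L i v)) (bpow (-1) (sqlen L g)).

Let quotientE (L : 'I_m -> blin H bm) g u v z : bpos (sqlen L g) ->
  quotient L g u v z = (\sum_i L i u z * L i v z) / sqlen L g z.
Proof.
move=> pL; apply: (eq_trans (bmulE _ _ z)); rewrite (inv_bounded z pL); congr (_ / _).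
by rewrite bmf_sum; apply: eq_bigr => i _; rewrite bmulE.
Qed.

Lemma B2_L1 g u v : regular hs g ->
  L1 (fun z : Z => B2_density s g u v z.1 z.2 * mu_density g z.1 z.2).
Proof.
move=> reg; have [pQ _ _] := reg.
apply: eq_L1 (bmulL1 (quotient (chord_map hs) g u v) (tp_L1 reg)) => z.
rewrite (B2_densityE hs g u v z) (quotientE u v z pQ) mulrC; congr (_ * (_ / _)).
by apply: eq_bigr => i _; rewrite (chord_mapE hs i u z) (chord_mapE hs i v z).
Qed.

Lemma B3_L1 g u v : regular hs g ->
  L1 (fun z : Z => B3_density s g u v z.1 z.2 * mu_density g z.1 z.2).
Proof.
move=> reg; have [_ pA pS] := reg; have tpL := tp_L1 reg.
have L := L1D (bmulL1 (quotient (der1_map hs) g u v) tpL)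
  (bmulL1 (quotient (der2_map hs) g u v) tpL).
apply: eq_L1 L => z.
rewrite (B3_densityE hs g u v z) (quotientE u v z pA) (quotientE u v z pS).
rewrite -mulrDl mulrC; congr (_ * (_ / _ + _ / _)).
  by apply: eq_bigr => i _; rewrite (der1_mapE hs i u z) (der1_mapE hs i v z).
by apply: eq_bigr => i _; rewrite (der2_mapE hs i u z) (der2_mapE hs i v z).
Qed.

Lemma Int_energy_density_der g u : regular hs g ->
  Int (energy_density_der hs g u) = 2 * B1 s g g u - (2 * s + 1) * B2 s g g u + B3 s g g u.
Proof.
move=> reg; have b1 := B1_L1 g u reg; have b2 := B2_L1 g u reg; have b3 := B3_L1 g u reg.
transitivity (Int (fun z : Z => 2 * (B1_density s g g u z.1 z.2 * mu_density g z.1 z.2) -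
  (2 * s + 1) * (B2_density s g g u z.1 z.2 * mu_density g z.1 z.2) +
  B3_density s g g u z.1 z.2 * mu_density g z.1 z.2)).
  by congr Int; apply/funext => z; rewrite energy_density_derE.
rewrite (IntD (L1B (L1Z 2 b1) (L1Z (2 * s + 1) b2)) b3).
by rewrite (IntB (L1Z 2 b1) (L1Z (2 * s + 1) b2)) (IntZ 2 b1) (IntZ _ b2).
Qed.

Lemma energy_near g : regular hs g -> \forall u \near g, model_energy hs u = energy m s u.
Proof.
move=> reg; apply: filterS (regular_near reg) => u ru.
by rewrite energyE.
Qed.

End Integrability.

Theorem theorem4p6 (R : realType) (m : nat) (s : R) (hs : 3 / 2 < s < 2) :
  [/\ forall g : sobolev m s, embeddings m s g ->
        mu_integrable g (tp_density s g),
      smooth_on (embeddings m s) (energy m s)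
    & forall g u : sobolev m s, embeddings m s g ->
        [/\ mu_integrable g (B1_density s g g u),
            mu_integrable g (B2_density s g g u),
            mu_integrable g (B3_density s g g u)
          & let p := 2 * s + 1 in
            'd (energy m s) g u =
              2 * B1 s g g u - p * B2 s g g u + B3 s g g u]].
Proof.
have /andP[hs1 _] := hs.
have reg (g : sobolev m s) : embeddings m s g -> regular hs1 g by exact: embedding_regular.
split=> [g /reg rg| |g u /reg rg].
- exact: (tp_L1 rg).
- apply: smooth_local (model_energy_smooth reg) => g /reg; exact: energy_near.
split; [exact: (B1_L1 g u rg)|exact: (B2_L1 g u rg)|exact: (B3_L1 g u rg)|move=> p].
have [[F dF FE] _] := model_energy_has_dir rg.
have dE : is_diff g (energy m s) F := is_diff_near (energy_near rg) dF.
by rewrite (@diff_val _ _ _ _ _ _ _ dE) FE (Int_energy_density_der u rg).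
Qed.
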